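(* For every $p$ that is a prime number or zero, the theory $\mathrm{ACFC}_p$ is complete.
   Context: A character $\chi:F\to K$ between integral domains is a map with $\chi(ab)=\chi(a)\chi(b)$ for all $a,b\in F$, $\chi(0)=0$ and $\chi(1)=1$. A structure $(F,K;\chi)$ of this kind is a structure in the $2$-sorted language $L$, which consists of two disjoint copies of the language of rings (one for each sort) augmented by a unary function symbol $\chi$ from the first sort to the second. For $n\ge 1$, $\alpha\in F^n$ and $k\in\mathbb{N}^n$ put $\alpha^k=\alpha_1^{k_1}\cdots\alpha_n^{k_n}$. The tuple $\alpha$ is multiplicatively dependent if $\alpha^k=\alpha^l$ for some distinct $k,l\in\mathbb{N}^n$, and multiplicatively independent otherwise. A character $\chi:F\to K$ is generic if it is injective and, for every $n\ge1$ and every multiplicatively independent $\alpha\in F^n$, the tuple $\chi(\alpha)=(\chi(\alpha_1),\dots,\chi(\alpha_n))$ is algebraically independent, in the fraction field of $K$, over its prime field. $\mathrm{ACFC}$ is a recursive set of $\forall\exists$-sentences of $L$ whose models are exactly the structures $(F,K;\chi)$ with $F,K$ algebraically closed fields, $\mathrm{char}(K)=0$ and $\chi$ a generic character. For $p$ prime or zero, $\mathrm{ACFC}_p$ is $\mathrm{ACFC}$ together with sentences expressing $\mathrm{char}(F)=p$. *)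

(* Defs.v *)
From HB Require Import structures.
From mathcomp Require Import all_boot all_order all_algebra.
From mathcomp Require Import mpoly.

Set Implicit Arguments.
Unset Strict Implicit.
Unset Printing Implicit Defensive.

Import GRing.Theory.
Local Open Scope ring_scope.

(** * Structures of the two-sorted language L *)

(* The language of rings is {0, 1, +, -, *} with a unary minus.  No axiom is
   imposed here: these are arbitrary structures. *)
Record ring_structure : Type := RingStructure {
  carrier :> Type;
  zeroS : carrier;
  oneS : carrier;
  addS : carrier -> carrier -> carrier;
  oppS : carrier -> carrier;
  mulS : carrier -> carrier -> carrier
}.

Record Lstructure : Type := LStructure {
  sortF : ring_structure;
  sortK : ring_structure;
  charS : sortF -> sortK
}.

Definition ring_structure_of (R : nzRingType) : ring_structure :=
  RingStructure 0 1 (fun x y : R => x + y) (fun x : R => - x)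
    (fun x y : R => x * y).

Definition Lstructure_of (F K : nzRingType) (chi : F -> K) : Lstructure :=
  @LStructure (ring_structure_of F) (ring_structure_of K) chi.

(** * First-order syntax and semantics *)

(* [formula n m] has its free variables among n variables of the first sort
   and m variables of the second (well-scoped de Bruijn indices); the variable
   bound by a quantifier has index [ord0] in the body. *)
Inductive termF (n : nat) : Type :=
| FVar of 'I_n
| FZero
| FOne
| FAdd of termF n & termF n
| FOpp of termF n
| FMul of termF n & termF n.

Inductive termK (n m : nat) : Type :=
| KVar of 'I_m
| KZero
| KOne
| KAdd of termK n m & termK n m
| KOpp of termK n m
| KMul of termK n m & termK n m
| KChi of termF n.

(* The other connectives and the universal quantifiers are the usual
   abbreviations. *)
Inductive formula (n m : nat) : Type :=
| EqF of termF n & termF n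
| EqK of termK n m & termK n m
| Not of formula n m
| And of formula n m & formula n m
| ExF of formula n.+1 m
| ExK of formula n m.+1.

Arguments FZero {n}.
Arguments FOne {n}.
Arguments KZero {n m}.
Arguments KOne {n m}.
Arguments EqF {n m}.

Definition sentence : Type := formula 0 0.

Definition extend (T : Type) (n : nat) (x : T) (v : 'I_n -> T) (i : 'I_n.+1) : T :=
  if unlift ord0 i is Some j then v j else x.

Fixpoint evalF (M : Lstructure) (n : nat) (v : 'I_n -> sortF M) (t : termF n) :
    sortF M :=
  match t with
  | FVar i => v i
  | FZero => zeroS (sortF M)
  | FOne => oneS (sortF M)
  | FAdd t1 t2 => addS (evalF v t1) (evalF v t2)
  | FOpp t1 => oppS (evalF v t1)
  | FMul t1 t2 => mulS (evalF v t1) (evalF v t2)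
  end.

Fixpoint evalK (M : Lstructure) (n m : nat) (v : 'I_n -> sortF M)
    (w : 'I_m -> sortK M) (t : termK n m) : sortK M :=
  match t with
  | KVar i => w i
  | KZero => zeroS (sortK M)
  | KOne => oneS (sortK M)
  | KAdd t1 t2 => addS (evalK v w t1) (evalK v w t2)
  | KOpp t1 => oppS (evalK v w t1)
  | KMul t1 t2 => mulS (evalK v w t1) (evalK v w t2)
  | KChi t1 => charS (evalF v t1)
  end.

Fixpoint holds (M : Lstructure) (n m : nat) (v : 'I_n -> sortF M)
    (w : 'I_m -> sortK M) (phi : formula n m) : Prop :=
  match phi with
  | EqF t1 t2 => evalF v t1 = evalF v t2
  | EqK t1 t2 => evalK v w t1 = evalK v w t2
  | Not phi1 => ~ holds v w phi1
  | And phi1 phi2 => holds v w phi1 /\ holds v w phi2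
  | ExF phi1 => exists x : sortF M, holds (extend x v) w phi1
  | ExK phi1 => exists y : sortK M, holds v (extend y w) phi1
  end.

Definition empty_env (T : Type) (i : 'I_0) : T :=
  match notF (ltn_ord i) return T with end.

Definition satisfies (M : Lstructure) (phi : sentence) : Prop :=
  holds (@empty_env (sortF M)) (@empty_env (sortK M)) phi.

(** * Theories *)

Definition theory : Type := sentence -> Prop.

Definition models (M : Lstructure) (T : theory) : Prop :=
  forall phi : sentence, T phi -> satisfies M phi.

Definition entails (T : theory) (phi : sentence) : Prop :=
  forall M : Lstructure, models M T -> satisfies M phi.

Definition consistent (T : theory) : Prop := exists M : Lstructure, models M T.

Definition complete (T : theory) : Prop :=
  consistent T /\ forall phi : sentence, entails T phi \/ entails T (Not phi).

(** * Generic characters *)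

Definition character (F K : idomainType) (chi : F -> K) : Prop :=
  [/\ forall a b : F, chi (a * b) = chi a * chi b, chi 0 = 0 & chi 1 = 1].

Definition mult_dependent (F : idomainType) (n : nat) (alpha : 'I_n -> F) : Prop :=
  exists k l : 'X_{1..n},
    k <> l /\ \prod_(i < n) alpha i ^+ k i = \prod_(i < n) alpha i ^+ l i.

Definition mult_independent (F : idomainType) (n : nat) (alpha : 'I_n -> F) : Prop :=
  ~ mult_dependent alpha.

(* The prime field of E is its smallest subfield. *)
Definition in_prime_field (E : fieldType) (x : E) : Prop :=
  forall S : {pred E}, GRing.divring_closed S -> x \in S.

Definition alg_independent (E : fieldType) (n : nat) (x : 'I_n -> E) : Prop :=
  forall P : {mpoly E[n]},
    (forall m : 'X_{1..n}, in_prime_field P@_m) -> P != 0 -> P.@[x] != 0.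

Definition generic (F K : idomainType) (chi : F -> K) : Prop :=
  injective chi /\
  forall (n : nat) (alpha : 'I_n -> F), (0 < n)%N -> mult_independent alpha ->
    alg_independent (fun i => FracField.tofrac (chi (alpha i)) : {fraction K}).

(** * ACFC and ACFC_p *)

Definition is_model_of_ACFC (M : Lstructure) : Prop :=
  exists (F K : closedFieldType) (chi : F -> K),
    [/\ M = Lstructure_of chi, [pchar K] =i pred0, character chi & generic chi].

(* Only the class of its models matters for an axiomatization ACFC, so its
   recursiveness and the shape of its axioms are not required. *)
Definition axiomatizes_ACFC (ACFC : theory) : Prop :=
  forall M : Lstructure, models M ACFC <-> is_model_of_ACFC M.

Fixpoint numeralF (q : nat) : termF 0 :=
  if q is q'.+1 then FAdd (numeralF q') FOne else FZero.

Definition char_axioms (p : nat) : theory := fun phi : sentence =>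
  if p is 0 then
    exists q : nat, prime q /\ phi = Not (EqF (numeralF q) FZero)
  else phi = EqF (numeralF p) FZero.

Definition ACFC_p (ACFC : theory) (p : nat) : theory := fun phi : sentence =>
  ACFC phi \/ char_axioms p phi.

(* Main.v *)
Require Import Defs.
From HB Require Import structures.
From mathcomp Require Import all_boot all_algebra all_field.
From mathcomp Require Import boolp classical_sets filter.
From mathcomp Require Import mpoly ring.

Set Implicit Arguments.
Unset Strict Implicit.
Unset Printing Implicit Defensive.
Import GRing.Theory.
Local Open Scope ring_scope.

(** A generic character leaves no freedom.  It sends a root of unity to a root of
    unity of the same order, unique up to conjugacy over the rationals, and it
    sends multiplicatively independent elements to algebraically independent
    ones; so the subfield of [K] generated by the range of [chi] is determined by
    the multiplicative group of [F].  As [F] is determined by its characteristic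
    and its transcendence degree, and [K] by its transcendence degree over the
    range, two models of the same characteristic in which both degrees are
    infinite ought to be elementarily equivalent, and every model ought to be
    elementarily equivalent to such a model.

    For the first point the Ehrenfeucht-Fraisse game is played with pairs of
    partial isomorphisms, one for each sort, commuting with [chi] ([game]).  The
    invariant, [strong], says that over the part of [K] reached so far [chi] is
    as independent as it can be: for every pure subgroup [H] of the
    multiplicative group that contains the part of [F] reached so far, and every
    [g] outside [H], the value [chi g] is transcendental over that part of [K] and
    [chi H].  The ring generated by that part and the range of [chi] is then
    graded by the cosets of the part of [F] ([strong_graded]), whence all linear
    relations between new values of [chi] transfer ([chi_extend]).  The game
    starts because primitive roots of unity of equal order are conjugate
    ([initial_state]).

    For the second point [K] may well be algebraic over the range of [chi], and
    the infinite degree has to come from an ultrapower, which is a model again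
    by the theorem of Los.  If [t] has infinite order, [(1 + chi t) ^+ N] is not a
    root of any nonzero polynomial whose coefficients are sums of at most [N]
    integer multiples of values of [chi] ([binomial_avoid]): in characteristic
    zero a polynomial with at most [N] terms cannot vanish to order [N] at a
    nonzero point ([sparse_root]).  Letting [N] grow along the ultrapower makes
    such powers transcendental over the range ([ultrapower_wideK]).

    It remains to produce models.  In the algebraic closure of a finite prime
    field all nonzero elements are roots of unity, so that an injective character
    into the algebraic numbers exists ([torsion_character]) and is generic for
    want of independent elements; characteristic zero is reached by an
    ultraproduct over the primes ([ACFC_p_consistent]). *)

(** * Subrings given as sets *)

Definition subring_set (R : nzRingType) (S : R -> Prop) :=
  [/\ S 1, forall x y, S x -> S y -> S (x - y)
    & forall x y, S x -> S y -> S (x * y)].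

Definition coefs_in (R : nzRingType) (S : R -> Prop) (p : {poly R}) :=
  forall i, S p`_i.

Section SubringSet.
Variable R : nzRingType.
Implicit Types (S : R -> Prop) (x y : R) (p q : {poly R}).
Variables (S : R -> Prop) (ringS : subring_set S).

Lemma subring1 : S 1. Proof. by case: ringS. Qed.
Lemma subringB x y : S x -> S y -> S (x - y). Proof. by case: ringS => _ h _; apply: h. Qed.
Lemma subringM x y : S x -> S y -> S (x * y). Proof. by case: ringS => _ _; apply. Qed.
Lemma subring0 : S 0. Proof. by rewrite -(subrr 1); apply: subringB; apply: subring1. Qed.
Lemma subringN x : S x -> S (- x).
Proof. by rewrite -sub0r; apply: subringB; apply: subring0. Qed.
Lemma subringD x y : S x -> S y -> S (x + y).
Proof. by rewrite -{2}[y]opprK => Sx Sy; apply/subringB/subringN. Qed.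
Lemma subringX x n : S x -> S (x ^+ n).
Proof.
by move=> Sx; elim: n => [|n IH]; [apply: subring1 | rewrite exprS; apply: subringM].
Qed.
Lemma subring_sum I (r : seq I) (P : pred I) (f : I -> R) :
  (forall i, P i -> S (f i)) -> S (\sum_(i <- r | P i) f i).
Proof. by move=> Sf; apply: big_ind => //; [apply: subring0 | apply: subringD]. Qed.
Lemma subring_int (k : int) : S k%:~R.
Proof.
have Sn n : S n%:R by elim: n => [|n IH]; [apply: subring0 | rewrite mulrS; apply: subringD subring1 IH].
by case: k => n; rewrite ?NegzE ?mulrNz; [|apply: subringN]; rewrite -pmulrn.
Qed.
Lemma subring_horner p x : coefs_in S p -> S x -> S p.[x].
Proof.
move=> Sp Sx; rewrite horner_coef.
by apply: subring_sum => i _; apply: subringM => //; apply: subringX.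
Qed.
Lemma coefs_inC x : S x -> coefs_in S x%:P.
Proof. by move=> Sx i; rewrite coefC; case: eqP => // _; apply: subring0. Qed.
Lemma coefs_inX n : coefs_in S 'X^n.
Proof. by move=> i; rewrite coefXn; case: eqP => // _; [apply: subring1|apply: subring0]. Qed.
Lemma coefs_in_subring : subring_set (coefs_in S).
Proof.
split=> [|p q Sp Sq i|p q Sp Sq i].
- exact: (coefs_inX 0).
- by rewrite coefB; apply: subringB.
- by rewrite coefM; apply: subring_sum => j _; apply: subringM.
Qed.
End SubringSet.

Lemma subring_image (R R' : nzRingType) (f : {rmorphism R -> R'}) S :
  subring_set S -> subring_set (fun y => exists2 x, S x & f x = y).
Proof.
move=> rS; split=> [|_ _ [x Sx <-] [y Sy <-]|_ _ [x Sx <-] [y Sy <-]].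
- by exists 1; [apply: subring1 | rewrite rmorph1].
- by exists (x - y); [apply: subringB | rewrite rmorphB].
- by exists (x * y); [apply: subringM | rewrite rmorphM].
Qed.

Lemma coefs_in_lift (R R' : nzRingType) (f : {rmorphism R -> R'})
    (S : R -> Prop) (p : {poly R'}) :
  S 0 -> coefs_in (fun y => exists2 x, S x & f x = y) p ->
  exists2 q : {poly R}, coefs_in S q & map_poly f q = p.
Proof.
move=> S0 hp; have /choice[g gP] : forall i, exists x, S x /\ f x = p`_i.
  by move=> i; have [x] := hp i; exists x.
exists (\poly_(i < size p) g i).
  by move=> i; rewrite coef_poly; case: ifP => // _; apply: (proj1 (gP i)).
apply/polyP => i; rewrite coef_map coef_poly.
case: ltnP => h; first by case: (gP i).
by rewrite [RHS]nth_default //; apply: rmorph0.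
Qed.

(** * Relative algebraic closure *)
Section Subfield.
Variables (K : fieldType) (S : {pred K}) (divS : GRing.divring_closed S).
HB.instance Definition _ := GRing.isDivringClosed.Build K S divS.
Record subfield_of := SubfieldOf { sf_val :> K; sf_valP : sf_val \in S }.
HB.instance Definition _ := [isSub for sf_val].
HB.instance Definition _ := [Choice of subfield_of by <:].
HB.instance Definition _ := [SubChoice_isSubIntegralDomain of subfield_of by <:].
HB.instance Definition _ := [SubIntegralDomain_isSubField of subfield_of by <:].

(** Lets results on elements algebraic over a field apply to a subfield that is
    given as a predicate. *)
Lemma subfield_as_type : exists (D : fieldType) (i : {rmorphism D -> K}),
  forall x, x \in S <-> exists d, i d = x.
Proof.
exists subfield_of; exists (val : {rmorphism subfield_of -> K}) => x; split.
  by move=> Sx; exists (SubfieldOf Sx).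
by case=> d <-; apply: sf_valP.
Qed.
End Subfield.

Section Closure.
Variable K : fieldType.
Implicit Types (A B S R : K -> Prop) (x y z : K) (p q : {poly K}).

Definition alg_over S x := exists p, [/\ p != 0, coefs_in S p & root p x].

Definition algclosed_in A := subring_set A /\ forall x, alg_over A x -> A x.

(** As an intersection the closure is idempotent and monotone by construction;
    [acl_alg] recovers the description by polynomials over a subring. *)
Definition acl S x := forall A, algclosed_in A -> (forall y, S y -> A y) -> A x.

Lemma acl_sub S x : S x -> acl S x. Proof. by move=> Sx A _; apply. Qed.

Lemma acl_min S A : algclosed_in A -> (forall y, S y -> A y) -> forall x, acl S x -> A x.
Proof. by move=> cA SA x; apply. Qed.

Lemma acl_closed S : algclosed_in (acl S).
Proof.
split; first split.
- by move=> A cA _; apply: subring1; case: cA.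
- by move=> x y Sx Sy A cA SA; apply: subringB; [case: cA|apply: Sx|apply: Sy].
- by move=> x y Sx Sy A cA SA; apply: subringM; [case: cA|apply: Sx|apply: Sy].
move=> x [p [p0 Sp px]] A cA SA; apply: (proj2 cA); exists p; split=> // i.
exact: Sp.
Qed.

Lemma acl_ring S : subring_set (acl S). Proof. by case: (acl_closed S). Qed.

Lemma acl_mono S T : (forall y, S y -> acl T y) -> forall x, acl S x -> acl T x.
Proof. by move=> ST; apply: acl_min => //; apply: acl_closed. Qed.

Lemma aclS S T : (forall y, S y -> T y) -> forall x, acl S x -> acl T x.
Proof. by move=> ST; apply: acl_mono => y /ST; apply: acl_sub. Qed.

Lemma acl_id A : algclosed_in A -> forall x, acl A x -> A x.
Proof. by move=> cA; apply: acl_min. Qed.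

Section ClosedIn.
Variables (A : K -> Prop) (cA : algclosed_in A).
Lemma algclosed_root p x : p != 0 -> coefs_in A p -> root p x -> A x.
Proof. by move=> p0 Ap px; apply: (proj2 cA); exists p. Qed.

Lemma algclosed_inv x : A x -> A x^-1.
Proof.
have rA := proj1 cA => Ax; have [->|x0] := eqVneq x 0.
  by rewrite invr0; apply: subring0.
apply: (@algclosed_root (x *: 'X - 1)).
- apply: contra_neq x0 => /(congr1 (coefp 1)) /=.
  by rewrite coefB coefZ coefX coefC coefC /= subr0 mulr1.
- apply: (subringB (coefs_in_subring rA)); last exact: (coefs_inX rA 0).
  by move=> i; rewrite coefZ; apply: subringM => //; apply: (coefs_inX rA 1).
- by rewrite rootE !hornerE mulfV ?subrr.
Qed.

Lemma algclosed_div x y : A x -> A y -> A (x / y).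
Proof. by move=> Ax Ay; apply: subringM (proj1 cA) _ _ Ax _; apply: algclosed_inv. Qed.

Lemma algclosed_expr x n : (0 < n)%N -> A (x ^+ n) -> A x.
Proof.
have rA := proj1 cA; move=> n0 Axn; apply: (@algclosed_root ('X^n - (x ^+ n)%:P)).
- by rewrite -size_poly_eq0 size_XnsubC.
- by apply: (subringB (coefs_in_subring rA)); [apply: coefs_inX | apply: coefs_inC].
- by rewrite rootE !hornerE ?hornerXn subrr.
Qed.
End ClosedIn.

Lemma acl_alg_over S x : alg_over S x -> acl S x.
Proof.
case=> p [p0 Sp px]; apply: (algclosed_root (acl_closed S) p0 _ px) => i.
by apply: acl_sub; apply: Sp.
Qed.

(** Clearing denominators identifies algebraicity over a subring with
    algebraicity over its field of fractions; over a field algebraic elements are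
    integral, and integral dependence is transitive. *)
Lemma alg_over_closed R : subring_set R -> algclosed_in (alg_over R).
Proof.
move=> rR; pose Q : {pred K} := fun x => `[< exists a b, [/\ R a, R b, b != 0 & x = a / b] >].
have QP x : x \in Q <-> exists a b, [/\ R a, R b, b != 0 & x = a / b].
  by split=> [/asboolP|?]; last apply/asboolP.
have divQ : GRing.divring_closed Q.
  split.
  - by apply/QP; exists 1, 1; rewrite oner_eq0 divr1; split=> //; apply: subring1.
  - move=> _ _ /QP[a [b [Ra Rb b0 ->]]] /QP[c [d [Rc Rd d0 ->]]]; apply/QP.
    exists (a * d - c * b), (b * d); split.
    + by apply: subringB => //; apply: subringM.
    + exact: subringM.
    + exact: mulf_neq0.
    + by rewrite -mulNr addf_div // mulNr.
  - move=> _ _ /QP[a [b [Ra Rb b0 ->]]] /QP[c [d [Rc Rd d0 ->]]]; apply/QP.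
    have [->|c0] := eqVneq c 0.
      exists 0, 1; rewrite oner_eq0 mul0r invr0 mulr0 mul0r; split=> //.
      - exact: subring0.
      - exact: subring1.
    exists (a * d), (b * c); split; [exact: subringM|exact: subringM|exact: mulf_neq0|].
    by rewrite invf_div mulf_div.
have [D [i iP]] := subfield_as_type divQ.
have inR x : R x -> exists d, i d = x.
  move=> Rx; apply/iP/QP; exists x, 1; rewrite divr1 oner_eq0; split=> //; exact: subring1.
have algP x : alg_over R x <-> algebraicOver i x.
  split.
    case=> p [p0 Rp px].
    have [|q _ qp] := @coefs_in_lift _ _ i (fun _ => True) p I.
      by move=> j; have [d dE] := inR _ (Rp j); exists d.
    exists q; last by rewrite qp.
    by apply: contra_neq p0 => q0; rewrite -qp q0 rmorph0.
  case=> q q0 qx.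
  have [c [c0 Rc Rcq]] : exists c, [/\ c != 0, R c & forall j, R (c * i q`_j)].
    have [s sP] : exists s : {poly D}, s = q by exists q.
    rewrite -sP; elim/poly_ind: s {sP} => [|s d [c [c0 Rc IH]]].
      exists 1; rewrite oner_eq0; split=> //; first exact: subring1.
      by move=> j; rewrite coef0 rmorph0 mulr0; apply: subring0.
    have /QP[a [b [Ra Rb b0 dE]]] : i d \in Q by apply/iP; exists d.
    exists (c * b); split; [exact: mulf_neq0|exact: subringM|] => j.
    rewrite coefD coefMX coefC; case: j => [|j] /=.
      rewrite add0r dE -mulrA [b * _]mulrC divfK //; exact: subringM.
    by rewrite addr0 mulrAC; apply: subringM.
  exists (c *: map_poly i q); split.
  - by rewrite scaler_eq0 negb_or c0 map_poly_eq0.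
  - by move=> j; rewrite coefZ coef_map; apply: Rcq.
  - by rewrite rootE hornerZ (rootP qx) mulr0.
split; first split.
- by apply/algP; apply: algebraic1.
- by move=> x y /algP hx /algP hy; apply/algP; apply: algebraic_sub.
- by move=> x y /algP hx /algP hy; apply/algP; apply: algebraic_mul.
move=> x [p [p0 hp px]]; apply/algP/integral_algebraic/(integral_root p0 px).
by move=> _ /(nthP 0)[j _ <-]; apply/integral_algebraic/algP/hp.
Qed.

Lemma acl_alg R : subring_set R -> forall x, acl R x -> alg_over R x.
Proof.
move=> rR; apply: acl_min (alg_over_closed rR) _ => y Ry.
exists ('X - y%:P); split; rewrite ?polyXsubC_eq0 ?root_XsubC //.
by apply: (subringB (coefs_in_subring rR)); [apply: (coefs_inX rR 1)|apply: coefs_inC].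
Qed.

Definition adjoin_set S x : K -> Prop := fun y => S y \/ y = x.

(** A polynomial relation between [x] and [y] over [acl S], read as a polynomial
    in [y], has coefficients algebraic over [S] and [x]; these cannot all vanish
    because [x] is transcendental. *)
Lemma acl_exchange S x y :
  acl (adjoin_set S y) x -> ~ acl S x -> acl (adjoin_set S x) y.
Proof.
move=> xSy nSx; pose A := acl S; have rA : subring_set A := acl_ring S.
pose R z := exists2 q, coefs_in A q & q.[y] = z.
have rR : subring_set R := subring_image (horner_eval y) (coefs_in_subring rA).
have {xSy} /(acl_alg rR)[p [p0 Rp px]] : acl R x.
  apply: aclS xSy => z [Sz|->].
    by exists z%:P; rewrite ?hornerC //; apply: coefs_inC => //; apply: acl_sub.
  by exists 'X; rewrite ?hornerX //; apply: (coefs_inX rA 1).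
have [Q AQ Qp] :=
  @coefs_in_lift _ _ (horner_eval y) _ p (subring0 (coefs_in_subring rA)) Rp.
(* [Q(Y, X)] is a polynomial over [acl S] with [Q(y, X) = p]; its other
   specialization [r = Q(Y, x)] has the root [y]. *)
pose r : {poly K} := Q.[x%:P].
have ry : root r y.
  have /rootP px0 := px; apply/rootP; rewrite -horner2_swapXY -px0 -Qp.
  by rewrite -[in RHS](swapXYK Q) -horner_polyC.
have sQ j : coefs_in A (swapXY Q)`_j by move=> i; rewrite coef_swapXY; apply: AQ.
have rE j : r`_j = ((swapXY Q)`_j).[x].
  by rewrite /r horner_polyC coef_map_id0 /horner_eval ?horner0.
have [r0|nz_r] := eqVneq r 0; last first.
  apply: (algclosed_root (acl_closed _) nz_r _ ry) => j; rewrite rE.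
  apply: (subring_horner (acl_ring _)); last by apply: acl_sub; right.
  by move=> i; apply: aclS (sQ j i) => z; left.
case: nSx; apply: (algclosed_root (acl_closed S) (p := lead_coef (swapXY Q))).
- rewrite lead_coef_eq0 swapXY_eq0; apply: contra_neq p0 => Q0.
  by rewrite -Qp Q0 rmorph0.
- exact: sQ.
- by rewrite rootE lead_coefE -rE r0 coef0.
Qed.
End Closure.

Lemma exists_min (T : Type) (P : T -> Prop) (f : T -> nat) :
  (exists x, P x) -> exists2 x, P x & forall y, P y -> (f x <= f y)%N.
Proof.
case=> x0 Px0.
pose Q n := `[< exists2 x, P x & f x = n >].
have exQ : exists n, Q n by exists (f x0); apply/asboolP; exists x0.
case: (ex_minnP exQ) => n /asboolP[x Px <-] min.
by exists x => // y Py; apply: min; apply/asboolP; exists y.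
Qed.

Section Matroid.
Variable K : fieldType.
Implicit Types (S : K -> Prop) (x : K) (s : seq K).

(** The elements algebraic over some finite part of [S] already form a
    relatively algebraically closed subfield. *)
Lemma acl_fin S x : acl S x ->
  exists2 s : seq K, (forall y, y \in s -> S y) & acl (fun y => y \in s) x.
Proof.
pose A x := exists2 s : seq K, (forall y, y \in s -> S y) & acl (fun y => y \in s) x.
have catA s1 s2 : (forall y, y \in s1 -> S y) -> (forall y, y \in s2 -> S y) ->
    forall y, y \in s1 ++ s2 -> S y.
  by move=> h1 h2 y; rewrite mem_cat => /orP[/h1|/h2].
apply: (@acl_min _ _ A) => [|y Sy]; last first.
  exists [:: y]; first by move=> z; rewrite inE => /eqP ->.
  by apply: acl_sub; rewrite inE.
have wl s1 s2 y : acl (fun z => z \in s1) y -> acl (fun z => z \in s1 ++ s2) y.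
  by apply: aclS => z h; rewrite mem_cat h.
have wr s1 s2 y : acl (fun z => z \in s2) y -> acl (fun z => z \in s1 ++ s2) y.
  by apply: aclS => z h; rewrite mem_cat h orbT.
split; first split.
- by exists [::] => //; apply: (subring1 (acl_ring _)).
- move=> y z [s1 h1 ?] [s2 h2 ?]; exists (s1 ++ s2); first exact: catA.
  by apply: (subringB (acl_ring _)); [apply: wl|apply: wr].
- move=> y z [s1 h1 ?] [s2 h2 ?]; exists (s1 ++ s2); first exact: catA.
  by apply: (subringM (acl_ring _)); [apply: wl|apply: wr].
move=> y [p [p0 hp py]].
have /choice[g gP] : forall i, exists s, (forall y, y \in s -> S y) /\
    acl (fun y => y \in s) p`_i.
  by move=> i; have [s] := hp i; exists s.
exists (flatten [seq g i | i <- iota 0 (size p)]).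
  by move=> z /flatten_mapP[i _]; apply: (proj1 (gP i)).
apply: (algclosed_root (acl_closed _) p0 _ py) => i.
have [ip|ip] := ltnP i (size p); last first.
  by rewrite nth_default //; apply: (subring0 (acl_ring _)).
apply: aclS (proj2 (gP i)) => z zg; apply/flatten_mapP; exists i => //.
by rewrite mem_iota.
Qed.

(** One new element can spoil the independence of only one member of an
    independent sequence, so a tail of the sequence stays independent. *)
Lemma indep_seq_avoid S (b : nat -> K) s :
  (forall n, ~ acl (fun y => S y \/ exists2 i, (i < n)%N & b i = y) (b n)) ->
  exists n, ~ acl (fun y => S y \/ y \in s) (b n).
Proof.
elim: s S b => [|x s IH] S b hb.
  exists 0%N; apply: contra_not (hb 0%N).
  by apply: aclS => y [Sy|//]; left.
have [hx|] := pselect (forall n, ~ acl (fun y => adjoin_set S x y \/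
    exists2 i, (i < n)%N & b i = y) (b n)).
  have [n hn] := IH _ _ hx; exists n; apply: contra_not hn.
  apply: aclS => y; rewrite inE /adjoin_set => -[Sy|/predU1P[->|ys]].
  - by left; left.
  - by left; right.
  - by right.
move=> /existsNP[n /contrapT hn].
have {hn} xin : acl (fun y => S y \/ exists2 i, (i < n.+1)%N & b i = y) x.
  pose T y := S y \/ exists2 i, (i < n)%N & b i = y.
  have : acl (adjoin_set T (b n)) x.
    apply: acl_exchange (hb n); apply: aclS hn => y.
    by rewrite /adjoin_set /T => -[[Sy|->]|ib]; [left; left|right|left; right].
  apply: aclS => y [[Sy|[i ltin <-]]|->]; [by left| |].
  - by right; exists i => //; apply: ltnW.
  - by right; exists n.
have /IH[m hm] : forall m, ~ acl (fun y => adjoin_set S x y \/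
    exists2 i, (i < m)%N & b (n.+1 + i)%N = y) (b (n.+1 + m)%N).
  move=> m; apply: contra_not (hb (n.+1 + m)%N).
  apply: acl_mono => y [[Sy|->]|[i im <-]].
  - by apply: acl_sub; left.
  - apply: aclS xin => z [Sz|[i ilt <-]]; [by left|right; exists i => //].
    by apply: leq_trans ilt _; rewrite leq_addr.
  - by apply: acl_sub; right; exists (n.+1 + i)%N => //; rewrite ltn_add2l.
exists (n.+1 + m)%N; apply: contra_not hm; apply: aclS => y.
rewrite inE /adjoin_set => -[Sy|/predU1P[->|ys]].
- by left; left.
- by left; right.
- by right.
Qed.
End Matroid.

(** * Partial isomorphisms *)

Section Piso.
Variables E E' : fieldType.
Implicit Types (S B : E * E' -> Prop) (q r : {poly (E * E')%type}).

(** An isomorphism between subrings is encoded by its graph, a subring of the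
    product ring: that the graph is functional in both directions means that its
    elements have both components zero or none.  Polynomials over the graph are
    polynomials over the product ring, of which the two projections give the two
    corresponding polynomials. *)
Definition piso S := subring_set S /\ forall z, S z -> (z.1 == 0) = (z.2 == 0).

Definition pdom S x := exists2 z, S z & z.1 = x.
Definition pcod S y := exists2 z, S z & z.2 = y.

Definition padjoin S z w := exists2 q, coefs_in S q & q.[z] = w.

Lemma horner_fst q z : (q.[z]).1 = (map_poly fst q).[z.1].
Proof. by rewrite (horner_map (fst : {rmorphism (E * E')%type -> E})). Qed.
Lemma horner_snd q z : (q.[z]).2 = (map_poly snd q).[z.2].
Proof. by rewrite (horner_map (snd : {rmorphism (E * E')%type -> E'})). Qed.

Lemma pdom_ring S : subring_set S -> subring_set (pdom S).
Proof. exact: (subring_image (fst : {rmorphism (E * E')%type -> E})). Qed.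
Lemma pcod_ring S : subring_set S -> subring_set (pcod S).
Proof. exact: (subring_image (snd : {rmorphism (E * E')%type -> E'})). Qed.

Lemma padjoin_ring S z : subring_set S -> subring_set (padjoin S z).
Proof.
by move=> rS; apply: (subring_image (horner_eval z)) (coefs_in_subring rS).
Qed.
Lemma padjoin_sub S z w : subring_set S -> S w -> padjoin S z w.
Proof. by move=> rS Sw; exists w%:P; rewrite ?hornerC //; apply: coefs_inC. Qed.
Lemma padjoin_gen S z : subring_set S -> padjoin S z z.
Proof. by move=> rS; exists 'X; rewrite ?hornerX //; apply: (coefs_inX rS 1). Qed.

Lemma padjoin_acl S z : piso S ->
  forall w, padjoin S z w ->
    acl (adjoin_set (pdom S) z.1) w.1 /\ acl (adjoin_set (pcod S) z.2) w.2.
Proof.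
move=> [rS _] _ [q Sq <-]; rewrite horner_fst horner_snd.
split; apply: (subring_horner (acl_ring _)); try by apply: acl_sub; right.
- by move=> i; apply: acl_sub; left; rewrite coef_map; exists q`_i.
- by move=> i; apply: acl_sub; left; rewrite coef_map; exists q`_i.
Qed.

Section PisoTheory.
Variables (S : E * E' -> Prop) (isoS : piso S).
Let rS : subring_set S := proj1 isoS.

Lemma piso_eq0 z : S z -> (z.1 == 0) = (z.2 == 0). Proof. exact: (proj2 isoS). Qed.

Lemma piso_fst_eq0 z : S z -> (z.1 == 0) = (z == 0).
Proof.
move=> Sz; have := piso_eq0 Sz; case: z {Sz} => a b /= ab.
have -> : ((a, b) == 0) = (a == 0) && (b == 0) by [].
by rewrite -ab andbb.
Qed.
Lemma piso_snd_eq0 z : S z -> (z.2 == 0) = (z == 0).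
Proof. by move=> Sz; rewrite -piso_fst_eq0 // piso_eq0. Qed.

Lemma piso_inj z z' : S z -> S z' -> z.1 = z'.1 -> z = z'.
Proof.
move=> Sz Sz' e; apply/eqP; rewrite -subr_eq0 -piso_fst_eq0; last exact: subringB.
by rewrite -[(z - z').1]/(z.1 - z'.1) e subrr.
Qed.

Lemma piso_size_fst q : coefs_in S q -> size (map_poly fst q) = size q.
Proof.
move=> Sq; have [->|q0] := eqVneq q 0; first by rewrite rmorph0 !size_poly0.
by rewrite size_map_poly_id0 // piso_fst_eq0 ?lead_coef_eq0 //; apply: Sq.
Qed.
Lemma piso_size_snd q : coefs_in S q -> size (map_poly snd q) = size q.
Proof.
move=> Sq; have [->|q0] := eqVneq q 0; first by rewrite rmorph0 !size_poly0.
by rewrite size_map_poly_id0 // piso_snd_eq0 ?lead_coef_eq0 //; apply: Sq.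
Qed.

(** Pseudo-division over the graph.  The product ring is not a domain, but a
    nonzero element of the graph is regular. *)
Lemma piso_divp r : coefs_in S r -> r != 0 -> forall q, coefs_in S q ->
  exists c u s, [/\ S c /\ c != 0, coefs_in S u, coefs_in S s,
    c *: q = u * r + s & (size s < size r)%N].
Proof.
move=> Sr r0; have rP := coefs_in_subring rS; have r_gt0 : (0 < size r)%N by rewrite size_poly_gt0.
have Slc : S (lead_coef r) by apply: Sr.
have lc0 : lead_coef r != 0 by rewrite lead_coef_eq0.
suff main n q : (size q <= n)%N -> coefs_in S q -> exists c u s, [/\ S c /\ c != 0, coefs_in S u,
    coefs_in S s, c *: q = u * r + s & (size s < size r)%N].
  by move=> q; apply: main.
elim: n q => [|n IH] q sq Sq.
  exists 1, 0, 0; rewrite oner_eq0 size_poly0; split=> //.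
  - by split=> //; apply: subring1.
  - exact: (subring0 rP).
  - exact: (subring0 rP).
  - by move: sq; rewrite leqn0 size_poly_eq0 => /eqP ->; rewrite scaler0 mul0r addr0.
have [lt_nr|le_rn] := ltnP n.+1 (size r).
  exists 1, 0, q; rewrite oner_eq0; split=> //.
  - by split=> //; apply: subring1.
  - exact: (subring0 rP).
  - by rewrite scale1r mul0r add0r.
  - exact: leq_ltn_trans lt_nr.
pose k := (n.+1 - size r)%N; pose t := (q`_n)%:P * 'X^k.
have St : coefs_in S t by apply: (subringM rP); [apply: coefs_inC|apply: coefs_inX].
have Sq' : coefs_in S ((lead_coef r)%:P * q - t * r).
  by apply: (subringB rP); apply: (subringM rP) => //; apply: coefs_inC.
have [|c [u [s [[Sc c0] Su Ss cE ss]]]] := IH ((lead_coef r)%:P * q - t * r) _ Sq'.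
  have nE : n = (k + (size r).-1)%N by rewrite -subn1 addnBA // subnK // subn1.
  have le_kn : (k <= n)%N by rewrite nE leq_addr.
  apply/leq_sizeP => j le_nj; rewrite coefB coefCM /t -mulrA coefCM coefXnM.
  have -> : (j < k)%N = false by rewrite ltnNge (leq_trans le_kn).
  have [lt_nj|le_jn] := ltnP n j; last first.
    have <- : n = j by apply/eqP; rewrite eqn_leq le_nj.
    have -> : (n - k)%N = (size r).-1 by rewrite {1}nE addKn.
    by rewrite mulrC subrr.
  rewrite (nth_default _ (leq_trans sq lt_nj)) mulr0 sub0r.
  rewrite [r`_ _]nth_default ?mulr0 ?oppr0 //.
  by rewrite leq_subRL ?(leq_trans le_kn) // -(prednK r_gt0) addnS -nE.
exists (c * lead_coef r), (c%:P * t + u), s; split=> //.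
- split; first exact: subringM.
  rewrite -piso_fst_eq0 /= ?mulf_neq0 ?piso_fst_eq0 //; exact: subringM.
- by apply: (subringD rP) => //; apply: (subringM rP) => //; apply: coefs_inC.
- by rewrite mulrDl -addrA -cE -!mul_polyC -mulrA -mulrDr addrC subrK polyCM mulrA.
Qed.

Lemma coefs_in_dom (p : {poly E}) : coefs_in (pdom S) p ->
  exists2 q, coefs_in S q & map_poly fst q = p.
Proof.
exact: (@coefs_in_lift _ _ (fst : {rmorphism (E * E')%type -> E})) (subring0 rS).
Qed.

Lemma padjoin_iso z :
  (forall q, coefs_in S q -> ((q.[z]).1 == 0) = ((q.[z]).2 == 0)) ->
  piso (padjoin S z).
Proof. by move=> h; split=> [|_ [q Sq <-]]; [apply: padjoin_ring|apply: h]. Qed.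

(** Two elements transcendental over the domain and the codomain generate
    isomorphic extensions: evaluation at them kills no polynomial. *)
Lemma padjoin_trans z : ~ alg_over (pdom S) z.1 -> ~ alg_over (pcod S) z.2 ->
  piso (padjoin S z).
Proof.
move=> tr1 tr2; apply: padjoin_iso => q Sq; rewrite horner_fst horner_snd.
have [->|q0] := eqVneq q 0; first by rewrite !rmorph0 !horner0 !eqxx.
have -> : (map_poly fst q).[z.1] == 0 = false.
  apply/negP => qz; apply: tr1; exists (map_poly fst q); split=> //.
  - by rewrite -size_poly_eq0 piso_size_fst // size_poly_eq0.
  - by move=> i; rewrite coef_map; exists q`_i.
apply/esym/negP => qz; apply: tr2; exists (map_poly snd q); split=> //.
- by rewrite -size_poly_eq0 piso_size_snd // size_poly_eq0.
- by move=> i; rewrite coef_map; exists q`_i.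
Qed.
End PisoTheory.

End Piso.

(** Adjoining an algebraic element [x]: the image [y] is any root of the image
    of the minimal polynomial of [x].  The minimal polynomial of [y] then has
    the same degree, since a proper factor of the image polynomial would come
    from a proper factor of the minimal polynomial of [x]. *)
Lemma piso_alg (E : fieldType) (E' : closedFieldType) (S : E * E' -> Prop) x :
  piso S -> alg_over (pdom S) x ->
  exists y, alg_over (pcod S) y /\ piso (padjoin S (x, y)).
Proof.
move=> isoS [p0 [nz_p0 Sp0 p0x]]; have rP := coefs_in_subring (proj1 isoS).
have [q0 Sq0 q0E] := coefs_in_dom isoS Sp0.
pose P1 q := [/\ coefs_in S q, q != 0 & root (map_poly fst q) x].
have [|p [Sp nz_p px] p_min] := @exists_min _ P1 (fun q => size q).
  exists q0; split; rewrite ?q0E //; apply: contra_neq nz_p0 => q00.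
  by rewrite -q0E q00 rmorph0.
have sp1 : (1 < size p)%N.
  rewrite -(piso_size_fst isoS Sp); apply: root_size_gt1 px.
  by rewrite -size_poly_eq0 (piso_size_fst isoS) // size_poly_eq0.
have [y py] : exists y, root (map_poly snd p) y.
  by apply/closed_rootP; rewrite (piso_size_snd isoS) // neq_ltn sp1 orbT.
exists y; split.
  exists (map_poly snd p); split=> //.
  - by rewrite -size_poly_eq0 (piso_size_snd isoS) // size_poly_eq0.
  - by move=> i; rewrite coef_map; exists p`_i.
pose P2 q := [/\ coefs_in S q, q != 0 & root (map_poly snd q) y].
have [|r [Sr nz_r ry] r_min] := @exists_min _ P2 (fun q => size q).
  by exists p.
have fstE (c : E * E') (u s q m : {poly (E * E')%type}) : c *: q = u * m + s ->
    c.1 * (map_poly fst q).[x] = (map_poly fst u).[x] * (map_poly fst m).[x] + (map_poly fst s).[x].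
  move/(congr1 (map_poly fst)); rewrite -mul_polyC !(rmorphD, rmorphM) /= map_polyC.
  by move/(congr1 (horner^~ x)); rewrite hornerD !hornerM hornerC.
have sndE (c : E * E') (u s q m : {poly (E * E')%type}) : c *: q = u * m + s ->
    c.2 * (map_poly snd q).[y] = (map_poly snd u).[y] * (map_poly snd m).[y] + (map_poly snd s).[y].
  move/(congr1 (map_poly snd)); rewrite -mul_polyC !(rmorphD, rmorphM) /= map_polyC.
  by move/(congr1 (horner^~ y)); rewrite hornerD !hornerM hornerC.
have s_pr : (size p <= size r)%N.
  rewrite leqNgt; apply/negP => lt_rp.
  have [c [u [s [[Sc nz_c] Su Ss cE ss]]]] := piso_divp isoS Sr nz_r Sp.
  have s0 : s = 0.
    apply/eqP; apply: contraTT ss => nz_s; rewrite -leqNgt; apply: r_min; split=> //.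
    by apply/rootP; have := sndE _ _ _ _ _ cE; rewrite (rootP py) (rootP ry) !mulr0 add0r => <-.
  rewrite s0 addr0 in cE.
  have sr1 : (1 < size r)%N.
    rewrite -(piso_size_snd isoS Sr); apply: root_size_gt1 ry.
    by rewrite -size_poly_eq0 (piso_size_snd isoS) // size_poly_eq0.
  have cE1 : c.1 *: map_poly fst p = map_poly fst u * map_poly fst r.
    by rewrite -rmorphM /= -cE -!mul_polyC rmorphM /= map_polyC.
  have nz_c1 : c.1 != 0 by rewrite (piso_fst_eq0 isoS Sc).
  have nz_p1 : map_poly fst p != 0 by rewrite -size_poly_eq0 (piso_size_fst isoS) // size_poly_eq0.
  have nz_r1 : map_poly fst r != 0 by rewrite -size_poly_eq0 (piso_size_fst isoS) // size_poly_eq0.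
  have nz_u1 : map_poly fst u != 0.
    apply: contra_neq nz_p1 => u0; apply/eqP; move/eqP: cE1.
    by rewrite u0 mul0r scaler_eq0 (negPf nz_c1).
  have su : (size u < size p)%N.
    have := size_mul nz_u1 nz_r1; rewrite -cE1 size_scale // !(piso_size_fst isoS) // => ->.
    by rewrite -(ltn_predK sr1) addnS /= -{1}[size u]addn0 ltn_add2l -subn1 subn_gt0.
  have /rootP/eqP : root (map_poly fst u * map_poly fst r) x.
    by rewrite -cE1 rootE hornerZ (rootP px) mulr0.
  rewrite hornerM mulf_eq0 => /orP[ux|rx].
    have : (size p <= size u)%N.
      by apply: p_min; split=> //; rewrite -size_poly_eq0 -(piso_size_fst isoS) // size_poly_eq0.
    by rewrite leqNgt su.
  by have := p_min r (And3 Sr nz_r rx); rewrite leqNgt lt_rp.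
apply: padjoin_iso => // q Sq; rewrite horner_fst horner_snd /=.
have [c [u [s [[Sc nz_c] Su Ss cE ss]]]] := piso_divp isoS Sp nz_p Sq.
have nz_c1 : c.1 != 0 by rewrite (piso_fst_eq0 isoS Sc).
have nz_c2 : c.2 != 0 by rewrite (piso_snd_eq0 isoS Sc).
have c1E := fstE _ _ _ _ _ cE; rewrite (rootP px) mulr0 add0r in c1E.
have c2E := sndE _ _ _ _ _ cE; rewrite (rootP py) mulr0 add0r in c2E.
have [s0|nz_s] := eqVneq s 0.
  move: c1E c2E; rewrite s0 !rmorph0 !horner0 => /eqP + /eqP.
  by rewrite !mulf_eq0 (negPf nz_c1) (negPf nz_c2) /= => -> ->.
have -> : (map_poly fst q).[x] == 0 = false.
  apply: contraTF ss => /eqP qx; rewrite -leqNgt; apply: p_min; split=> //.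
  by apply/rootP; rewrite -c1E qx mulr0.
apply/esym; apply: contraTF ss => /eqP qy; rewrite -leqNgt.
apply: leq_trans s_pr (r_min _ _); split=> //.
by apply/rootP; rewrite -c2E qy mulr0.
Qed.

Definition pflip (E E' : fieldType) (S : E * E' -> Prop) : E' * E -> Prop :=
  fun z => S (z.2, z.1).

Section Flip.
Variables (E E' : fieldType) (S : E * E' -> Prop).
Lemma pflip_iso : piso S -> piso (pflip S).
Proof.
case=> rS eS; split=> [|[x y] /eS /= -> //].
split=> [|z w Sz Sw|z w Sz Sw].
- exact: (subring1 rS).
- exact: (subringB rS Sz Sw).
- exact: (subringM rS Sz Sw).
Qed.
Lemma pdom_flip : pdom (pflip S) = pcod S.
Proof. by apply/funext => y; apply/propext; split=> -[[a b] ? <-]; exists (b, a). Qed.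
Lemma pcod_flip : pcod (pflip S) = pdom S.
Proof. by apply/funext => y; apply/propext; split=> -[[a b] ? <-]; exists (b, a). Qed.
End Flip.

Section PisoExtension.
Variables E E' : closedFieldType.
Implicit Types S B : E * E' -> Prop.

Let ext S B := [/\ piso B, forall z, S z -> B z
  & forall z, B z -> acl (pdom S) z.1 /\ acl (pcod S) z.2].

Let ext_trans S B C : ext S B -> ext B C -> ext S C.
Proof.
case=> isoB SB Ba [isoC BC Ca]; split=> // [z Sz|z Cz]; first exact/BC/SB.
have [c1 c2] := Ca _ Cz; split.
- by apply: acl_mono c1 => x [w Bw <-]; case: (Ba _ Bw).
- by apply: acl_mono c2 => x [w Bw <-]; case: (Ba _ Bw).
Qed.

Let ext_alg S x : piso S -> alg_over (pdom S) x -> exists2 B, ext S B & pdom B x.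
Proof.
move=> isoS Sx; have [y [Sy isoB]] := piso_alg isoS Sx; have rS := proj1 isoS.
exists (padjoin S (x, y)); last by exists (x, y) => //; apply: padjoin_gen.
split=> // [z Sz|z /(padjoin_acl isoS)[/= zx zy]]; first exact: padjoin_sub.
split.
- by apply: acl_mono zx => w [Sw|->]; [apply: acl_sub|apply: acl_alg_over].
- by apply: acl_mono zy => w [Sw|->]; [apply: acl_sub|apply: acl_alg_over].
Qed.

Let ext_alg_cod S y : piso S -> alg_over (pcod S) y -> exists2 B, ext S B & pcod B y.
Proof.
move=> isoS; rewrite -pdom_flip => Sy; have [rS isoF] := (proj1 isoS, pflip_iso isoS).
have rF := proj1 isoF; have [x [Sx isoB]] := piso_alg isoF Sy.
exists (pflip (padjoin (pflip S) (y, x))); last by exists (x, y) => //; apply: padjoin_gen.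
split=> [|[z w] Sz|[z w] /(padjoin_acl isoF)]; first exact: pflip_iso.
  exact: (padjoin_sub _ rF (w := (w, z))).
rewrite /= pcod_flip in Sx *; rewrite pdom_flip in Sy *.
case=> zx zy; split.
- by apply: acl_mono zy => u [Su|->]; [apply: acl_sub|apply: acl_alg_over].
- by apply: acl_mono zx => u [Su|->]; [apply: acl_sub|apply: acl_alg_over].
Qed.

(** Steinitz' theorem on the uniqueness of algebraic closures: a maximal extension
    with algebraic domain and range has room for no further algebraic element on
    either side. *)
Theorem piso_acl S : piso S -> exists B, [/\ piso B, forall z, S z -> B z,
  forall x, pdom B x <-> acl (pdom S) x & forall y, pcod B y <-> acl (pcod S) y].
Proof.
move=> isoS; pose P B := B = set0 \/ ext S B.
have [|A [PA maxA]] := @Zorn_bigcup _ (P : set (set (E * E')%type)).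
  move=> F FP Ftot; have [[B FB extB]|noB] := pselect (exists2 B, F B & ext S B); last first.
    left; apply/seteqP; split=> // z [B FB Bz]; case: (FP _ FB) => [B0|extB].
      by rewrite B0 in Bz.
    by case: noB; exists B.
  right; have two z w : (\bigcup_(X in F) X)%classic z -> (\bigcup_(X in F) X)%classic w ->
      exists C, [/\ F C, ext S C, C z & C w].
    move=> [C FC Cz] [D FD Dw].
    have extC : ext S C by case: (FP _ FC) => // C0; rewrite C0 in Cz.
    have extD : ext S D by case: (FP _ FD) => // D0; rewrite D0 in Dw.
    by case: (Ftot _ _ FC FD) => sub; [exists D|exists C]; split=> //; apply: sub.
  split; first split; first split.
  - by exists B => //; case: extB => -[rB _] _ _; apply: subring1.
  - move=> z w hz hw; have [C [FC [[rC _] _ _] Cz Cw]] := two _ _ hz hw.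
    by exists C => //; apply: subringB.
  - move=> z w hz hw; have [C [FC [[rC _] _ _] Cz Cw]] := two _ _ hz hw.
    by exists C => //; apply: subringM.
  - by move=> z hz; have [C [FC [[_ eC] _ _] Cz _]] := two _ _ hz hz; apply: eC.
  - by move=> z Sz; exists B => //; case: extB => _ SB _; apply: SB.
  - by move=> z hz; have [C [_ [_ _ aC] Cz _]] := two _ _ hz hz; apply: aC.
have extS : ext S S.
  split=> // z Sz; split; apply: acl_sub; exists z => //.
have extA : ext S A.
  case: PA => // A0; case: (maxA S); last by right.
  by rewrite A0; split=> [z //|/(_ _ (subring1 (proj1 isoS)))].
have {}maxA B : ext A B -> forall z, B z -> A z.
  move=> extB; apply: contrapT => nBA; apply: (maxA B); last by right; apply: ext_trans extB.
  by split=> [z|//]; case: extB => _ + _; apply.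
have [isoA SA aA] := extA; exists A; split=> //.
- move=> x; split=> [[z Az <-]|]; first by case: (aA _ Az).
  apply: acl_min => [|y [z Sz <-]]; last by exists z => //; apply: SA.
  split=> [|y /(ext_alg isoA)[B /maxA BA [z Bz <-]]]; first exact: pdom_ring (proj1 isoA).
  by exists z => //; apply: BA.
- move=> x; split=> [[z Az <-]|]; first by case: (aA _ Az).
  apply: acl_min => [|y [z Sz <-]]; last by exists z => //; apply: SA.
  split=> [|y /(ext_alg_cod isoA)[B /maxA BA [z Bz <-]]]; first exact: pcod_ring (proj1 isoA).
  by exists z => //; apply: BA.
Qed.
End PisoExtension.

(** * Pure subgroups and graded relations *)

Section PureSubgroups.
Variable F : fieldType.
Implicit Types (H A : F -> Prop) (x y g s : F).

(** Subgroups of the multiplicative group with a torsion free quotient; they play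
    for the first sort the role of closed sets. *)
Definition pure_subgroup H :=
  [/\ H 1, forall x, H x -> x != 0, forall x y, H x -> H y -> H (x / y)
    & forall x n, (0 < n)%N -> H (x ^+ n) -> H x].

Definition torsion x := exists2 n, (0 < n)%N & x ^+ n = 1.

Section PureTheory.
Variables (H : F -> Prop) (pureH : pure_subgroup H).
Lemma pure1 : H 1. Proof. by case: pureH. Qed.
Lemma pure_neq0 x : H x -> x != 0. Proof. by case: pureH => _ h _ _; apply: h. Qed.
Lemma pure_div x y : H x -> H y -> H (x / y).
Proof. by case: pureH => _ _ h _; apply: h. Qed.
Lemma pure_root x n : (0 < n)%N -> H (x ^+ n) -> H x.
Proof. by case: pureH => _ _ _; apply. Qed.
Lemma pureV x : H x -> H x^-1.
Proof. by move=> Hx; rewrite -[x^-1]mul1r; apply: pure_div => //; apply: pure1. Qed.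
Lemma pureM x y : H x -> H y -> H (x * y).
Proof. by move=> Hx Hy; rewrite -[y]invrK; apply/pure_div/pureV. Qed.
Lemma pureX x n : H x -> H (x ^+ n).
Proof.
by move=> Hx; elim: n => [|n IH]; [apply: pure1|rewrite exprS; apply: pureM].
Qed.
Lemma torsion_pure x : torsion x -> H x.
Proof. by case=> n n0 xn; apply: (pure_root n0); rewrite xn; apply: pure1. Qed.
End PureTheory.

Lemma pure_torsion : pure_subgroup torsion.
Proof.
split.
- by exists 1%N; rewrite ?expr1n.
- move=> x [n n0 xn]; apply/eqP => x0; move/eqP: xn.
  by rewrite x0 expr0n gtn_eqF // eq_sym oner_eq0.
- move=> x y [n n0 xn] [m m0 ym]; exists (n * m)%N; first by rewrite muln_gt0 n0.
  by rewrite expr_div_n exprM xn expr1n mulnC exprM ym expr1n divr1.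
- by move=> x n n0 [m m0 xm]; exists (n * m)%N; rewrite ?muln_gt0 ?n0 // exprM.
Qed.

Definition nonzero A x := A x /\ x != 0.

Lemma pure_closed A : algclosed_in A -> pure_subgroup (nonzero A).
Proof.
move=> cA; have rA := proj1 cA; split.
- by split; [apply: subring1|apply: oner_neq0].
- by move=> x [].
- move=> x y [Ax x0] [Ay y0]; split; last by rewrite mulf_neq0 ?invr_neq0.
  exact: algclosed_div.
- move=> x n n0 [Ax x0]; split; first exact: (algclosed_expr cA n0 Ax).
  by apply: contra_neq x0 => ->; rewrite expr0n gtn_eqF.
Qed.

(** The smallest pure subgroup containing [H] and [g]. *)
Definition hull H g x :=
  x != 0 /\ exists n a b, (0 < n)%N /\ H (x ^+ n * g ^+ a / g ^+ b).

Section Hull.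
Variables (H : F -> Prop) (pureH : pure_subgroup H) (g : F) (g0 : g != 0).

Lemma hull_sub x : H x -> hull H g x.
Proof.
move=> Hx; split; first exact: pure_neq0 Hx.
by exists 1%N, 0%N, 0%N; split=> //; rewrite expr1 expr0 mulr1 divr1.
Qed.

Lemma hull_gen : hull H g g.
Proof.
split=> //; exists 1%N, 0%N, 1%N; split=> //.
by rewrite !expr1 expr0 mulr1 divff //; apply: pure1.
Qed.

Lemma hull_pure : pure_subgroup (hull H g).
Proof.
split; first exact: hull_sub (pure1 pureH).
- by move=> x [].
- move=> x y [x0 [n [a [b [n0 hx]]]]] [y0 [m [c [d [m0 hy]]]]].
  split; first by rewrite mulf_neq0 ?invr_neq0.
  exists (n * m)%N, (a * m + d * n)%N, (b * m + c * n)%N; split; first by rewrite muln_gt0 n0.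
  have -> : (x / y) ^+ (n * m) * g ^+ (a * m + d * n) / g ^+ (b * m + c * n) =
      (x ^+ n * g ^+ a / g ^+ b) ^+ m / (y ^+ m * g ^+ c / g ^+ d) ^+ n.
    rewrite !exprMn !exprVn !exprD -!exprM [(m * n)%N]mulnC.
    by field; rewrite ?expf_neq0.
  by apply: pure_div => //; apply: pureX.
- move=> x n n0 [xn0 [m [a [b [m0 hx]]]]]; split.
    by apply: contra_neq xn0 => ->; rewrite expr0n gtn_eqF.
  by exists (n * m)%N, a, b; rewrite muln_gt0 n0 m0 exprM.
Qed.

Lemma hull_id : H g -> forall x, hull H g x -> H x.
Proof.
move=> Hg x [x0 [n [a [b [n0 hx]]]]]; apply: (pure_root pureH n0).
have -> : x ^+ n = (x ^+ n * g ^+ a / g ^+ b) * g ^+ b / g ^+ a.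
  by rewrite divfK ?mulfK ?expf_neq0.
by apply: pure_div => //; [apply: pureM => //|]; apply: pureX.
Qed.
End Hull.
End PureSubgroups.

Arguments torsion {F} x.

Lemma closed_nth_root (F : closedFieldType) (x : F) n : (0 < n)%N -> exists y, y ^+ n = x.
Proof.
move=> n0; have [y] : exists y, root ('X^n - x%:P) y.
  by apply/closed_rootP; rewrite size_XnsubC // eqSS -lt0n.
by rewrite rootE !hornerE ?hornerXn subr_eq0 => /eqP; exists y.
Qed.

(** Modulo a pure subgroup the hull of one further element is torsion free of
    rank one, so finitely many of its elements are powers of a common root. *)
Lemma common_root (F : closedFieldType) (H : F -> Prop) (g : F) (l : seq F) :
  pure_subgroup H -> g != 0 -> ~ H g -> (forall x, x \in l -> hull H g x) ->
  exists s B N, [/\ (0 < N)%N, s ^+ N = g, s != 0, ~ H s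
    & forall x, x \in l -> exists n, H (x * s ^+ B / s ^+ n)].
Proof.
move=> pureH g0 nHg hl.
have [N [N0 hN]] : exists N, (0 < N)%N /\
    forall x, x \in l -> exists a b, H (x ^+ N * g ^+ a / g ^+ b).
  elim: l hl => [|x l IH] hl; first by exists 1%N.
  have [|N [N0 hN]] := IH; first by move=> y yl; apply: hl; rewrite inE yl orbT.
  have [x0 [n [a [b [n0 hx]]]]] := hl x (mem_head _ _).
  exists (N * n)%N; split=> [|y]; first by rewrite muln_gt0 N0.
  rewrite inE => /predU1P[->|/hN[c [d hy]]].
    exists (a * N)%N, (b * N)%N.
    by rewrite mulnC !exprM -exprVn -!exprMn; apply: pureX.
  exists (c * n)%N, (d * n)%N.
  by rewrite !exprM -exprVn -!exprMn; apply: pureX.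
have [s sN] := closed_nth_root g N0.
have s0 : s != 0 by apply: contra_neq g0 => s0; rewrite -sN s0 expr0n gtn_eqF.
have nHs : ~ H s by move=> Hs; apply: nHg; rewrite -sN; apply: pureX.
have hs x : x \in l -> exists a b, H (x * s ^+ a / s ^+ b).
  move=> /hN[a [b hx]]; exists a, b; apply: (pure_root pureH N0).
  by rewrite !exprMn exprVn -!exprM ![(_ * N)%N]mulnC !exprM sN.
suff [B hB] : exists B, forall x, x \in l -> exists n, H (x * s ^+ B / s ^+ n).
  by exists s, B, N.
elim: l hs {hl hN} => [|x l IH] hs; first by exists 0%N.
have [|B hB] := IH; first by move=> y yl; apply: hs; rewrite inE yl orbT.
have [a [b hx]] := hs x (mem_head _ _).
have shift y m c n : H (y * s ^+ c / s ^+ n) -> H (y * s ^+ (c + m) / s ^+ (n + m)).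
  by rewrite !exprD mulrA -mulf_div divff ?expf_neq0 // mulr1.
exists (B + a)%N => y; rewrite inE => /predU1P[->|/hB[n hy]].
  by exists (b + B)%N; rewrite addnC; apply: shift.
by exists (n + a)%N; apply: shift.
Qed.

Section Graded.
Variables (F K : closedFieldType) (chi : F -> K).
Hypotheses (chiM : forall a b, chi (a * b) = chi a * chi b) (chi1 : chi 1 = 1).
Implicit Types (A : K -> Prop) (G H : F -> Prop).

Lemma chiX a n : chi (a ^+ n) = chi a ^+ n.
Proof. by elim: n => [|n IH]; rewrite ?expr0 // !exprS chiM IH. Qed.
Lemma chi_div a b : b != 0 -> chi (a / b) = chi a / chi b.
Proof.
move=> b0; have cb : chi b^-1 * chi b = 1 by rewrite -chiM mulVf.
have cb0 : chi b != 0 by apply/eqP => e; move/eqP: cb; rewrite e mulr0 eq_sym oner_eq0.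
by rewrite chiM -[chi b^-1](mulfK cb0) cb mul1r.
Qed.
Lemma chi_neq0 a : a != 0 -> chi a != 0.
Proof.
move=> a0; apply/eqP => e; have /eqP := chiM a a^-1.
by rewrite e mul0r mulfV // chi1 oner_eq0.
Qed.

Definition with_image A H y := A y \/ exists2 h, H h & chi h = y.

(** [chi] sends elements that are multiplicatively independent over [G] to
    elements that are algebraically independent over [A]; quantifying over all
    pure overgroups makes this insensitive to enlarging [A] inside [acl A]. *)
Definition strong G A := forall H, pure_subgroup H -> (forall x, G x -> H x) ->
  forall g, g != 0 -> ~ H g -> ~ acl (with_image A H) (chi g).

Local Notation rel := (fun z : K * F => z.1 * chi z.2).

(** The entries are powers of one root [s] up to factors in [H], so the relation
    is a polynomial equation for the transcendental [chi s]; multiplying by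
    [s ^+ B] clears the negative exponents, and the terms with entry in [H] make
    up the coefficient of degree [B]. *)
Lemma graded_step A H g (l : seq (K * F)) : pure_subgroup H ->
  (forall s, s != 0 -> ~ H s -> ~ acl (with_image A H) (chi s)) ->
  g != 0 -> ~ H g ->
  (forall z, z \in l -> acl (with_image A H) z.1 /\ hull H g z.2) ->
  \sum_(z <- l) rel z = 0 -> \sum_(z <- l | `[< H z.2 >]) rel z = 0.
Proof.
move=> pureH strH g0 nHg hl suml; pose C := with_image A H; have rC := acl_ring C.
have [|s [B [N [N0 sN s0 nHs hs]]]] := @common_root _ H g [seq z.2 | z <- l] pureH g0 nHg.
  by move=> x /mapP[z zl ->]; case: (hl _ zl).
have /choice[n nP] : forall z, exists n, z \in l -> H (z.2 * s ^+ B / s ^+ n).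
  move=> z; have [zl|] := boolP (z \in l); last by exists 0%N.
  by have [|n hn] := hs z.2; [apply: map_f|exists n].
pose h z := z.2 * s ^+ B / s ^+ n z.
have hE z : rel z * chi s ^+ B = z.1 * chi (h z) * chi s ^+ n z.
  rewrite /h -mulrA -[in RHS]mulrA; congr (_ * _).
  by rewrite -!chiX -!chiM divfK ?expf_neq0.
have Ch z : z \in l -> acl C (z.1 * chi (h z)).
  move=> zl; apply: subringM rC _ _ (proj1 (hl _ zl)) _.
  by apply: acl_sub; right; exists (h z) => //; apply: nP.
pose p := \sum_(z <- l) (z.1 * chi (h z)) *: 'X^(n z).
have Cp : coefs_in (acl C) p.
  rewrite /p big_seq; apply: (subring_sum (coefs_in_subring rC)) => z zl.
  rewrite -mul_polyC; apply: (subringM (coefs_in_subring rC)).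
    by apply: coefs_inC => //; apply: Ch.
  exact: coefs_inX.
have p_s : p.[chi s] = 0.
  rewrite /p horner_sum; transitivity ((\sum_(z <- l) rel z) * chi s ^+ B); last by rewrite suml mul0r.
  by rewrite mulr_suml; apply: eq_bigr => z _; rewrite hE !hornerE ?hornerXn.
have {p_s} p0 : p = 0.
  apply: contrapT => /eqP nz_p; apply: (strH s s0 nHs).
  by apply: (algclosed_root (acl_closed _) nz_p Cp); apply/rootP.
have HB z : z \in l -> (n z == B) = `[< H z.2 >].
  move=> zl; have Hh := nP _ zl; apply/eqP/asboolP => [nB|Hz].
    by move: Hh; rewrite nB mulfK ?expf_neq0.
  apply: contrapT => /eqP; rewrite neq_ltn => ineq; apply: nHs.
  have Hs : H (s ^+ B / s ^+ n z).
    have -> : s ^+ B / s ^+ n z = z.2 * s ^+ B / s ^+ n z / z.2.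
      by field; rewrite (pure_neq0 pureH) ?expf_neq0.
    exact: pure_div.
  case/orP: ineq => [lt_nB|lt_Bn].
    apply: (@pure_root _ _ pureH _ (B - n z)); rewrite ?subn_gt0 //.
    by rewrite expfB.
  apply: (@pure_root _ _ pureH _ (n z - B)); rewrite ?subn_gt0 //.
  by rewrite expfB // -invf_div; apply: pureV.
have := congr1 (coefp B) p0; rewrite /= coef0 /p coef_sum => coefB.
apply: (mulIf (expf_neq0 B (chi_neq0 s0))); rewrite mul0r mulr_suml.
rewrite -[RHS](mul0r (chi s ^+ B)) -[in RHS]coefB mulr_suml big_mkcond /=.
rewrite big_seq [RHS]big_seq; apply: eq_bigr => z zl.
rewrite coefZ coefXn -HB // eq_sym.
case: eqP => [nB|_]; last by rewrite mulr0 mul0r.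
by rewrite mulr1 hE nB.
Qed.

(** Writing [K] as generated over [A] by [chi F], the images of the cosets of
    [G] are linearly independent: a relation splits into one relation for each
    coset.  The coset of [1] is reached by enlarging [G] to a pure subgroup that
    contains all the entries and removing the generators one at a time. *)
Lemma strong_graded G A (l : seq (K * F)) : pure_subgroup G -> strong G A ->
  (forall z, z \in l -> acl (with_image A G) z.1 /\ z.2 != 0) ->
  \sum_(z <- l) rel z = 0 -> \sum_(z <- l | `[< G z.2 >]) rel z = 0.
Proof.
move=> pureG strG hl suml.
pose fix hulls (H : F -> Prop) (gs : seq F) : F -> Prop :=
  if gs is g :: gs' then hulls (hull H g) gs' else H.
have hulls_sub gs H : pure_subgroup H -> (forall g, g \in gs -> g != 0) ->
    forall x, H x \/ x \in gs -> hulls H gs x.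
  elim: gs H => [|g gs IH] H pureH gs0 x; first by case.
  have g0 : g != 0 by apply: gs0; rewrite mem_head.
  rewrite inE => hx; apply: IH; first exact: hull_pure.
    by move=> y ygs; apply: gs0; rewrite inE ygs orbT.
  case: hx => [Hx|/predU1P[->|]]; [left; exact: hull_sub|left|by right].
  exact: hull_gen.
suff main gs H : pure_subgroup H -> (forall x, G x -> H x) -> (forall g, g \in gs -> g != 0) ->
    (forall z, z \in l -> hulls H gs z.2) -> \sum_(z <- l | `[< H z.2 >]) rel z = 0.
  apply: (main [seq z.2 | z <- l] G) => // [g /mapP[z /hl[_ ?] ->] //|z zl].
  apply: hulls_sub => //; first by move=> g /mapP[w /hl[_ ?] ->].
  by right; apply: map_f.
elim: gs H => [|g gs IH] H pureH GH gs0 hgs.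
  rewrite -[RHS]suml big_seq_cond [RHS]big_seq; apply: eq_bigl => z.
  by have [zl|//] := boolP (z \in l); apply/asboolP/hgs.
have g0 : g != 0 by apply: gs0; rewrite mem_head.
have {}IH : \sum_(z <- l | `[< hull H g z.2 >]) rel z = 0.
  apply: IH => //; first exact: hull_pure.
  - by move=> x /GH; apply: hull_sub.
  - by move=> y ygs; apply: gs0; rewrite inE ygs orbT.
have [Hg|nHg] := pselect (H g).
  rewrite -[RHS]IH; apply: eq_bigl => z; apply/asboolP/asboolP; first exact: hull_sub.
  exact: hull_id.
have := @graded_step A H g [seq z <- l | `[< hull H g z.2 >]] pureH _ g0 nHg.
rewrite big_filter big_filter_cond IH.
have -> : \sum_(z <- l | `[< hull H g z.2 >] && `[< H z.2 >]) rel z =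
    \sum_(z <- l | `[< H z.2 >]) rel z.
  apply: eq_bigl => z; apply/andP/asboolP => [[_ /asboolP]//|Hz].
  by split; apply/asboolP => //; apply: hull_sub.
apply=> //; first by move=> s s0 nHs; apply: strG.
move=> z; rewrite mem_filter => /andP[/asboolP hz /hl[Az _]]; split=> //.
apply: aclS Az => y [Ay|[h Gh <-]]; [by left|right].
by exists h => //; apply: GH.
Qed.
End Graded.

(** * Generic characters *)

Section IntegerPolynomials.
Variable n : nat.
Local Notation widen := (widen_ord (leqnSn n)).

Lemma muni_mwiden (q : {mpoly int[n]}) : muni (mwiden q) = q%:P.
Proof.
elim/mpolyind: q => [|c m q _ _ IH]; first by rewrite !raddf0.
rewrite !raddfD /= IH; congr (_ + _).
rewrite mwidenZ mwidenX muniZ muniE msuppX big_seq1 mcoeffX eqxx scale1r.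
rewrite mnmwiden_ordmax expr0 -mul_mpolyC polyCM -mul_polyC alg_polyC; congr (_ * _).
by congr ('X_[_])%:P; apply/mnmP => i; rewrite mnmE mnmwiden_widen.
Qed.

Lemma muni_mmulti (p : {poly {mpoly int[n]}}) : muni (mmulti p) = p.
Proof.
rewrite /mmulti raddf_sum /= -[RHS]coefK poly_def; apply: eq_bigr => i _.
rewrite rmorphM rmorphXn /= muni_mwiden mul_polyC; congr (_ *: _ ^+ _).
rewrite muniE msuppX big_seq1 mcoeffX eqxx scale1r mnm1E eqxx expr1.
have -> : [multinom (U_(ord_max)%MM (widen i0)) | i0 < n] = 0%MM.
  by apply/mnmP => j; rewrite mnmE mnm1E mnm0E -val_eqE /= gtn_eqF.
by rewrite mpolyX0 scale1r.
Qed.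

Variable K : comNzRingType.

Definition ev k (h : 'I_k -> K) : {mpoly int[k]} -> K := mmap (intr : int -> K) h.

Lemma ev_widen (h : 'I_n.+1 -> K) q : ev h (mwiden q) = ev (h \o widen) q.
Proof.
rewrite /ev; elim/mpolyind: q => [|c m q _ _ IH]; first by rewrite !raddf0.
rewrite !raddfD /= IH; congr (_ + _).
rewrite mwidenZ mwidenX !mmapZ !mmapX /mmap1 big_ord_recr /=.
rewrite mnmwiden_ordmax expr0 mulr1; congr (_ * _).
by apply: eq_bigr => i _; rewrite mnmwiden_widen.
Qed.

Lemma ev_mmulti (h : 'I_n.+1 -> K) p :
  ev h (mmulti p) = (map_poly (ev (h \o widen)) p).[h ord_max].
Proof.
rewrite /mmulti /ev raddf_sum /= (horner_coef_wide _ (size_poly _ _)).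
apply: eq_bigr => i _; rewrite rmorphM rmorphXn /= -!/(ev _ _) ev_widen coef_map.
by rewrite /ev mmapX mmap1U.
Qed.
End IntegerPolynomials.

Definition snoc (T : Type) n (v : 'I_n -> T) (x : T) (i : 'I_n.+1) : T :=
  if unlift ord_max i is Some j then v j else x.

Lemma snoc_last (T : Type) n (v : 'I_n -> T) x : snoc v x ord_max = x.
Proof. by rewrite /snoc unlift_none. Qed.

Lemma snoc_widen (T : Type) n (v : 'I_n -> T) x i :
  snoc v x (widen_ord (leqnSn n) i) = v i.
Proof.
rewrite /snoc; have -> : widen_ord (leqnSn n) i = lift ord_max i.
  by apply: val_inj; rewrite /= /bump leqNgt ltn_ord.
by rewrite liftK.
Qed.

Lemma mult_dependent_snoc (F : idomainType) n (v : 'I_n -> F) g :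
  g != 0 -> (forall i, v i != 0) -> mult_independent v -> mult_dependent (snoc v g) ->
  exists d (k l : 'X_{1..n}),
    (0 < d)%N /\ g ^+ d * \prod_(i < n) v i ^+ k i = \prod_(i < n) v i ^+ l i.
Proof.
move=> g0 v0 iv [k [l [kl e]]].
pose res (k : 'X_{1..n.+1}) : 'X_{1..n} := [multinom k (widen_ord (leqnSn n) i) | i < n].
have prodE (m : 'X_{1..n.+1}) : \prod_(i < n.+1) snoc v g i ^+ m i =
    \prod_(i < n) v i ^+ res m i * g ^+ m ord_max.
  rewrite big_ord_recr /= snoc_last; congr (_ * _).
  by apply: eq_bigr => i _; rewrite snoc_widen mnmE.
have prod0 (m : 'X_{1..n}) : \prod_(i < n) v i ^+ m i != 0.
  by apply/prodf_neq0 => i _; rewrite expf_neq0.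
rewrite !prodE in e.
have main a b (A B : F) : A * g ^+ a = B * g ^+ b -> (b < a)%N -> g ^+ (a - b) * A = B.
  move=> eAB lt_ba; apply: (mulIf (expf_neq0 b g0)).
  by rewrite -eAB mulrAC -exprD subnK ?(ltnW lt_ba) // mulrC.
have [lt_kl|lt_lk|ekl] := ltngtP (k ord_max) (l ord_max).
- exists (l ord_max - k ord_max)%N, (res l), (res k).
  by rewrite subn_gt0 lt_kl; split=> //; apply: main.
- exists (k ord_max - l ord_max)%N, (res k), (res l).
  by rewrite subn_gt0 lt_lk; split=> //; apply: main.
case: iv; exists (res k), (res l); split.
  apply: contra_not kl => /mnmP ekl'; apply/mnmP => i.
  have [j|->//] := unliftP ord_max i.
  have -> : lift ord_max j = widen_ord (leqnSn n) j.
    by apply: val_inj; rewrite /= /bump leqNgt ltn_ord.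
  by move=> ->; have := ekl' j; rewrite !mnmE.
by apply: (mulIf (expf_neq0 (k ord_max) g0)); rewrite e ekl.
Qed.

Lemma char0_int_eq0 (R : fieldType) (k : int) :
  [pchar R] =i pred0 -> (k%:~R == 0 :> R) = (k == 0).
Proof.
move=> /pcharf0P charR; case: k => n; first by rewrite -pmulrn charR.
by rewrite NegzE mulrNz oppr_eq0 -pmulrn charR.
Qed.

Lemma ev_rmorph (K L : comNzRingType) (f : {rmorphism K -> L}) n (h : 'I_n -> K)
    (P : {mpoly int[n]}) :
  (map_mpoly (intr : int -> L) P).@[fun i => f (h i)] = f (ev h P).
Proof.
rewrite /ev; elim/mpolyind: P => [|c m q _ _ IH]; first by rewrite !raddf0.
rewrite !raddfD /= IH; congr (_ + _).
rewrite map_mpolyZ map_mpolyX mevalZ mevalX mmapZ mmapX rmorphM rmorph_int.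
rewrite /mmap1 rmorph_prod /=; congr (_ * _).
by apply: eq_bigr => i _; rewrite rmorphXn.
Qed.

Section Generic.
Variables (F K : closedFieldType) (chi : F -> K).
Hypotheses (charK : [pchar K] =i pred0) (chi_char : character chi) (chi_gen : generic chi).
Let chiM : forall a b, chi (a * b) = chi a * chi b. Proof. by case: chi_char. Qed.
Let chi1 : chi 1 = 1. Proof. by case: chi_char. Qed.

Lemma generic_ev n (v : 'I_n -> F) (P : {mpoly int[n]}) : (0 < n)%N ->
  mult_independent v -> P != 0 -> ev (chi \o v) P != 0.
Proof.
move=> n0 iv nzP; have [_ gen] := chi_gen; have := gen n v n0 iv.
move=> /(_ (map_mpoly (intr : int -> {fraction K}) P)); rewrite (ev_rmorph (@FracField.tofrac K)) tofrac_eq0.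
have int_eq0 k : (k%:~R == 0 :> {fraction K}) = (k == 0).
  by rewrite -(rmorph_int (@FracField.tofrac K)) tofrac_eq0 char0_int_eq0.
apply=> [m S divS|].
  rewrite mcoeff_map_mpoly; have [S1 SB SM] := GRing.divring_closedBM divS.
  have rS : subring_set (fun x => x \in S) by split.
  exact: (subring_int rS).
apply: contra_neq nzP => P0; apply/mpolyP => m; rewrite mcoeff0; apply/eqP.
by rewrite -int_eq0 -mcoeff_map_mpoly P0 mcoeff0.
Qed.

Lemma monomial_in (H : F -> Prop) n (v : 'I_n -> F) (k : 'X_{1..n}) :
  pure_subgroup H -> (forall i, H (v i)) -> H (\prod_(i < n) v i ^+ k i).
Proof.
move=> pureH Hv; apply: (big_ind H); [exact: pure1|exact: pureM|].
by move=> i _; apply: pureX.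
Qed.

Lemma chi_monomial n (v : 'I_n -> F) (k : 'X_{1..n}) :
  chi (\prod_(i < n) v i ^+ k i) = \prod_(i < n) chi (v i) ^+ k i.
Proof.
rewrite (big_morph chi chiM chi1); apply: eq_bigr => i _.
exact: chiX.
Qed.

(** The family is built by adding one element at a time: either it stays
    independent, or the dependence exhibits a power of the new element as a
    quotient of monomials in the family. *)
Lemma independent_basis (H : F -> Prop) (s : seq F) : pure_subgroup H ->
  (forall x, x \in s -> H x) ->
  exists n (v : 'I_n -> F), [/\ mult_independent v, forall i, H (v i)
    & forall x, x \in s -> acl (fun y => exists i, chi (v i) = y) (chi x)].
Proof.
move=> pureH; elim: s => [|g s IH] Hs.
  exists 0%N, (@empty_env F); split=> [|[]//|//].
  by case=> k [l [kl _]]; apply: kl; apply/mnmP => -[].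
have [|n [v [iv Hv hs]]] := IH; first by move=> x xs; apply: Hs; rewrite inE xs orbT.
have Hg : H g by apply: Hs; rewrite mem_head.
have g0 : g != 0 := pure_neq0 pureH Hg.
have v0 i : v i != 0 := pure_neq0 pureH (Hv i).
have [dep|indep] := pselect (mult_dependent (snoc v g)).
  have [d [k [l [d0 e]]]] := mult_dependent_snoc g0 v0 iv dep.
  exists n, v; split=> // x; rewrite inE => /predU1P[->|/hs//].
  pose C := fun y => exists i, chi (v i) = y; rewrite -/C.
  have rC := acl_ring C.
  have Cm (m : 'X_{1..n}) : acl C (chi (\prod_(i < n) v i ^+ m i)).
    rewrite chi_monomial; apply: (big_ind (acl C)); [exact: subring1 rC|exact: subringM rC|].
    by move=> i _; apply: (subringX rC); apply: acl_sub; exists i.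
  apply: (algclosed_expr (acl_closed C) d0); rewrite -(chiX chiM chi1).
  have -> : g ^+ d = (\prod_(i < n) v i ^+ l i) / (\prod_(i < n) v i ^+ k i).
    by rewrite -e mulfK //; apply/prodf_neq0 => i _; rewrite expf_neq0.
  rewrite (chi_div chiM chi1); last by apply/prodf_neq0 => i _; rewrite expf_neq0.
  exact: algclosed_div (acl_closed C) _ _ (Cm _) (Cm _).
exists n.+1, (snoc v g); split=> [//|i|x].
  by rewrite /snoc; case: unlift.
rewrite inE => /predU1P[->|/hs].
  by apply: acl_sub; exists ord_max; rewrite snoc_last.
apply: aclS => _ [i <-]; exists (widen_ord (leqnSn n) i).
by rewrite snoc_widen.
Qed.

(** An algebraic relation for [chi g] over [chi H] involves finitely many elements
    of [H], which may be replaced by an independent family [v]; since [g] lies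
    outside the pure subgroup [H], the family remains independent with [g] added,
    and the relation becomes an integer polynomial killed by its image. *)
Lemma generic_strong : strong chi torsion (fun _ => False).
Proof.
move=> H pureH _ g g0 nHg /acl_fin[s0 hs0 g_s0].
have [s [Hs g_s]] : exists s : seq F, (forall x, x \in s -> H x) /\
    acl (fun y => exists2 x, x \in s & chi x = y) (chi g).
  have /choice[f fP] : forall y, exists x, y \in s0 -> H x /\ chi x = y.
    move=> y; have [/hs0[//|[x Hx xy]]|_] := boolP (y \in s0); last by exists 0.
    by exists x.
  exists (map f s0); split=> [x /mapP[y /fP[? _] ->//]|].
  by apply: aclS g_s0 => y ys; exists (f y); [apply: map_f|case: (fP y ys)].
have [n [v [iv Hv hv]]] := independent_basis pureH Hs.
have v0 i : v i != 0 := pure_neq0 pureH (Hv i).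
have ivg : mult_independent (snoc v g).
  move=> dep; have [d [k [l [d0 e]]]] := mult_dependent_snoc g0 v0 iv dep.
  apply: nHg; apply: (pure_root pureH d0).
  have -> : g ^+ d = (\prod_(i < n) v i ^+ l i) / (\prod_(i < n) v i ^+ k i).
    by rewrite -e mulfK //; apply/prodf_neq0 => i _; rewrite expf_neq0.
  by apply: pure_div => //; apply: monomial_in.
have {g_s} g_v : acl (fun y => exists i, chi (v i) = y) (chi g).
  by apply: acl_mono g_s => _ [x xs <-]; apply: hv.
pose evr : {rmorphism {mpoly int[n]} -> K} := mmap (intr : int -> K) (chi \o v).
pose R y := exists2 P : {mpoly int[n]}, True & evr P = y.
have rR : subring_set R by apply: (subring_image evr).
have /(acl_alg rR)[p [p0 Rp pg]] : acl R (chi g).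
  apply: aclS g_v => _ [i <-]; exists 'X_i => //.
  by rewrite /evr /= mmapX mmap1U.
have [P _ Pp] := coefs_in_lift (f := evr) I Rp.
have nzP : mmulti P != 0.
  by apply: contra_neq p0 => P0; rewrite -Pp -[P]muni_mmulti P0 !rmorph0.
have := generic_ev (ltn0Sn n) ivg nzP; rewrite ev_mmulti /= snoc_last.
have -> : map_poly (ev ((chi \o snoc v g) \o widen_ord (leqnSn n))) P = p.
  rewrite -Pp; apply: eq_map_poly => q; rewrite /ev /evr /=; congr (mmap _ _ q).
  by apply/funext => i /=; rewrite snoc_widen.
by rewrite (rootP pg) eqxx.
Qed.
End Generic.

(** * Back and forth *)

Lemma piso_div (F F' : fieldType) (S : F * F' -> Prop) z w :
  piso S -> algclosed_in (pdom S) -> S z -> S w -> S (z.1 / w.1, z.2 / w.2).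
Proof.
move=> isoS cS Sz Sw; have rS := proj1 isoS.
have [w0|w0] := eqVneq w.1 0.
  have /eqP w20 : w.2 == 0 by rewrite -(piso_eq0 isoS Sw) w0.
  rewrite w0 w20 !invr0 !mulr0; exact: (subring0 rS).
have [v Sv vw] : pdom S w.1^-1 by apply: algclosed_inv cS _ _; exists w.
have vw1 : v * w = 1.
  apply: (piso_inj isoS); [exact: subringM|exact: subring1|].
  by rewrite -[(v * w).1]/(v.1 * w.1) vw mulVf.
have -> : w.2^-1 = v.2.
  have e : v.2 * w.2 = 1 by rewrite -[v.2 * w.2]/((v * w).2) vw1.
  have w20 : w.2 != 0 by apply/eqP => w20; move/eqP: e; rewrite w20 mulr0 eq_sym oner_eq0.
  by rewrite -[RHS](mulfK w20) e mul1r.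
by rewrite -vw; apply: (subringM rS Sz Sv).
Qed.

Section Transfer.
Variables (F K F' K' : closedFieldType) (chi : F -> K) (chi' : F' -> K').
Hypotheses (chiP : character chi) (chiP' : character chi').
Let chiM : forall a b, chi (a * b) = chi a * chi b. Proof. by case: chiP. Qed.
Let chi1 : chi 1 = 1. Proof. by case: chiP. Qed.
Let chi0 : chi 0 = 0. Proof. by case: chiP. Qed.
Let chiM' : forall a b, chi' (a * b) = chi' a * chi' b. Proof. by case: chiP'. Qed.
Let chi1' : chi' 1 = 1. Proof. by case: chiP'. Qed.
Let chi0' : chi' 0 = 0. Proof. by case: chiP'. Qed.

Variables (SF : F * F' -> Prop) (SK : K * K' -> Prop) (G : F -> Prop).
Hypotheses (isoF : piso SF) (isoK : piso SK) (cF : algclosed_in (pdom SF)).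
Hypotheses (pureG : pure_subgroup G) (strG : strong chi G (pdom SK)).
Hypothesis compatG : forall z, SF z -> G z.1 -> SK (chi z.1, chi' z.2).

(** A relation splits along the cosets of [G].  Dividing the part of one coset by
    one of its entries turns it into an identity inside the domain of [SK], which
    [SK] carries over. *)
Lemma relation_transfer (s : seq ((K * K') * (F * F'))) :
  (forall u, u \in s -> SK u.1 /\ SF u.2) ->
  \sum_(u <- s) u.1.1 * chi u.2.1 = 0 -> \sum_(u <- s) u.1.2 * chi' u.2.2 = 0.
Proof.
have rK := proj1 isoK; pose f (u : (K * K') * (F * F')) := u.2.1 != 0.
have drop0 (t : seq ((K * K') * (F * F'))) : (forall u, u \in t -> SK u.1 /\ SF u.2) ->
    (\sum_(u <- [seq u <- t | f u]) u.1.1 * chi u.2.1 = \sum_(u <- t) u.1.1 * chi u.2.1)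
    * (\sum_(u <- [seq u <- t | f u]) u.1.2 * chi' u.2.2 = \sum_(u <- t) u.1.2 * chi' u.2.2).
  move=> ht; rewrite !big_filter; split; rewrite big_mkcond big_seq [RHS]big_seq;
    apply: eq_bigr => u /ht[_ Su]; rewrite /f; case: (eqVneq u.2.1 0) => //= u0.
    by rewrite u0 chi0 mulr0.
  have /eqP -> : u.2.2 == 0 by rewrite -(piso_eq0 isoF Su) u0.
  by rewrite chi0' mulr0.
have [n] := ubnP (size s); elim: n s => // n IH s /ltnSE sn hs.
have [e1 e2] := drop0 s hs; rewrite -e1 -e2 {e1 e2}.
have : forall u, u \in [seq u <- s | f u] -> [/\ SK u.1, SF u.2 & u.2.1 != 0].
  by move=> u; rewrite mem_filter => /andP[u0 /hs[]].
have : (size [seq u <- s | f u] <= n)%N.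
  by apply: leq_trans sn; rewrite size_filter count_size.
move: ([seq u <- s | f u]) => {hs sn}s sn hs sum0.
case: s => [|u0 s'] in sn hs sum0 *; first by rewrite !big_nil.
set s := u0 :: s' in sn hs sum0 *.
have [Su0K Su0F nz0] := hs u0 (mem_head _ _).
have nz0' : u0.2.2 != 0 by rewrite -(piso_eq0 isoF Su0F).
pose P (u : (K * K') * (F * F')) := `[< G (u.2.1 / u0.2.1) >].
have SF0 u : u \in s -> SF (u.2.1 / u0.2.1, u.2.2 / u0.2.2).
  by move=> /hs[_ Su _]; apply: (piso_div isoF).
have sumP : \sum_(u <- s | P u) u.1.1 * chi (u.2.1 / u0.2.1) = 0.
  have := @strong_graded _ _ chi chiM chi1 G (pdom SK)
    [seq (u.1.1, u.2.1 / u0.2.1) | u <- s] pureG strG.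
  rewrite !big_map; apply.
    move=> _ /mapP[u /hs[Ku Fu u20] ->] /=; split; last by rewrite mulf_neq0 ?invr_neq0.
    by apply: acl_sub; left; exists u.1.
  rewrite -[RHS](mul0r (chi u0.2.1)^-1) -[in RHS]sum0 mulr_suml.
  by apply: eq_bigr => u _; rewrite (chi_div chiM chi1) ?mulrA.
pose w : K * K' := \sum_(u <- s | P u) u.1 * (chi (u.2.1 / u0.2.1), chi' (u.2.2 / u0.2.2)).
have Sw : SK w.
  rewrite /w big_seq_cond; apply: (subring_sum rK) => u /andP[us /asboolP Gu].
  apply: (subringM rK); first by case: (hs u us).
  exact: (compatG (SF0 u us) Gu).
have w1 : w.1 = 0.
  by rewrite -[RHS]sumP /w (raddf_sum (fst : {rmorphism (K * K')%type -> K})).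
have w2 : \sum_(u <- s | P u) u.1.2 * chi' (u.2.2 / u0.2.2) = 0.
  have /eqP : w.2 == 0 by rewrite -(piso_eq0 isoK Sw) w1.
  by rewrite /w (raddf_sum (snd : {rmorphism (K * K')%type -> K'})).
have sumP1 : \sum_(u <- s | P u) u.1.1 * chi u.2.1 = 0.
  rewrite -[RHS](mul0r (chi u0.2.1)) -[in RHS]sumP mulr_suml.
  by apply: eq_bigr => u _; rewrite -mulrA -chiM divfK.
have sumP2 : \sum_(u <- s | P u) u.1.2 * chi' u.2.2 = 0.
  rewrite -[RHS](mul0r (chi' u0.2.2)) -[in RHS]w2 mulr_suml.
  by apply: eq_bigr => u _; rewrite -mulrA -chiM' divfK.
rewrite (bigID P) /= sumP2 add0r -big_filter; apply: IH.
- apply: leq_trans sn; rewrite size_filter ltnS /s /= {1}/P divff // asboolT ?add0n.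
    exact: count_size.
  exact: pure1.
- by move=> u; rewrite mem_filter => /andP[_ /hs[]].
- by rewrite big_filter -[RHS]sum0 [RHS](bigID P) /= sumP1 add0r.
Qed.
End Transfer.

Section ChiExtend.
Variables (F K F' K' : closedFieldType) (chi : F -> K) (chi' : F' -> K').
Hypotheses (chiP : character chi) (chiP' : character chi').
Let chiM : forall a b, chi (a * b) = chi a * chi b. Proof. by case: chiP. Qed.
Let chi1 : chi 1 = 1. Proof. by case: chiP. Qed.
Let chiM' : forall a b, chi' (a * b) = chi' a * chi' b. Proof. by case: chiP'. Qed.
Let chi1' : chi' 1 = 1. Proof. by case: chiP'. Qed.

Definition chi2 (z : F * F') : K * K' := (chi z.1, chi' z.2).

Lemma chi2M z w : chi2 (z * w) = chi2 z * chi2 w.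
Proof. by rewrite /chi2 /= chiM chiM'. Qed.
Lemma chi21 : chi2 1 = 1. Proof. by rewrite /chi2 /= chi1 chi1'. Qed.

Variables (SF : F * F' -> Prop) (SK : K * K' -> Prop) (G : F -> Prop) (G' : F' -> Prop).
Hypotheses (isoF : piso SF) (isoK : piso SK).
Hypotheses (cF : algclosed_in (pdom SF)) (cF' : algclosed_in (pcod SF)).
Hypotheses (pureG : pure_subgroup G) (pureG' : pure_subgroup G').
Hypotheses (strG : strong chi G (pdom SK)) (strG' : strong chi' G' (pcod SK)).
Hypothesis GG' : forall z, SF z -> G z.1 <-> G' z.2.
Hypothesis compatG : forall z, SF z -> G z.1 -> SK (chi2 z).

Let T w := exists s : seq ((K * K') * (F * F')),
  (forall u, u \in s -> SK u.1 /\ SF u.2) /\ \sum_(u <- s) u.1 * chi2 u.2 = w.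

Let rF := proj1 isoF.
Let rK := proj1 isoK.

Let T_term w z : SK w -> SF z -> T (w * chi2 z).
Proof.
move=> Sw Sz; exists [:: (w, z)]; rewrite big_seq1; split=> // u.
by rewrite inE => /eqP ->.
Qed.

Let T_K w : SK w -> T w.
Proof.
by move=> Sw; rewrite -[w]mulr1 -chi21; apply: T_term => //; apply: subring1.
Qed.

Let T_F z : SF z -> T (chi2 z).
Proof.
by move=> Sz; rewrite -[chi2 z]mul1r; apply: T_term => //; apply: subring1.
Qed.

Let T_ring : subring_set T.
Proof.
split; first by apply: T_K; apply: subring1.
- move=> _ _ [s [hs <-]] [t [ht <-]].
  exists (s ++ [seq (- u.1, u.2) | u <- t]); split.
    move=> u; rewrite mem_cat => /orP[/hs//|/mapP[v /ht[v1 v2] ->]].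
    by split=> //; apply: subringN.
  rewrite big_cat big_map; congr (_ + _); rewrite -sumrN.
  by apply: eq_bigr => u _; rewrite mulNr.
- move=> _ _ [s [hs <-]] [t [ht <-]].
  exists [seq (u.1 * v.1, u.2 * v.2) | u <- s, v <- t]; split.
    move=> _ /allpairsP[[u v] /= [/hs[u1 u2] /ht[v1 v2] ->]].
    by split; apply: subringM.
  rewrite big_allpairs_dep mulr_suml; apply: eq_bigr => u _.
  rewrite mulr_sumr; apply: eq_bigr => v _.
  by rewrite chi2M /= mulrACA.
Qed.

Let T_iso : piso T.
Proof.
split=> // _ [s [hs <-]].
rewrite (raddf_sum (fst : {rmorphism (K * K')%type -> K})).
rewrite (raddf_sum (snd : {rmorphism (K * K')%type -> K'})) /=.
apply/eqP/eqP.
  exact: (@relation_transfer _ _ _ _ chi chi' chiP chiP' SF SK G).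
pose s' := [seq ((u.1.2, u.1.1), (u.2.2, u.2.1)) | u <- s].
have := @relation_transfer _ _ _ _ chi' chi chiP' chiP (pflip SF) (pflip SK) G'
   (pflip_iso isoF) (pflip_iso isoK).
rewrite !pdom_flip => /(_ cF' pureG' strG') h sum0.
have := h _ s'; rewrite /s' !big_map; apply=> //.
  move=> z Sz; rewrite -(GG' Sz) => Gz; exact: (compatG Sz Gz).
by move=> _ /mapP[[[a b] [c d]] /hs ? ->].
Qed.

(** The isomorphism of the second sort extends along [chi]: the linear relations
    between the new values are those forced by [G]. *)
Theorem chi_extend : exists SK1, [/\ piso SK1, forall w, SK w -> SK1 w,
    forall z, SF z -> SK1 (chi2 z),
    forall x, pdom SK1 x <-> acl (with_image chi (pdom SK) (pdom SF)) x
  & forall x, pcod SK1 x <-> acl (with_image chi' (pcod SK) (pcod SF)) x].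
Proof.
have [SK1 [iso1 T1 d1 c1]] := piso_acl T_iso.
exists SK1; split=> // [w Sw|z Sz|x|x].
- exact/T1/T_K.
- exact/T1/T_F.
- rewrite d1; split; apply: acl_mono => y.
    case=> _ [s [hs <-]] <-; rewrite (raddf_sum (fst : {rmorphism (K * K')%type -> K})).
    rewrite big_seq; apply: (subring_sum (acl_ring _)) => u /hs[u1 u2].
    apply: (subringM (acl_ring _)); apply: acl_sub; first by left; exists u.1.
    by right; exists u.2.1 => //; exists u.2.
  case=> [[w Sw <-]|[_ [z Sz <-] <-]]; apply: acl_sub.
    by exists w => //; apply: T_K.
  by exists (chi2 z) => //; apply: T_F.
- rewrite c1; split; apply: acl_mono => y.
    case=> _ [s [hs <-]] <-; rewrite (raddf_sum (snd : {rmorphism (K * K')%type -> K'})).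
    rewrite big_seq; apply: (subring_sum (acl_ring _)) => u /hs[u1 u2].
    apply: (subringM (acl_ring _)); apply: acl_sub; first by left; exists u.1.
    by right; exists u.2.2 => //; exists u.2.
  case=> [[w Sw <-]|[_ [z Sz <-] <-]]; apply: acl_sub.
    by exists w => //; apply: T_K.
  by exists (chi2 z) => //; apply: T_F.
Qed.
End ChiExtend.

Section Side.
Variables (F K : closedFieldType) (chi : F -> K).
Hypothesis chiP : character chi.

Definition chi_range y := exists x, chi x = y.

(** What a position of the game requires of the substructure [(A, B)] on one side.
    The last two clauses keep it small, so that a structure of infinite
    transcendence degrees always has further transcendental elements. *)
Definition side (A : F -> Prop) (B : K -> Prop) :=
  [/\ algclosed_in A, algclosed_in B, strong chi (nonzero A) B,
    exists s : seq F, forall x, A x -> acl (fun y => y \in s) x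
  & exists t : seq K, forall y, B y -> acl (fun z => chi_range z \/ z \in t) y].

(** Infinite transcendence degree of [F], and of [K] over the range of [chi]. *)
Definition wideF := forall s : seq F, exists x, ~ acl (fun y => y \in s) x.
Definition wideK :=
  forall t : seq K, exists y, ~ acl (fun z => chi_range z \/ z \in t) y.

(** The property [strong] survives because it speaks of pure subgroups that
    contain the new [A1] already, and over which [B1] is algebraic. *)
Lemma side_extF A B A1 B1 : side A B -> (forall x, A x -> A1 x) -> algclosed_in A1 ->
  (exists s : seq F, forall x, A1 x -> acl (fun y => y \in s) x) ->
  (forall y, B1 y <-> acl (with_image chi B A1) y) -> side A1 B1.
Proof.
case=> cA cB strAB fA [t ht] AA1 cA1 fA1 B1E; have chi0 : chi 0 = 0 by case: chiP.
have B1eq : B1 = acl (with_image chi B A1) by apply/funext => y; apply/propext.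
split=> //; first by rewrite B1eq; apply: acl_closed.
- move=> H pureH AH g g0 nHg; apply: contra_not (strAB H pureH _ g g0 nHg); last first.
    by move=> x [Ax x0]; apply: AH; split=> //; apply: AA1.
  apply: acl_mono => y [|[h Hh <-]]; last by apply: acl_sub; right; exists h.
  rewrite B1eq; apply: acl_mono => z [Bz|[h A1h <-]]; first by apply: acl_sub; left.
  have [->|h0] := eqVneq h 0; first by rewrite chi0; apply: (subring0 (acl_ring _)).
  by apply: acl_sub; right; exists h => //; apply: AH.
- exists t => y; rewrite B1eq; apply: acl_mono => z [/ht//|[h _ <-]].
  by apply: acl_sub; left; exists h.
Qed.

(** If [b] spoiled [strong], it would by exchange be algebraic over [B] and the
    range of [chi]. *)
Lemma side_extK A B B1 b : side A B -> ~ acl (fun z => B z \/ chi_range z) b ->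
  (forall y, B1 y <-> acl (adjoin_set B b) y) -> side A B1.
Proof.
case=> cA cB strAB fA [t ht] nb B1E.
have B1eq : B1 = acl (adjoin_set B b) by apply/funext => y; apply/propext.
split=> //; first by rewrite B1eq; apply: acl_closed.
- move=> H pureH AH g g0 nHg gB1; apply: nb; have nBg := strAB H pureH AH g g0 nHg.
  have : acl (adjoin_set (with_image chi B H) b) (chi g).
    apply: acl_mono gB1 => y [|[h Hh <-]]; last by apply: acl_sub; left; right; exists h.
    by rewrite B1eq; apply: aclS => z [Bz|->]; [left; left|right].
  move=> /acl_exchange/(_ nBg); apply: aclS => y [[By|[h _ <-]]|->]; [by left| |].
    by right; exists h.
  by right; exists g.
- exists (b :: t) => y; rewrite B1eq; apply: acl_mono => z [/ht|->].
    by apply: aclS => w [?|wt]; [left|right; rewrite inE wt orbT].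
  by apply: acl_sub; right; rewrite mem_head.
Qed.

Lemma chi_range_fin B b : acl (fun z => B z \/ chi_range z) b ->
  exists s : seq F, acl (fun z => B z \/ exists2 x, x \in s & chi x = z) b.
Proof.
case/acl_fin => t ht bt.
have [s hs] : exists s : seq F, forall y, y \in t -> B y \/ exists2 x, x \in s & chi x = y.
  elim: t ht {bt} => [|y t IH] ht; first by exists [::].
  have [|s hs] := IH; first by move=> z zt; apply: ht; rewrite inE zt orbT.
  have [By|[x xy]] := ht y (mem_head _ _).
    by exists s => z; rewrite inE => /predU1P[->|/hs]; [left|].
  exists (x :: s) => z; rewrite inE => /predU1P[->|/hs[Bz|[w ws <-]]]; [|by left|].
    by right; exists x => //; rewrite mem_head.
  by right; exists w => //; rewrite inE ws orbT.
by exists s; apply: aclS bt => y /hs.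
Qed.
End Side.

Definition state (F K F' K' : closedFieldType) (chi : F -> K) (chi' : F' -> K') SF SK :=
  [/\ piso SF, piso SK, forall z, SF z -> SK (chi2 chi chi' z),
    side chi (pdom SF) (pdom SK) & side chi' (pcod SF) (pcod SK)].

Lemma state_flip (F K F' K' : closedFieldType) (chi : F -> K) (chi' : F' -> K') SF SK :
  state chi chi' SF SK -> state chi' chi (pflip SF) (pflip SK).
Proof.
case=> isoF isoK comp s s'; rewrite /state !pdom_flip !pcod_flip.
by split=> // [||z /comp//]; apply: pflip_iso.
Qed.

Section Steps.
Variables (F K F' K' : closedFieldType) (chi : F -> K) (chi' : F' -> K').
Hypotheses (chiP : character chi) (chiP' : character chi').
Hypotheses (wF' : wideF F') (wK' : wideK chi').

(** A new element of the first sort is matched with any transcendental one; the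
    second sort then follows by [chi_extend]. *)
Lemma stepF SF SK a : state chi chi' SF SK -> exists SF1 SK1,
  [/\ state chi chi' SF1 SK1, forall z, SF z -> SF1 z, forall z, SK z -> SK1 z & pdom SF1 a].
Proof.
case=> isoF isoK comp sd sd'.
have [ha|na] := pselect (pdom SF a); first by exists SF, SK.
have [cA cB strAB [s hs] _] := sd; have [cA' cB' strAB' [s' hs'] _] := sd'.
have [a' na'] := wF' s'.
have {}na' : ~ pcod SF a' by move=> /hs'.
have isoA : piso (padjoin SF (a, a')).
  apply: padjoin_trans => //= h; [apply: na|apply: na'].
    exact: (proj2 cA).
  exact: (proj2 cA').
have [SF1 [iso1 sub1 d1 c1]] := piso_acl isoA.
have rF := proj1 isoF.
have sub z : SF z -> SF1 z by move=> Sz; apply: sub1; apply: padjoin_sub.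
have SF1a : SF1 (a, a') by apply: sub1; apply: padjoin_gen.
have cd1 : algclosed_in (pdom SF1).
  have -> : pdom SF1 = acl (pdom (padjoin SF (a, a'))) by apply/funext => x; apply/propext.
  exact: acl_closed.
have cc1 : algclosed_in (pcod SF1).
  have -> : pcod SF1 = acl (pcod (padjoin SF (a, a'))) by apply/funext => x; apply/propext.
  exact: acl_closed.
have GG' z : SF1 z -> nonzero (pdom SF) z.1 <-> nonzero (pcod SF) z.2.
  move=> Sz; rewrite /nonzero (piso_eq0 iso1 Sz); split=> -[[w Sw wz] z0]; split=> //.
    by exists w => //; rewrite (piso_inj iso1 (sub w Sw) Sz wz).
  exists w => //.
  by have := piso_inj (pflip_iso iso1) (z := (w.2, w.1)) (z' := (z.2, z.1));
     case: w z Sw Sz wz z0 => [w1 w2] [z1 z2] /= /sub Sw Sz wz _ /(_ Sw Sz wz) [].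
have compG z : SF1 z -> nonzero (pdom SF) z.1 -> SK (chi2 chi chi' z).
  move=> Sz [[w Sw wz] _]; rewrite -(piso_inj iso1 (sub w Sw) Sz wz).
  exact: comp.
have [SK1 [isoK1 subK comp1 dK1 cK1]] := chi_extend chiP chiP' iso1 isoK cd1 cc1
  (pure_closed cA) (pure_closed cA') strAB strAB' GG' compG.
exists SF1, SK1; split=> //; last by exists (a, a').
split=> //.
- apply: (side_extF chiP sd) => //; first by move=> x [z Sz <-]; exists z => //; apply: sub.
  exists (a :: s) => x; rewrite d1; apply: acl_mono => _ [z /(padjoin_acl isoF)[/= hz _] <-].
  apply: acl_mono hz => w [/hs|->]; last by apply: acl_sub; rewrite mem_head.
  by apply: aclS => v vs; rewrite inE vs orbT.
- apply: (side_extF chiP' sd') => //; first by move=> x [z Sz <-]; exists z => //; apply: sub.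
  exists (a' :: s') => x; rewrite c1; apply: acl_mono => _ [z /(padjoin_acl isoF)[/= _ hz] <-].
  apply: acl_mono hz => w [/hs'|->]; last by apply: acl_sub; rewrite mem_head.
  by apply: aclS => v vs; rewrite inE vs orbT.
Qed.

Lemma stepF_seq (l : seq F) SF SK : state chi chi' SF SK -> exists SF1 SK1,
  [/\ state chi chi' SF1 SK1, forall z, SF z -> SF1 z, forall z, SK z -> SK1 z
    & forall a, a \in l -> pdom SF1 a].
Proof.
elim: l SF SK => [|a l IH] SF SK st; first by exists SF, SK.
have [SF1 [SK1 [st1 sF sK [z Sz za]]]] := stepF a st.
have [SF2 [SK2 [st2 sF2 sK2 hl]]] := IH _ _ st1.
exists SF2, SK2; split=> // [w /sF/sF2//|w /sK/sK2//|x].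
by rewrite inE => /predU1P[->|/hl//]; exists z => //; apply: sF2.
Qed.

(** An element algebraic over the range of [chi] is reached by finitely many moves
    in the first sort; any other one is matched with an element transcendental
    over the range. *)
Lemma stepK SF SK b : state chi chi' SF SK -> exists SF1 SK1,
  [/\ state chi chi' SF1 SK1, forall z, SF z -> SF1 z, forall z, SK z -> SK1 z & pdom SK1 b].
Proof.
move=> st; have [isoF isoK comp sd sd'] := st.
have [/chi_range_fin[l bl]|nb] := pselect (acl (fun z => pdom SK z \/ chi_range chi z) b).
  have [SF1 [SK1 [st1 sF sK hl]]] := stepF_seq l st; exists SF1, SK1; split=> //.
  have [_ _ comp1 [_ cB _ _ _] _] := st1.
  apply: (acl_id cB); apply: aclS bl => y [[z Sz <-]|[x xl <-]].
    by exists z => //; apply: sK.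
  by have [z /comp1 Sz <-] := hl x xl; exists (chi2 chi chi' z).
have [cA cB strAB hs [t ht]] := sd; have [cA' cB' strAB' hs' [t' ht']] := sd'.
have [b' nb'] := wK' t'.
have {}nb' : ~ acl (fun z => pcod SK z \/ chi_range chi' z) b'.
  apply: contra_not nb'; apply: acl_mono => y [/ht'//|ry].
  by apply: acl_sub; left.
have isoA : piso (padjoin SK (b, b')).
  apply: padjoin_trans => //= /acl_alg_over h; [apply: nb|apply: nb'].
    by apply: aclS h => z ?; left.
  by apply: aclS h => z ?; left.
have [SK1 [iso1 sub1 d1 c1]] := piso_acl isoA.
have rK := proj1 isoK.
have sub z : SK z -> SK1 z by move=> Sz; apply: sub1; apply: padjoin_sub.
exists SF, SK1; split=> //; last by exists (b, b') => //; apply: sub1; apply: padjoin_gen.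
split=> // [z /comp/sub//||].
- apply: (side_extK sd nb) => y; rewrite d1; split; apply: acl_mono => x.
    by case=> z /(padjoin_acl isoK)[/= hz _] <-.
  case=> [[z Sz <-]|->]; apply: acl_sub; first by exists z => //; apply: padjoin_sub.
  by exists (b, b') => //; apply: padjoin_gen.
- apply: (side_extK sd' nb') => y; rewrite c1; split; apply: acl_mono => x.
    by case=> z /(padjoin_acl isoK)[/= _ hz] <-.
  case=> [[z Sz <-]|->]; apply: acl_sub; first by exists z => //; apply: padjoin_sub.
  by exists (b, b') => //; apply: padjoin_gen.
Qed.
End Steps.

Section Game.
Variables (F K F' K' : closedFieldType) (chi : F -> K) (chi' : F' -> K').
Hypotheses (chiP : character chi) (chiP' : character chi').
Hypotheses (wF : wideF F) (wK : wideK chi) (wF' : wideF F') (wK' : wideK chi').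
Local Notation M := (Lstructure_of chi).
Local Notation M' := (Lstructure_of chi').

Definition linked (T T' : Type) (S : T * T' -> Prop) n (v : 'I_n -> T) (v' : 'I_n -> T') :=
  forall i, S (v i, v' i).

Lemma linked_extend (T T' : Type) (S : T * T' -> Prop) n x x' (v : 'I_n -> T) (v' : 'I_n -> T') :
  S (x, x') -> linked S v v' -> linked S (extend x v) (extend x' v').
Proof. by move=> Sx Sv i; rewrite /extend; case: unlift. Qed.

Lemma evalF_linked SF n (v : 'I_n -> F) (v' : 'I_n -> F') t : piso SF -> linked SF v v' ->
  SF (evalF (M := M) v t, evalF (M := M') v' t).
Proof.
move=> [rF _] Sv; elim: t => //=.
- exact: (subring0 rF).
- exact: (subring1 rF).
- by move=> t1 IH1 t2 IH2; apply: (subringD rF IH1 IH2).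
- by move=> t1 IH1; apply: (subringN rF IH1).
- by move=> t1 IH1 t2 IH2; apply: (subringM rF IH1 IH2).
Qed.

Lemma evalK_linked SF SK n m (v : 'I_n -> F) (v' : 'I_n -> F') (w : 'I_m -> K) (w' : 'I_m -> K') t :
  state chi chi' SF SK -> linked SF v v' -> linked SK w w' ->
  SK (evalK (M := M) v w t, evalK (M := M') v' w' t).
Proof.
move=> [isoF [rK _] comp _ _] Sv Sw; elim: t => //=.
- exact: (subring0 rK).
- exact: (subring1 rK).
- by move=> t1 IH1 t2 IH2; apply: (subringD rK IH1 IH2).
- by move=> t1 IH1; apply: (subringN rK IH1).
- by move=> t1 IH1 t2 IH2; apply: (subringM rK IH1 IH2).
- by move=> t; apply: (comp _ (evalF_linked t isoF Sv)).
Qed.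

Lemma piso_eq (E E' : fieldType) (S : E * E' -> Prop) x y x' y' : piso S ->
  S (x, x') -> S (y, y') -> x = y <-> x' = y'.
Proof.
move=> isoS Sx Sy; have := piso_eq0 isoS (subringB (proj1 isoS) Sx Sy).
by rewrite /= !subr_eq0 => e; split=> /eqP h; apply/eqP; [rewrite -e|rewrite e].
Qed.

Theorem game n m (phi : formula n m) SF SK
    (v : 'I_n -> F) (v' : 'I_n -> F') (w : 'I_m -> K) (w' : 'I_m -> K') :
  state chi chi' SF SK -> linked SF v v' -> linked SK w w' ->
  holds (M := M) v w phi <-> holds (M := M') v' w' phi.
Proof.
elim: phi SF SK v v' w w' => {n m}
  [n m t1 t2|n m t1 t2|n m p IH|n m p IHp q IHq|n m p IH|n m p IH] SF SK v v' w w' st Sv Sw /=.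
- have [isoF _ _ _ _] := st.
  by apply: (piso_eq isoF); apply: evalF_linked.
- have [_ isoK _ _ _] := st.
  by apply: (piso_eq isoK); apply: evalK_linked st Sv Sw.
- by rewrite (IH _ _ _ _ _ _ st Sv Sw).
- by rewrite (IHp _ _ _ _ _ _ st Sv Sw) (IHq _ _ _ _ _ _ st Sv Sw).
- split=> -[x hx].
    have [SF1 [SK1 [st1 sF sK [[a a'] Sz /= za]]]] := stepF chiP chiP' wF' x st.
    rewrite za in Sz; exists a'.
    rewrite -(IH _ _ (extend x v) (extend a' v') w w' st1) //; last by move=> i; apply: sK.
    by apply: linked_extend => // i; apply: sF.
  have [SF1 [SK1 [st1 sF sK [[a a'] Sz /= za]]]] := stepF chiP' chiP wF x (state_flip st).
  rewrite za in Sz; exists a'; have st2 := state_flip st1.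
  rewrite (IH _ _ (extend a' v) (extend x v') w w' st2) //.
    by apply: linked_extend => // i; apply: (sF (_, _)); apply: Sv.
  by move=> i; apply: (sK (_, _)); apply: Sw.
- split=> -[x hx].
    have [SF1 [SK1 [st1 sF sK [[a a'] Sz /= za]]]] := stepK chiP chiP' wF' wK' x st.
    rewrite za in Sz; exists a'.
    rewrite -(IH _ _ v v' (extend x w) (extend a' w') st1) //; first by move=> i; apply: sF.
    by apply: linked_extend => // i; apply: sK.
  have [SF1 [SK1 [st1 sF sK [[a a'] Sz /= za]]]] := stepK chiP' chiP wF wK x (state_flip st).
  rewrite za in Sz; exists a'; have st2 := state_flip st1.
  rewrite (IH _ _ v v' (extend a' w) (extend x w') st2) //.
    by move=> i; apply: (sF (_, _)); apply: Sv.
  by apply: linked_extend => // i; apply: (sK (_, _)); apply: Sw.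
Qed.
End Game.

(** * The initial position *)

Lemma int_eq0_char (E E' : fieldType) (k : int) : [pchar E] =i [pchar E'] ->
  (k%:~R == 0 :> E) = (k%:~R == 0 :> E').
Proof.
move=> eqc; have nat_eq (n : nat) : (n%:R == 0 :> E) = (n%:R == 0 :> E').
  apply: negb_inj; rewrite !natf_neq0_pchar; apply: eq_pnat => p.
  exact: (congr1 negb (eqc p)).
by case: k => n; rewrite ?NegzE ?mulrNz ?oppr_eq0 -!pmulrn nat_eq.
Qed.

Lemma pairX (R R' : nzRingType) (x : R) (y : R') n : (x, y) ^+ n = (x ^+ n, y ^+ n) :> R * R'.
Proof. by elim: n => [|n IH]; rewrite ?expr0 // !exprS IH. Qed.

Definition int_graph (E E' : fieldType) (z : E * E') := exists k : int, z = (k%:~R, k%:~R).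

Lemma int_graph_iso (E E' : fieldType) : [pchar E] =i [pchar E'] -> piso (@int_graph E E').
Proof.
move=> eqc; split=> [|_ [k ->]] /=; last exact: int_eq0_char.
split=> [|_ _ [k ->] [l ->]|_ _ [k ->] [l ->]]; first by exists 1.
- by exists (k - l); rewrite !rmorphB.
- by exists (k * l); rewrite !rmorphM.
Qed.

Lemma prime_piso (E E' : closedFieldType) : [pchar E] =i [pchar E'] -> exists S : E * E' -> Prop,
  [/\ piso S, forall x, pdom S x <-> acl (fun _ => False) x
    & forall y, pcod S y <-> acl (fun _ => False) y].
Proof.
move=> eqc; have [S [isoS sub dS cS]] := piso_acl (int_graph_iso eqc).
exists S; split=> // x.
  rewrite dS; split; apply: acl_mono => // _ [_ [k ->] <-].
  exact: (subring_int (acl_ring _)).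
rewrite cS; split; apply: acl_mono => // _ [_ [k ->] <-].
exact: (subring_int (acl_ring _)).
Qed.

Lemma algC_acl (x : algC) : acl (fun _ => False) x.
Proof.
have [p [pE mon_p _]] := minCpolyP x; have cA := acl_closed (fun _ : algC => False).
have rA := proj1 cA.
apply: (algclosed_root cA (p := minCpoly x)).
- by rewrite monic_neq0 // minCpoly_monic.
- rewrite pE => i; rewrite coef_map /= /ratr.
  by apply: (algclosed_div cA); apply: (subring_int rA).
- exact: root_minCpoly.
Qed.

(** Primitive roots of unity of the same order are conjugate, as the cyclotomic
    polynomials are irreducible. *)
Lemma prim_root_conj m (c c' : algC) (P : {poly int}) :
  m.-primitive_root c -> m.-primitive_root c' ->
  root (map_poly intr P) c = root (map_poly intr P) c'.
Proof.
move=> prc prc'; have [p [pE mon_p pP]] := minCpolyP c; have [p' [pE' mon_p' pP']] := minCpolyP c'.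
have epp : p = p'.
  apply: (map_poly_inj (ratr : {rmorphism rat -> algC})).
  rewrite /= -pE -pE' (minCpoly_cyclotomic prc) (minCpoly_cyclotomic prc').
  by rewrite -(Cintr_Cyclotomic prc) -(Cintr_Cyclotomic prc').
have -> : map_poly (intr : int -> algC) P = map_poly ratr (map_poly intr P : {poly rat}).
  by rewrite -map_poly_comp; apply: eq_map_poly => k /=; rewrite ratr_int.
by rewrite pP pP' epp.
Qed.

Lemma piso_horner_int (E E' : fieldType) (S : E * E' -> Prop) z (P : {poly int}) :
  piso S -> S z -> ((map_poly intr P).[z.1] == 0) = ((map_poly intr P).[z.2] == 0).
Proof.
move=> isoS Sz; have rS := proj1 isoS.
have SP : S (map_poly intr P).[z].
  by apply: (subring_horner rS) => // i; rewrite coef_map; apply: (subring_int rS).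
have := piso_eq0 isoS SP; rewrite horner_fst horner_snd.
have intE (R R' : nzRingType) (f : {rmorphism R -> R'}) :
    map_poly f (map_poly intr P) = map_poly intr P.
  by apply/polyP => i; rewrite !coef_map /= rmorph_int.
by rewrite (intE _ _ (fst : {rmorphism (E * E')%type -> E}))
  (intE _ _ (snd : {rmorphism (E * E')%type -> E'})).
Qed.

Lemma torsion_acl (E : fieldType) (x : E) : torsion x -> acl (fun _ => False) x.
Proof.
case=> n n0 xn; apply: (algclosed_expr (acl_closed _) n0); rewrite xn.
exact: (subring1 (acl_ring _)).
Qed.

Lemma piso_expr_eq1 (E E' : fieldType) (S : E * E' -> Prop) z n :
  piso S -> S z -> (z.1 ^+ n == 1) = (z.2 ^+ n == 1).
Proof.
move=> isoS Sz; have rS := proj1 isoS.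
case: z Sz => x y Sz; have := piso_eq0 isoS (subringB rS (subringX rS n Sz) (subring1 rS)).
by rewrite pairX /= !subr_eq0.
Qed.

Section InitialTorsion.
Variables (F K : closedFieldType) (chi : F -> K).
Hypotheses (charK : [pchar K] =i pred0) (chiP : character chi) (chi_inj : injective chi).
Let chiM : forall a b, chi (a * b) = chi a * chi b. Proof. by case: chiP. Qed.
Let chi1 : chi 1 = 1. Proof. by case: chiP. Qed.

Lemma chi_torsion (x : F) : torsion x -> torsion (chi x).
Proof. by case=> n n0 xn; exists n; rewrite // -(chiX chiM chi1) xn. Qed.

(** Through [chi] the two roots of unity become powers of one primitive root in
    the algebraic numbers, and a Bezout relation between the exponents gives the
    common generator. *)
Lemma torsion_pair (x y : F) : torsion x -> torsion y -> exists a b e f,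
  x = (x ^+ a * y ^+ b) ^+ e /\ y = (x ^+ a * y ^+ b) ^+ f.
Proof.
move=> tx ty; have [|S [isoS dS cS]] := @prime_piso algC K.
  by move=> p; rewrite charK Num.Theory.pchar_num.
have rS := proj1 isoS.
have [[cx kx] Sx /= ex] : pcod S (chi x) by apply/cS; apply: torsion_acl; apply: chi_torsion.
have [[cy ky] Sy /= ey] : pcod S (chi y) by apply/cS; apply: torsion_acl; apply: chi_torsion.
rewrite {kx}ex in Sx; rewrite {ky}ey in Sy.
have [n n0 xn] := tx; have [m m0 ym] := ty; pose N := (n * m)%N.
have N0 : (0 < N)%N by rewrite muln_gt0 n0.
have xN : x ^+ N = 1 by rewrite exprM xn expr1n.
have yN : y ^+ N = 1 by rewrite /N mulnC exprM ym expr1n.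
have cxN : cx ^+ N = 1.
  by apply/eqP; rewrite (piso_expr_eq1 N isoS Sx) /= -(chiX chiM chi1) xN chi1.
have cyN : cy ^+ N = 1.
  by apply/eqP; rewrite (piso_expr_eq1 N isoS Sy) /= -(chiX chiM chi1) yN chi1.
have [w prw] := C_prim_root_exists N0.
have [e1 e1E] := prim_rootP prw cxN; have [e2 e2E] := prim_rootP prw cyN.
have back a b e u v : S (u, chi v) -> u = (cx ^+ a * cy ^+ b) ^+ e -> v = (x ^+ a * y ^+ b) ^+ e.
  move=> Su uE; apply: chi_inj; apply/eqP.
  have SE : S ((cx ^+ a * cy ^+ b) ^+ e, chi ((x ^+ a * y ^+ b) ^+ e)).
    have := subringX rS e (subringM rS (subringX rS a Sx) (subringX rS b Sy)).
    by rewrite !pairX /= (chiX chiM chi1) chiM !(chiX chiM chi1).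
  have := piso_eq0 isoS (subringB rS Su SE).
  by rewrite /= !subr_eq0 -uE eqxx => <-.
have [e10|e10] := posnP e1.
  exists 0%N, 1%N, 0%N, 1%N; split.
    by apply: (back _ _ _ cx) => //; rewrite e1E e10.
  by rewrite expr0 mul1r !expr1.
case: (egcdnP e2 e10) => km kn eg _.
have g0 : (0 < gcdn e1 e2)%N by rewrite gcdn_gt0 e10.
have gE : cx ^+ km * cy ^+ (kn * N.-1) = w ^+ gcdn e1 e2.
  rewrite e1E e2E -!exprM -exprD [(e1 * km)%N]mulnC eg.
  rewrite addnAC mulnA [(e2 * kn)%N]mulnC -mulnS prednK // exprD mulnC exprM.
  by rewrite (prim_expr_order prw) expr1n mul1r.
exists km, (kn * N.-1)%N, (e1 %/ gcdn e1 e2)%N, (e2 %/ gcdn e1 e2)%N; split.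
  by apply: (back _ _ _ cx) => //; rewrite gE -exprM mulnC divnK ?dvdn_gcdl.
by apply: (back _ _ _ cy) => //; rewrite gE -exprM mulnC divnK ?dvdn_gcdr.
Qed.
End InitialTorsion.

Lemma torsion_piso (E E' : fieldType) (S : E * E' -> Prop) z : piso S -> S z ->
  torsion z.1 <-> torsion z.2.
Proof.
move=> isoS Sz; split=> -[n n0 /eqP zn]; exists n => //; apply/eqP.
  by rewrite -(piso_expr_eq1 n isoS Sz).
by rewrite (piso_expr_eq1 n isoS Sz).
Qed.

Section Initial.
Variables (F K F' K' : closedFieldType) (chi : F -> K) (chi' : F' -> K').
Hypotheses (charK : [pchar K] =i pred0) (charK' : [pchar K'] =i pred0).
Hypothesis charF : [pchar F] =i [pchar F'].
Hypotheses (chiP : character chi) (chiP' : character chi').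
Hypotheses (chi_gen : generic chi) (chi_gen' : generic chi').
Let chi_inj : injective chi. Proof. by case: chi_gen. Qed.
Let chi_inj' : injective chi'. Proof. by case: chi_gen'. Qed.
Let chiM : forall a b, chi (a * b) = chi a * chi b. Proof. by case: chiP. Qed.
Let chi1 : chi 1 = 1. Proof. by case: chiP. Qed.
Let chiM' : forall a b, chi' (a * b) = chi' a * chi' b. Proof. by case: chiP'. Qed.
Let chi1' : chi' 1 = 1. Proof. by case: chiP'. Qed.

(** Injective characters preserve the order, so the two values are primitive roots
    of unity of the same order. *)
Lemma torsion_conj (z : F * F') (P : {poly int}) : torsion z.1 ->
  (forall n, (z.1 ^+ n == 1) = (z.2 ^+ n == 1)) ->
  ((map_poly intr P).[chi z.1] == 0) = ((map_poly intr P).[chi' z.2] == 0).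
Proof.
move=> tz ez; have tz' : torsion z.2.
  by case: tz => n n0 /eqP zn; exists n => //; apply/eqP; rewrite -ez.
have [|S [isoS dS cS]] := @prime_piso algC K.
  by move=> p; rewrite charK Num.Theory.pchar_num.
have [|S' [isoS' dS' cS']] := @prime_piso algC K'.
  by move=> p; rewrite charK' Num.Theory.pchar_num.
have [[c k] Sc /= ck] : pcod S (chi z.1) by apply/cS; apply: torsion_acl; apply: chi_torsion.
have [[c' k'] Sc' /= ck'] : pcod S' (chi' z.2) by apply/cS'; apply: torsion_acl; apply: chi_torsion.
rewrite {k}ck in Sc; rewrite {k'}ck' in Sc'.
rewrite -(piso_horner_int P isoS Sc) -(piso_horner_int P isoS' Sc') /=.
have ecc n : (c ^+ n == 1) = (c' ^+ n == 1).
  have := piso_expr_eq1 n isoS Sc; have := piso_expr_eq1 n isoS' Sc' => /= -> ->.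
  rewrite -(chiX chiM chi1) -(chiX chiM' chi1') -{1}chi1 -{1}chi1'.
  by rewrite !inj_eq.
have [n n0 zn] := tz.
have cn : c ^+ n = 1.
  by apply/eqP; rewrite (piso_expr_eq1 n isoS Sc) /= -(chiX chiM chi1) zn chi1.
have c'n : c' ^+ n = 1 by apply/eqP; rewrite -ecc cn.
have [m prc m_n] := prim_order_exists n0 cn; have [m' prc' m'_n] := prim_order_exists n0 c'n.
have emm : m = m'.
  apply/eqP; rewrite eqn_dvd; apply/andP; split.
    by rewrite (prim_order_dvd prc) ecc -(prim_order_dvd prc').
  by rewrite (prim_order_dvd prc') -ecc -(prim_order_dvd prc).
rewrite -emm in prc'; exact: (prim_root_conj P prc prc').
Qed.

Lemma torsion_list_cyclic (SF : F * F' -> Prop) (s : seq (F * F')) : piso SF ->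
  (forall z, z \in s -> SF z /\ torsion z.1) ->
  exists2 z, SF z /\ torsion z.1 & forall u, u \in s -> exists e, u = z ^+ e.
Proof.
move=> isoF; have rF := proj1 isoF; elim: s => [|u s IH] hs.
  by exists 1 => //; split; [apply: subring1|exists 1%N; rewrite ?expr1n].
have [|z [Sz tz] hz] := IH; first by move=> v vs; apply: hs; rewrite inE vs orbT.
have [Su tu] := hs u (mem_head _ _).
have [a [b [e [f [ue zf]]]]] := torsion_pair charK chiP chi_inj tu tz.
pose w := u ^+ a * z ^+ b.
have Sw : SF w by apply: (subringM rF); apply: (subringX rF).
have w1 : w.1 = u.1 ^+ a * z.1 ^+ b.
  by rewrite /w rmorphM !(rmorphXn (fst : {rmorphism (F * F')%type -> F})).
have lift v n : SF v -> v.1 = w.1 ^+ n -> v = w ^+ n.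
  move=> Sv vw; apply: (piso_inj isoF) => //; first exact: (subringX rF).
  by rewrite vw (rmorphXn (fst : {rmorphism (F * F')%type -> F})).
exists w.
  split=> //; rewrite w1; apply: (pureM (@pure_torsion F));
    exact: (pureX (@pure_torsion F)).
move=> v; rewrite inE => /predU1P[->|/hz[n ->]].
  by exists e; apply: lift => //; rewrite w1.
have -> : z = w ^+ f by apply: lift => //; rewrite w1.
by exists (f * n)%N; rewrite exprM.
Qed.

(** Finitely many roots of unity are powers of one of them, so a linear relation
    between their values is an integer polynomial equation for a single one. *)
Lemma torsion_start (SF : F * F' -> Prop) : piso SF -> exists SK : K * K' -> Prop,
  [/\ piso SK, forall z, SF z -> torsion z.1 -> SK (chi2 chi chi' z),
    forall x, pdom SK x -> acl (fun _ => False) x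
    & forall y, pcod SK y -> acl (fun _ => False) y].
Proof.
move=> isoF; have rF := proj1 isoF.
pose T w := exists s : seq (int * (F * F')),
  (forall u, u \in s -> SF u.2 /\ torsion u.2.1) /\
  \sum_(u <- s) u.1%:~R * chi2 chi chi' u.2 = w.
have T1 z : SF z -> torsion z.1 -> T (chi2 chi chi' z).
  move=> Sz tz; exists [:: (1, z)]; rewrite big_seq1 mul1r; split=> // u.
  by rewrite inE => /eqP ->.
have rT : subring_set T.
  split.
  - rewrite -(chi21 chiP chiP'); apply: T1; first exact: subring1.
    by exists 1%N; rewrite ?expr1n.
  - move=> _ _ [s [hs <-]] [t [ht <-]].
    exists (s ++ [seq (- u.1, u.2) | u <- t]); split.
      by move=> u; rewrite mem_cat => /orP[/hs//|/mapP[v /ht[v1 v2] ->]].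
    rewrite big_cat big_map; congr (_ + _); rewrite -sumrN.
    by apply: eq_bigr => u _; rewrite rmorphN mulNr.
  - move=> _ _ [s [hs <-]] [t [ht <-]].
    exists [seq (u.1 * v.1, u.2 * v.2) | u <- s, v <- t]; split.
      move=> _ /allpairsP[[u v] /= [/hs[u1 u2] /ht[v1 v2] ->]].
      split; first exact: subringM.
      exact: (pureM (@pure_torsion F)).
    rewrite big_allpairs_dep mulr_suml; apply: eq_bigr => u _.
    rewrite mulr_sumr; apply: eq_bigr => v _.
    by rewrite (chi2M chiP chiP') /= rmorphM mulrACA.
have isoT : piso T.
  split=> // _ [s [hs <-]].
  have [|z [Sz tz] hz] := @torsion_list_cyclic SF [seq u.2 | u <- s] isoF.
    by move=> _ /mapP[u us ->]; apply: hs.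
  have /choice[e eP] : forall u, exists n, u \in s -> u.2 = z ^+ n.
    move=> u; have [us|] := boolP (u \in s); last by exists 0%N.
    by have [|n uE] := hz u.2; [apply: map_f|exists n].
  pose P : {poly int} := \sum_(u <- s) u.1 *: 'X^(e u).
  have PE (R : nzRingType) (x : R) :
      (map_poly intr P).[x] = \sum_(u <- s) u.1%:~R * x ^+ e u.
    rewrite /P rmorph_sum horner_sum /=; apply: eq_bigr => u _.
    by rewrite map_polyZ map_polyXn hornerZ hornerXn.
  have chi2X n : chi2 chi chi' (z ^+ n) = chi2 chi chi' z ^+ n.
    elim: n => [|n IH]; first by rewrite !expr0 (chi21 chiP chiP').
    by rewrite !exprS (chi2M chiP chiP') IH.
  have -> : \sum_(u <- s) u.1%:~R * chi2 chi chi' u.2 = (map_poly intr P).[chi2 chi chi' z].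
    rewrite PE big_seq [RHS]big_seq; apply: eq_bigr => u us.
    by rewrite (eP u us) chi2X.
  rewrite horner_fst horner_snd.
  have intE (R R' : nzRingType) (f : {rmorphism R -> R'}) :
      map_poly f (map_poly intr P) = map_poly intr P.
    by apply/polyP => i; rewrite !coef_map /= rmorph_int.
  rewrite (intE _ _ (fst : {rmorphism (K * K')%type -> K})).
  rewrite (intE _ _ (snd : {rmorphism (K * K')%type -> K'})).
  by apply: torsion_conj => // n; apply: (piso_expr_eq1 n isoF Sz).
exists T; split=> // _ [_ [s [hs <-]] <-].
  rewrite (raddf_sum (fst : {rmorphism (K * K')%type -> K})) big_seq.
  apply: (subring_sum (acl_ring _)) => u /hs[_ tu]; apply: (subringM (acl_ring _)).
    rewrite (rmorph_int (fst : {rmorphism (K * K')%type -> K})).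
    exact: (subring_int (acl_ring _)).
  by apply: torsion_acl; apply: chi_torsion.
rewrite (raddf_sum (snd : {rmorphism (K * K')%type -> K'})) big_seq.
apply: (subring_sum (acl_ring _)) => u /hs[/(torsion_piso isoF) tE tu]; apply: (subringM (acl_ring _)).
  rewrite (rmorph_int (snd : {rmorphism (K * K')%type -> K'})).
  exact: (subring_int (acl_ring _)).
by apply: torsion_acl; apply: chi_torsion => //; apply/tE.
Qed.

(** The least position consists of the elements algebraic over the prime field in
    the first sort and of what their values generate in the second.  The values
    of torsion elements are matched by conjugacy, all others by [chi_extend]. *)
Theorem initial_state : exists SF SK, state chi chi' SF SK.
Proof.
have [SF [isoF dF cF]] := prime_piso charF.
have [SK0 [iso0 comp0 d0 c0]] := torsion_start isoF.
have cd : algclosed_in (pdom SF).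
  have -> : pdom SF = acl (fun _ => False) by apply/funext => x; apply/propext.
  exact: acl_closed.
have cc : algclosed_in (pcod SF).
  have -> : pcod SF = acl (fun _ => False) by apply/funext => x; apply/propext.
  exact: acl_closed.
have str0 (E L : closedFieldType) (ch : E -> L) (G : E -> Prop) (B : L -> Prop) :
    (forall b, B b -> acl (with_image ch (fun _ => False) (fun x => G x \/ x = 0)) b) ->
    ch 0 = 0 -> strong ch torsion (fun _ => False) -> strong ch G B.
  move=> hB ch0 strT H pureH GH g g0 nHg.
  apply: contra_not (strT H pureH (fun x tx => torsion_pure pureH tx) g g0 nHg).
  apply: acl_mono => y [/hB|[h Hh <-]]; last by apply: acl_sub; right; exists h.
  apply: acl_mono => _ [//|[h [Gh|->] <-]].
    by apply: acl_sub; right; exists h => //; apply: GH.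
  by rewrite ch0; apply: (subring0 (acl_ring _)).
have [[_ chi0 _] [_ chi0' _]] := (chiP, chiP').
have strT := generic_strong charK chiP chi_gen.
have strT' := generic_strong charK' chiP' chi_gen'.
have strG : strong chi torsion (pdom SK0) by apply: str0 => // b /d0; apply: aclS.
have strG' : strong chi' torsion (pcod SK0) by apply: str0 => // b /c0; apply: aclS.
have [SK [isoK _ comp dK cK]] := chi_extend chiP chiP' isoF iso0 cd cc
  (@pure_torsion F) (@pure_torsion F') strG strG'
  (fun z Sz => torsion_piso isoF Sz) comp0.
have dKE : pdom SK = acl (with_image chi (pdom SK0) (pdom SF)).
  by apply/funext => x; apply/propext.
have cKE : pcod SK = acl (with_image chi' (pcod SK0) (pcod SF)).
  by apply/funext => x; apply/propext.
exists SF, SK; split=> //; split=> //.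
- by rewrite dKE; apply: acl_closed.
- apply: str0 => // b; rewrite dKE; apply: acl_mono => y [/d0|[h Ah <-]]; first exact: aclS.
  apply: acl_sub; right; exists h => //; have [->|h0] := eqVneq h 0; [by right|by left].
- by exists [::] => x; rewrite dF; apply: aclS.
- exists [::] => y; rewrite dKE; apply: acl_mono => z [/d0|[h _ <-]]; first exact: aclS.
  by apply: acl_sub; left; exists h.
- by rewrite cKE; apply: acl_closed.
- apply: str0 => // b; rewrite cKE; apply: acl_mono => y [/c0|[h Ah <-]]; first exact: aclS.
  apply: acl_sub; right; exists h => //; have [->|h0] := eqVneq h 0; [by right|by left].
- by exists [::] => x; rewrite cF; apply: aclS.
- exists [::] => y; rewrite cKE; apply: acl_mono => z [/c0|[h _ <-]]; first exact: aclS.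
  by apply: acl_sub; left; exists h.
Qed.
End Initial.

(** * Ultraproducts *)

Definition nonprincipal_ultrafilter (U : (nat -> Prop) -> Prop) :=
  [/\ forall A B, U A -> U B -> U (fun n => A n /\ B n),
    forall A B : nat -> Prop, (forall n, A n -> B n) -> U A -> U B,
    forall A : nat -> Prop, U (fun n => ~ A n) <-> ~ U A
  & forall k, U (fun n => k <= n)%N].

Lemma exists_nonprincipal_ultrafilter : exists U, nonprincipal_ultrafilter U.
Proof.
have [U [[properU maxU] subU]] := @ultraFilterLemma nat _ eventually_filter.
have filterU := filter_filter; exists U.
have UI A B : U A -> U B -> U (fun n => A n /\ B n) by apply: filterI.
have US (A B : nat -> Prop) : (forall n, A n -> B n) -> U A -> U B by apply: filterS.
have U0 (A : nat -> Prop) : U A -> exists n, A n by apply: filter_ex.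
split=> // [A|k]; last by apply: subU; exists k.
split=> [UnA UA|nUA]; first by have [n []] := U0 _ (UI _ _ UA UnA).
pose G (B : nat -> Prop) := exists2 C, U C & forall n, C n -> ~ A n -> B n.
suff <- : G = U by exists (fun _ => True) => //; apply: filterT.
apply: maxU => [|B UB]; last by exists B.
split=> [[C UC hC]|].
  by apply: nUA; apply: US UC => n /hC h; apply: contrapT.
split; first by exists setT => //; apply: filterT.
- move=> B B' [C UC hC] [C' UC' hC']; exists (fun n => C n /\ C' n); first exact: UI.
  by move=> n [/hC h /hC' h'] nA; split; [apply: h|apply: h'].
- by move=> B B' BB' [C UC hC]; exists C => // n /hC h /h; apply: BB'.
Qed.

Section Ultraproduct.
Variables (U : (nat -> Prop) -> Prop) (hU : nonprincipal_ultrafilter U).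

Lemma ultraI A B : U A -> U B -> U (fun n => A n /\ B n). Proof. by case: hU => h _ _ _; apply: h. Qed.
Lemma ultraS (A B : nat -> Prop) : (forall n, A n -> B n) -> U A -> U B.
Proof. by case: hU => _ h _ _; apply: h. Qed.
Lemma ultraN (A : nat -> Prop) : U (fun n => ~ A n) <-> ~ U A. Proof. by case: hU. Qed.
Lemma ultra_ge k : U (fun n => k <= n)%N. Proof. by case: hU. Qed.
Lemma ultraT (A : nat -> Prop) : (forall n, A n) -> U A.
Proof. by move=> hA; apply: ultraS (ultra_ge 0) => n _. Qed.
Lemma ultra_ext (A B : nat -> Prop) : (forall n, A n <-> B n) -> U A <-> U B.
Proof. by move=> AB; split; apply: ultraS => n; rewrite AB. Qed.
Section Carrier.
Variable T : nat -> Type.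
Implicit Types f g : forall n, T n.

Definition ueq f g := U (fun n => f n = g n).

(** A point of the ultraproduct is the set of all functions that agree almost
    everywhere with some given one. *)
Definition ultra_type := {C : (forall n, T n) -> Prop | exists f, C = ueq f}.

Definition cls f : ultra_type := exist _ (ueq f) (ex_intro _ f erefl).

Definition rep (c : ultra_type) : forall n, T n := projT1 (cid (proj2_sig c)).

Lemma cls_eq f g : cls f = cls g <-> ueq f g.
Proof.
have refl h : ueq h h by apply: ultraT.
split=> [/(congr1 sval) /= e|fg]; first by rewrite e; apply: refl.
apply: eq_exist; apply/funext => h; apply/propext.
by split; move/(ultraI fg); apply: ultraS => n [-> ->].
Qed.

Lemma repK c : cls (rep c) = c.
Proof.
rewrite /rep; case: c => C hC /=; case: cid => f fC /=.
by apply: eq_exist.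
Qed.

Lemma rep_cls f : ueq (rep (cls f)) f. Proof. by apply/cls_eq; rewrite repK. Qed.

End Carrier.

Lemma cls_op1 (T T' : nat -> Type) (op : forall n, T n -> T' n) (f : forall n, T n) :
  cls (fun n => op n (rep (cls f) n)) = cls (fun n => op n (f n)).
Proof. by apply/cls_eq; apply: ultraS (rep_cls f) => n ->. Qed.

Lemma cls_op2 (T : nat -> Type) (op : forall n, T n -> T n -> T n) (f g : forall n, T n) :
  cls (fun n => op n (rep (cls f) n) (rep (cls g) n)) = cls (fun n => op n (f n) (g n)).
Proof.
by apply/cls_eq; apply: ultraS (ultraI (rep_cls f) (rep_cls g)) => n [-> ->].
Qed.

Definition ultra_ring (R : nat -> ring_structure) : ring_structure :=
  @RingStructure (ultra_type R) (cls (fun n => zeroS (R n))) (cls (fun n => oneS (R n)))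
    (fun x y => cls (fun n => addS (rep x n) (rep y n)))
    (fun x => cls (fun n => oppS (rep x n)))
    (fun x y => cls (fun n => mulS (rep x n) (rep y n))).

Definition ultraproduct (M : nat -> Lstructure) : Lstructure :=
  @LStructure (ultra_ring (fun n => sortF (M n))) (ultra_ring (fun n => sortK (M n)))
    (fun x => cls (fun n => charS (rep x n))).

Section Los.
Variable M : nat -> Lstructure.
Let N := ultraproduct M.

Lemma evalF_ultra n (v : 'I_n -> sortF N) t :
  evalF v t = cls (fun k => evalF (fun i => rep (v i) k) t).
Proof.
elim: t => //= [i|t1 -> t2 ->|t1 ->|t1 -> t2 ->]; first by rewrite -[LHS]repK.
- exact: (cls_op2 (fun k => @addS (sortF (M k)))).
- exact: (cls_op1 (fun k => @oppS (sortF (M k)))).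
- exact: (cls_op2 (fun k => @mulS (sortF (M k)))).
Qed.

Lemma evalK_ultra n m (v : 'I_n -> sortF N) (w : 'I_m -> sortK N) t :
  evalK v w t = cls (fun k => evalK (fun i => rep (v i) k) (fun i => rep (w i) k) t).
Proof.
elim: t => //= [i|t1 -> t2 ->|t1 ->|t1 -> t2 ->|t]; first by rewrite -[LHS]repK.
- exact: (cls_op2 (fun k => @addS (sortK (M k)))).
- exact: (cls_op1 (fun k => @oppS (sortK (M k)))).
- exact: (cls_op2 (fun k => @mulS (sortK (M k)))).
- by rewrite evalF_ultra; apply: (cls_op1 (fun k => @charS (M k))).
Qed.

Lemma rep_extend (T : nat -> Type) n (c : ultra_type T) (v : 'I_n -> ultra_type T) k :
  (fun i => rep (extend c v i) k) = extend (rep c k) (fun i => rep (v i) k).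
Proof. by apply/funext => i; rewrite /extend; case: unlift. Qed.

Theorem los n m (phi : formula n m) (v : 'I_n -> sortF N) (w : 'I_m -> sortK N) :
  holds v w phi <-> U (fun k => holds (fun i => rep (v i) k) (fun i => rep (w i) k) phi).
Proof.
elim: phi v w => {n m}
  [n m t1 t2|n m t1 t2|n m p IH|n m p IHp q IHq|n m p IH|n m p IH] v w /=.
- by rewrite !evalF_ultra; apply: cls_eq.
- by rewrite !evalK_ultra; apply: cls_eq.
- by rewrite IH ultraN.
- rewrite IHp IHq; split=> [[]|h]; first exact: ultraI.
  by split; apply: ultraS h => k [].
- split=> [[x /IH]|h].
    by apply: ultraS => k; rewrite rep_extend; exists (rep x k).
  have ex k : exists y : sortF (M k),
      (exists x, holds (extend x (fun i => rep (v i) k)) (fun i => rep (w i) k) p) ->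
      holds (extend y (fun i => rep (v i) k)) (fun i => rep (w i) k) p.
    have [[x hx]|no] := pselect (exists x : sortF (M k),
      holds (extend x (fun i => rep (v i) k)) (fun i => rep (w i) k) p); first by exists x.
    by exists (zeroS _).
  pose f k := projT1 (cid (ex k)).
  exists (cls f); apply/IH; apply: ultraS (ultraI h (rep_cls f)) => k [hk ek].
  by rewrite rep_extend ek; apply: (projT2 (cid (ex k))).
- split=> [[x /IH]|h].
    by apply: ultraS => k; rewrite rep_extend; exists (rep x k).
  have ex k : exists y : sortK (M k),
      (exists x, holds (fun i => rep (v i) k) (extend x (fun i => rep (w i) k)) p) ->
      holds (fun i => rep (v i) k) (extend y (fun i => rep (w i) k)) p.
    have [[x hx]|no] := pselect (exists x : sortK (M k),
      holds (fun i => rep (v i) k) (extend x (fun i => rep (w i) k)) p); first by exists x.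
    by exists (zeroS _).
  pose f k := projT1 (cid (ex k)).
  exists (cls f); apply/IH; apply: ultraS (ultraI h (rep_cls f)) => k [hk ek].
  by rewrite rep_extend ek; apply: (projT2 (cid (ex k))).
Qed.
End Los.
End Ultraproduct.

Section Ultrapower.
Variables (U : (nat -> Prop) -> Prop) (hU : nonprincipal_ultrafilter U).

Lemma satisfies_ultraproduct (M : nat -> Lstructure) phi :
  satisfies (ultraproduct U M) phi <-> U (fun k => satisfies (M k) phi).
Proof.
rewrite /satisfies los //; apply: ultra_ext => // k.
have envE T (v v' : 'I_0 -> T) : v = v' by apply/funext => -[].
by rewrite (envE _ (fun i => rep _ k) (@empty_env _)) (envE _ (fun i => rep _ k) (@empty_env _)).
Qed.

Lemma ultra_const (P : Prop) : U (fun _ => P) <-> P.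
Proof.
split=> [UP|hP]; last exact: ultraT.
by apply: contrapT => nP; have /(ultraN hU) := ultraT hU (fun _ => nP).
Qed.

Lemma satisfies_ultrapower M phi : satisfies (ultraproduct U (fun _ => M)) phi <-> satisfies M phi.
Proof. by rewrite satisfies_ultraproduct ultra_const. Qed.

(** The ultrapower of a field, seen from an isomorphic field. *)
Definition ultrapower_map (E EN : nzRingType) (p : (nat -> E) -> EN) :=
  [/\ forall y, exists f, p f = y, forall f g, p f = p g <-> U (fun n => f n = g n),
    p (fun _ => 1) = 1, forall f g, p (fun n => f n - g n) = p f - p g
  & forall f g, p (fun n => f n * g n) = p f * p g].

Let raw_map (R S : ring_structure) (p : (nat -> R) -> S) :=
  [/\ forall y, exists f, p f = y, forall f g, p f = p g <-> U (fun n => f n = g n),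
    p (fun _ => oneS R) = oneS S,
    forall f g, p (fun n => addS (f n) (oppS (g n))) = addS (p f) (oppS (p g))
  & forall f g, p (fun n => mulS (f n) (g n)) = mulS (p f) (p g)].

Let ultrapower_raw (M N : Lstructure) : N = ultraproduct U (fun _ => M) ->
  exists (pF : (nat -> sortF M) -> sortF N) (pK : (nat -> sortK M) -> sortK N),
  [/\ raw_map pF, raw_map pK & forall f, charS (pF f) = pK (fun n => charS (f n))].
Proof.
have raw (R : ring_structure) : @raw_map R (ultra_ring U (fun _ => R)) (@cls U (fun _ => R)).
  split=> //= [y|f g|f g|f g].
  - by exists (rep y); apply: repK.
  - exact: cls_eq.
  - rewrite (cls_op1 hU (fun _ => @oppS R) g).
    by rewrite (cls_op2 hU (fun _ => @addS R) f (fun n => oppS (g n))).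
  - by rewrite (cls_op2 hU (fun _ => @mulS R)).
move=> ->; exists (@cls U (fun _ => sortF M)), (@cls U (fun _ => sortK M)); split=> // f.
exact: (cls_op1 hU (fun _ => @charS M)).
Qed.

Lemma ultrapower_maps (F K FN KN : nzRingType) (chi : F -> K) (chiN : FN -> KN) :
  ultraproduct U (fun _ => Lstructure_of chi) = Lstructure_of chiN ->
  exists (pF : (nat -> F) -> FN) (pK : (nat -> K) -> KN),
  [/\ ultrapower_map pF, ultrapower_map pK & forall f, chiN (pF f) = pK (fun n => chi (f n))].
Proof. by move=> /esym/ultrapower_raw[pF [pK [hF hK hchi]]]; exists pF, pK. Qed.

Section Avoid.
Variables (E EN : fieldType) (p : (nat -> E) -> EN) (pP : ultrapower_map p).

Lemma upow_surj y : exists f, p f = y. Proof. by case: pP => h _ _ _ _; apply: h. Qed.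
Lemma upow_eq f g : p f = p g <-> U (fun n => f n = g n).
Proof. by case: pP => _ h _ _ _; apply: h. Qed.
Lemma upow1 : p (fun _ => 1) = 1. Proof. by case: pP. Qed.
Lemma upowB f g : p (fun n => f n - g n) = p f - p g. Proof. by case: pP => _ _ _ h _; apply: h. Qed.
Lemma upowM f g : p (fun n => f n * g n) = p f * p g. Proof. by case: pP => _ _ _ _ h; apply: h. Qed.
Lemma upow0 : p (fun _ => 0) = 0.
Proof. by rewrite -(subrr (p (fun _ => 0))) -upowB subrr. Qed.
Lemma upowD f g : p (fun n => f n + g n) = p f + p g.
Proof.
have -> : p (fun n => f n + g n) = p (fun n => f n - (0 - g n)).
  by congr p; apply/funext => n; rewrite sub0r opprK.
by rewrite upowB upowB upow0 sub0r opprK.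
Qed.
Lemma upowX f k : p (fun n => f n ^+ k) = p f ^+ k.
Proof.
elim: k => [|k IH]; first by rewrite -[RHS]upow1.
by rewrite exprS -IH -upowM; congr p; apply/funext => n; rewrite exprS.
Qed.
Lemma upow_sum d (f : 'I_d -> nat -> E) :
  p (fun n => \sum_(i < d) f i n) = \sum_(i < d) p (f i).
Proof.
elim: d f => [|d IH] f.
  by rewrite big_ord0 -upow0; congr p; apply/funext => n; rewrite big_ord0.
rewrite big_ord_recr /= -IH -upowD; congr p.
by apply/funext => n; rewrite big_ord_recr.
Qed.

(** [Cx C n] stands for the elements of complexity at most [C] at stage [n]. *)
Variable Cx : nat -> nat -> E -> Prop.
Hypothesis Cx_mono : forall C C' n u, (C <= C')%N -> Cx C n u -> Cx C' n u.
Hypothesis Cx1 : exists C, forall n, (C <= n)%N -> Cx C n 1.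
Hypothesis CxBM : forall C, exists C', forall n u v, (C' <= n)%N ->
  Cx C n u -> Cx C n v -> Cx C' n (u - v) /\ Cx C' n (u * v).

Definition bounded y := exists2 u, p u = y & exists C, forall n, (C <= n)%N -> Cx C n (u n).

Lemma bounded_ring : subring_set bounded.
Proof.
split.
- by exists (fun _ => 1); [apply: upow1|apply: Cx1].
- move=> _ _ [u <- [C hu]] [v <- [D hv]]; exists (fun n => u n - v n); first exact: upowB.
  have [C' hC'] := CxBM (maxn C D); exists (maxn (maxn C D) C') => n.
  rewrite !geq_max => /andP[/andP[leC leD] leC'].
  have [] := hC' n (u n) (v n) leC'.
  - by apply: Cx_mono (hu n leC); rewrite leq_maxl.
  - by apply: Cx_mono (hv n leD); rewrite leq_maxr.
  by move=> h _; apply: Cx_mono h; rewrite leq_maxr.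
- move=> _ _ [u <- [C hu]] [v <- [D hv]]; exists (fun n => u n * v n); first exact: upowM.
  have [C' hC'] := CxBM (maxn C D); exists (maxn (maxn C D) C') => n.
  rewrite !geq_max => /andP[/andP[leC leD] leC'].
  have [] := hC' n (u n) (v n) leC'.
  - by apply: Cx_mono (hu n leC); rewrite leq_maxl.
  - by apply: Cx_mono (hv n leD); rewrite leq_maxr.
  by move=> _ h; apply: Cx_mono h; rewrite leq_maxr.
Qed.

(** The coefficients of a polynomial over the bounded elements have complexity at
    most [n] at almost every stage [n], so that [x n] is not a root of the
    polynomial of that stage. *)
Lemma ultrapower_avoid (x : nat -> E) :
  (forall n (q : {poly E}), (forall i, Cx n n q`_i) -> (size q <= n)%N ->
    root q (x n) -> q = 0) ->
  ~ acl bounded (p x).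
Proof.
move=> avoid /(acl_alg bounded_ring)[q [q0 hq qx]].
have /choice[u uP] : forall i, exists u, p u = q`_i /\ exists C, forall n, (C <= n)%N -> Cx C n (u n).
  by move=> i; have [u] := hq i; exists u.
have /choice[C CP] : forall i, exists C, forall n, (C <= n)%N -> Cx C n (u i n).
  by move=> i; case: (uP i).
have [C1 hC1] := Cx1; have [C0 hC0] := CxBM C1.
pose D := maxn (maxn C1 C0) (maxn (size q) (\max_(i < size q) C i)).
have U0 : U (fun n => \sum_(i < size q) u i n * x n ^+ i = 0).
  apply/(upow_eq _ (fun=> 0)); rewrite upow_sum upow0 -[RHS](rootP qx) horner_coef.
  by apply: eq_bigr => i _; rewrite upowM upowX (proj1 (uP i)).
have d0 : (0 < size q)%N by rewrite size_poly_gt0.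
have : p (u (size q).-1) = p (fun _ => 0).
  apply/upow_eq; apply: ultraS hU _ _ _ (ultraI hU U0 (ultra_ge hU D)) => n [e].
  rewrite !geq_max => /andP[/andP[leC1 leC0] /andP[led leC]].
  pose r := \poly_(i < size q) u i n.
  have r0 : r = 0.
    apply: (avoid n); last 2 first.
    - by apply: leq_trans led; apply: size_poly.
    - by rewrite rootE (horner_coef_wide _ (size_poly _ _)) -[X in _ == X]e; apply/eqP/eq_bigr => i _; rewrite coef_poly ltn_ord.
    move=> i; rewrite coef_poly; case: ifP => lt_i.
      have leCi : (C i <= n)%N by apply: leq_trans leC; apply: (leq_bigmax (Ordinal lt_i)).
      by apply: Cx_mono (CP i n leCi).
    have [] := hC0 n 1 1 leC0 (hC1 n leC1) (hC1 n leC1).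
    by rewrite subrr => h _; apply: Cx_mono h.
  by have := congr1 (coefp (size q).-1) r0; rewrite /= coef0 coef_poly prednK ?leqnn.
rewrite (proj1 (uP _)) upow0 -lead_coefE => /eqP.
by rewrite lead_coef_eq0 (negPf q0).
Qed.
End Avoid.

(** At a root of [Q * 'X + 1] the product [Q] of the polynomials does not vanish. *)
Lemma avoid_roots (E : closedFieldType) (qs : seq {poly E}) :
  exists x, forall q, q \in qs -> root q x -> q = 0.
Proof.
pose Q := \prod_(q <- qs | q != 0) q.
have Q0 : Q != 0.
  by rewrite /Q; apply: (big_ind (fun q => q != 0)); [apply: oner_neq0|apply: mulf_neq0|].
have sQ : size (Q * 'X + 1) = (size Q).+1.
  by rewrite size_polyDl size_mulX // size_polyC oner_eq0 ltnS size_poly_gt0.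
have [|x] := @closed_rootP E (Q * 'X + 1) _.
  by rewrite sQ eqSS size_poly_eq0.
rewrite rootE hornerD hornerMX hornerC => /eqP Qx; exists x => q qs_q qx; apply/eqP/contraT => q0.
move/eqP: Qx; rewrite /Q horner_prod (big_rem q) //= q0 (rootP qx) !mul0r add0r.
by rewrite oner_eq0.
Qed.

Section WideF.
Variable E : closedFieldType.

(** Finite approximations to the subring generated by [s]. *)
Fixpoint combinations k (s : seq E) : seq E :=
  if k is k'.+1 then let l := combinations k' s in
    l ++ [seq x - y | x <- l, y <- l] ++ [seq x * y | x <- l, y <- l]
  else 0 :: 1 :: s.

Fixpoint words (l : seq E) n : seq (seq E) :=
  if n is n'.+1 then [seq x :: t | x <- l, t <- words l n'] else [:: [::]].

Lemma mem_words l t : (forall x, x \in t -> x \in l) -> t \in words l (size t).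
Proof.
elim: t => [|x t IH] //= h; apply/allpairsP; exists (x, t); split=> //=.
  by apply: h; rewrite mem_head.
by apply: IH => y yt; apply: h; rewrite inE yt orbT.
Qed.

Lemma mem_polys l n (q : {poly E}) : (forall i, q`_i \in l) -> (size q <= n)%N ->
  q \in [seq Poly t | t <- words l n].
Proof.
move=> ql sq; apply/mapP; exists (mkseq (fun i => q`_i) n).
  have := @mem_words l (mkseq (fun i => q`_i) n); rewrite size_mkseq; apply.
  by move=> _ /mapP[i _ ->].
apply/polyP => i; rewrite coef_Poly; have [lt_in|le_ni] := ltnP i n; first by rewrite nth_mkseq.
by rewrite !nth_default ?size_mkseq // (leq_trans sq).
Qed.

Lemma combinations_mono C C' s u : (C <= C')%N -> u \in combinations C s -> u \in combinations C' s.
Proof.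
move=> /subnK <-; elim: (C' - C)%N => // d IH /IH.
by rewrite addSn /= mem_cat => ->.
Qed.

(** At stage [n] only finitely many polynomials have to be avoided. *)
Lemma ultrapower_wideF (EN : closedFieldType) (p : (nat -> E) -> EN) :
  ultrapower_map p -> wideF EN.
Proof.
move=> pP s.
have [fs fsE] : exists fs : seq (nat -> E), map p fs = s.
  elim: s => [|y s [fs <-]]; first by exists [::].
  by have [f <-] := upow_surj pP y; exists (f :: fs).
pose sn n := [seq f n | f <- fs].
have /choice[x xP] : forall n, exists x, forall q,
    q \in [seq Poly t | t <- words (combinations n (sn n)) n] -> root q x -> q = 0.
  by move=> n; apply: avoid_roots.
exists (p x) => px.
apply: (@ultrapower_avoid E EN p pP (fun C n u => u \in combinations C (sn n)) _ _ _ x).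
- by move=> C C' n u; apply: combinations_mono.
- by exists 0%N => n _; rewrite /= !inE eqxx orbT.
- move=> C; exists C.+1 => n u v _ hu hv; split=> /=.
    by rewrite !mem_cat (allpairs_f (fun x y => x - y) hu hv) orbT.
  by rewrite !mem_cat (allpairs_f (fun x y => x * y) hu hv) !orbT.
- by move=> n q hq sq; apply: xP; apply: mem_polys.
apply: aclS px => y; rewrite -fsE => /mapP[f ffs ->]; exists f => //.
by exists 0%N => n _; rewrite /= !inE (map_f (fun f => f n)) // !orbT.
Qed.
End WideF.
End Ultrapower.

(** * Sparse polynomials *)

Section Sparse.
Variables (K : fieldType) (charK : [pchar K] =i pred0).

Lemma root_power_deriv (p : {poly K}) w n :
  ('X - w%:P) ^+ n.+1 %| p -> ('X - w%:P) ^+ n %| p^`().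
Proof.
case/dvdpP => q ->; rewrite derivM deriv_exp derivXsubC mul1r /=.
apply: dvdp_add; last by rewrite dvdp_mull // -mulr_natr dvdp_mulr.
by rewrite exprS mulrA dvdp_mull.
Qed.

(** In characteristic zero a polynomial with at most [n] terms vanishes to order
    less than [n] at a nonzero point: differentiating removes one term. *)
Lemma sparse_root n w (l : seq (K * nat)) : w != 0 -> (size l <= n)%N ->
  ('X - w%:P) ^+ n %| \sum_(z <- l) z.1 *: 'X^(z.2) ->
  \sum_(z <- l) z.1 *: 'X^(z.2) = 0.
Proof.
move=> w0; elim: n l => [|n IH] [|[c m] l] //=; rewrite ?big_nil // big_cons /=.
rewrite ltnS => sl.
pose C := c *: 'X^m + \sum_(z <- l) z.1 *: 'X^(z.2); rewrite -/C => dvdC.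
pose l' := [seq (z.1 * (z.2%:R - m%:R), z.2) | z <- l].
have DE : 'X * C^`() - m%:R *: C = \sum_(z <- l') z.1 *: 'X^(z.2).
  have XnE (a : K) k : 'X * (a *: 'X^k)^`() = (a * k%:R) *: 'X^k :> {poly K}.
    apply/polyP => -[|i]; rewrite coefXM /= ?coef_deriv !coefZ !coefXn.
      by case: k => [|k]; rewrite ?mulr0 ?mul0r.
    by case: eqP => [<-|_]; rewrite ?mulr0 ?mul0rn // !mulr1 mulr_natr.
  rewrite /C derivD mulrDr XnE scalerDr scalerA [m%:R * c]mulrC opprD addrACA subrr add0r.
  rewrite big_map raddf_sum mulr_sumr scaler_sumr -sumrB; apply: eq_bigr => z _.
  by rewrite XnE scalerA -scalerBl mulrBr [m%:R * _]mulrC.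
have D0 : 'X * C^`() - m%:R *: C = 0.
  rewrite DE; apply: IH; first by rewrite size_map.
  rewrite -DE dvdp_sub //; first by rewrite dvdp_mull // root_power_deriv.
  by rewrite -mul_polyC dvdp_mull // (dvdp_trans _ dvdC) // dvdp_exp2l.
have CE : C = C`_m *: 'X^m.
  apply/polyP => i; rewrite coefZ coefXn; case: eqP => [->|/eqP nim]; first by rewrite mulr1.
  have := congr1 (coefp i) D0; rewrite /= coefB coefXM coefZ coef0 mulr0.
  have -> : (if i == 0%N then 0 else C^`()`_i.-1) = i%:R * C`_i.
    by case: i {nim} => [|i]; rewrite ?mul0r //= coef_deriv mulr_natl.
  move/eqP; rewrite -mulrBl mulf_eq0 => /orP[|/eqP //].
  have -> : i%:R - m%:R = (i%:Z - m%:Z)%:~R :> K by rewrite rmorphB.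
  by rewrite char0_int_eq0 // subr_eq0 eqz_nat (negPf nim).
have : root C w.
  by rewrite -dvdp_XsubCl (dvdp_trans _ dvdC) // exprS dvdp_mulr.
by rewrite CE rootE hornerZ hornerXn mulf_eq0 (negPf (expf_neq0 _ w0)) orbF => /eqP ->; rewrite scale0r.
Qed.

(** Read as a number in base [Y], the sum has the digits [C i]; the lowest of them
    is divisible by [Y]. *)
Lemma sum_not_dvd (Y : {poly K}) d (C : nat -> {poly K}) : Y != 0 ->
  (forall i, Y %| C i -> C i = 0) -> \sum_(i < d) C i * Y ^+ i = 0 ->
  forall i, (i < d)%N -> C i = 0.
Proof.
move=> Y0; elim: d C => [//|d IH] C hC; rewrite big_ord_recl /= expr0 mulr1 => sum0.
pose R := \sum_(i < d) C i.+1 * Y ^+ i.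
have rest : \sum_(i < d) C (lift ord0 i) * Y ^+ lift ord0 i = R * Y.
  by rewrite mulr_suml; apply: eq_bigr => i _; rewrite exprSr mulrA.
rewrite rest in sum0.
have C0 : C 0%N = 0.
  by apply: hC; rewrite -(addrK (R * Y) (C 0%N)) sum0 sub0r dvdpNr dvdp_mull.
move: sum0; rewrite C0 add0r => /eqP; rewrite mulf_eq0 (negPf Y0) orbF => /eqP sum0.
case=> [|i] // lt_id; apply: (IH (fun i => C i.+1)) => // j; exact: hC.
Qed.
End Sparse.

Section Complexity.
Variables (F K : closedFieldType) (chi : F -> K).
Hypotheses (charK : [pchar K] =i pred0) (chiP : character chi) (chi_gen : generic chi).
Let chiM : forall a b, chi (a * b) = chi a * chi b. Proof. by case: chiP. Qed.
Let chi1 : chi 1 = 1. Proof. by case: chiP. Qed.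
Let chi0 : chi 0 = 0. Proof. by case: chiP. Qed.

Local Notation term := (fun u : int * F => u.1%:~R * chi u.2).

(** The complexity measure of the second sort: ring operations increase the number
    of terms in a controlled way, and powers of [1 + chi t] escape it. *)
Definition few_terms n (y : K) :=
  exists2 s : seq (int * F), (size s <= n)%N & \sum_(u <- s) term u = y.

Lemma few_terms_mono n n' y : (n <= n')%N -> few_terms n y -> few_terms n' y.
Proof. by move=> le_nn' [s sn <-]; exists s => //; apply: leq_trans le_nn'. Qed.

Lemma few_terms_chi a : few_terms 1 (chi a).
Proof. by exists [:: (1, a)]; rewrite // big_seq1 mul1r. Qed.

Lemma few_termsB n m y z : few_terms n y -> few_terms m z -> few_terms (n + m) (y - z).
Proof.
move=> [s sn <-] [t tm <-]; exists (s ++ [seq (- u.1, u.2) | u <- t]).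
  by rewrite size_cat size_map leq_add.
rewrite big_cat big_map; congr (_ + _); rewrite -sumrN.
by apply: eq_bigr => u _; rewrite rmorphN mulNr.
Qed.

Lemma few_termsM n m y z : few_terms n y -> few_terms m z -> few_terms (n * m) (y * z).
Proof.
move=> [s sn <-] [t tm <-]; exists [seq (u.1 * v.1, u.2 * v.2) | u <- s, v <- t].
  by rewrite size_allpairs leq_mul.
rewrite big_allpairs_dep mulr_suml; apply: eq_bigr => u _.
rewrite mulr_sumr; apply: eq_bigr => v _.
by rewrite chiM rmorphM mulrACA.
Qed.

Lemma few_terms_binomial t n : few_terms n.+1 ((1 + chi t) ^+ n).
Proof.
exists [seq ('C(n, i)%:Z, t ^+ i) | i <- iota 0 n.+1]; first by rewrite size_map size_iota.
rewrite big_map exprDn -[X in iota _ X]subn0 -/(index_iota 0 n.+1) big_mkord.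
by apply: eq_bigr => i _; rewrite expr1n mul1r (chiX chiM chi1) -mulr_natl.
Qed.

Variables (t : F) (t0 : t != 0) (nt : ~ torsion t) (N : nat).

Local Notation val := (fun z : nat * (int * F) => term z.2 * ((1 + chi t) ^+ N) ^+ z.1).

(** The case of a single coset of the hull of [t]: up to roots of unity all entries
    are powers of one [s] with [t = s ^+ M], and as [chi s] is transcendental the
    relation holds between polynomials.  Any root of [1 + 'X^M], of which
    [1 + chi t] is a value, is a point where [sparse_root] applies. *)
Lemma sparse_hull (l : seq (nat * (int * F))) :
  (forall z, z \in l -> hull torsion t z.2.2) ->
  (forall i, (count (fun z => z.1 == i) l <= N)%N) ->
  \sum_(z <- l) val z = 0 -> forall i, \sum_(z <- l | z.1 == i) term z.2 = 0.
Proof.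
move=> hl cl sum0; have pureT := @pure_torsion F.
have [|s [B [M [M0 sM s0 nts hs]]]] := @common_root F torsion t [seq z.2.2 | z <- l] pureT t0 nt.
  by move=> _ /mapP[z zl ->]; apply: hl.
have /choice[n nP] : forall z, exists n, z \in l -> torsion (z.2.2 * s ^+ B / s ^+ n).
  move=> z; have [zl|] := boolP (z \in l); last by exists 0%N.
  by have [|n hn] := hs z.2.2; [apply: map_f|exists n].
pose c z := z.2.1%:~R * chi (z.2.2 * s ^+ B / s ^+ n z).
have cs0 : chi s != 0 by apply: (chi_neq0 chiM chi1).
have termE z : term z.2 * chi s ^+ B = c z * chi s ^+ n z.
  rewrite /c -mulrA -[in RHS]mulrA; congr (_ * _).
  by rewrite -!(chiX chiM chi1) -!chiM divfK ?expf_neq0.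
pose C i := \sum_(z <- l | z.1 == i) c z *: 'X^(n z).
have CE i : (C i).[chi s] = (\sum_(z <- l | z.1 == i) term z.2) * chi s ^+ B.
  rewrite horner_sum mulr_suml; apply: eq_bigr => z _.
  by rewrite hornerZ hornerXn termE.
pose Q : {poly K} := 'X^M + 1%:P; pose d := (\max_(z <- l) z.1).+1.
have Qs : Q.[chi s] = 1 + chi t by rewrite /Q !hornerE ?hornerXn addrC -(chiX chiM chi1) sM.
have sumE (G : nat -> nat * (int * F) -> K) :
    \sum_(i < d) \sum_(z <- l | z.1 == i) G i z = \sum_(z <- l) G z.1 z.
  rewrite (exchange_big_dep xpredT) //= big_seq [RHS]big_seq; apply: eq_bigr => z zl.
  have lt_zd : (z.1 < d)%N by rewrite ltnS; apply: (@leq_bigmax_seq _ _ xpredT (fun z => z.1)).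
  by rewrite (big_pred1 (Ordinal lt_zd)) // => i; rewrite /= -val_eqE eq_sym.
pose P := \sum_(i < d) C i * (Q ^+ N) ^+ i.
have Ps : P.[chi s] = 0.
  rewrite horner_sum; transitivity ((\sum_(z <- l) val z) * chi s ^+ B); last by rewrite sum0 mul0r.
  have := sumE (fun i z => term z.2 * ((1 + chi t) ^+ N) ^+ i) => <-.
  rewrite mulr_suml. apply: eq_bigr => i _.
  by rewrite hornerM !horner_exp Qs CE mulrAC mulr_suml.
pose A := acl (fun _ : K => False); have rA : subring_set A := acl_ring _.
have AX k : coefs_in A 'X^k by apply: coefs_inX.
have rP := coefs_in_subring rA.
have AC i : coefs_in A (C i).
  rewrite /C big_seq_cond; apply: (subring_sum rP) => z /andP[zl _].
  rewrite -mul_polyC; apply: (subringM rP) => //; apply: (coefs_inC rA).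
  apply: (subringM rA); first exact: (subring_int rA).
  by apply: torsion_acl; apply: chi_torsion => //; apply: nP.
have AP : coefs_in A P.
  apply: (subring_sum rP) => i _; apply: (subringM rP) => //.
  apply: (subringX rP); apply: (subringX rP); apply: (subringD rP) => //.
  exact: (subring1 rP).
have P0 : P = 0.
  apply: contrapT => /eqP nzP.
  apply: (generic_strong charK chiP chi_gen pureT (fun x tx => tx) s0 nts).
  apply: aclS (fun _ (h : False) => False_ind _ h) _ _.
  by apply: (algclosed_root (acl_closed _) nzP AP); apply/rootP.
have [w Qw] : exists w, root Q w.
  by apply/closed_rootP; rewrite size_polyDl ?size_polyXn ?size_polyC ?oner_eq0 // gtn_eqF.
have w0 : w != 0.
  apply: contraTneq Qw => ->; rewrite rootE !hornerE ?hornerXn expr0n gtn_eqF // add0r.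
  exact: oner_neq0.
have C0 i : (i < d)%N -> C i = 0.
  apply: (@sum_not_dvd K (Q ^+ N)) P0 i => [|i dvdC].
    rewrite expf_neq0 //; apply/eqP => Q0; have /eqP := congr1 (coefp 0) Q0.
    by rewrite /Q /= coefD coefXn coefC coef0 /= (ltn_eqF M0) add0r oner_eq0.
  have Cl : C i = \sum_(u <- [seq (c z, n z) | z <- l & z.1 == i]) u.1 *: 'X^(u.2).
    by rewrite big_map big_filter.
  rewrite Cl; apply: (@sparse_root _ charK N w) => //; first by rewrite size_map size_filter.
  rewrite -Cl (dvdp_trans _ dvdC) // dvdp_exp2r // dvdp_XsubCl //.
move=> i; apply: (mulIf (expf_neq0 B cs0)); rewrite mul0r -CE.
have [lt_id|le_di] := ltnP i d; first by rewrite C0 // horner0.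
rewrite /C big_seq_cond big_pred0 ?horner0 // => z; apply/negP => /andP[zl /eqP zi].
move: le_di; rewrite -zi leqNgt ltnS.
by rewrite (@leq_bigmax_seq _ _ xpredT (fun z => z.1)).
Qed.

Let strong_hull : strong chi (hull torsion t) (fun _ => False).
Proof.
move=> H pureH TH; apply: (generic_strong charK chiP chi_gen pureH) => x tx.
by apply: TH; apply: (hull_sub (@pure_torsion F)).
Qed.

(** By [strong_graded] the relation may be treated one coset of the hull of [t] at
    a time, and division by an entry moves a coset into the hull. *)
Lemma sparse_relation (l : seq (nat * (int * F))) :
  (forall z, z \in l -> z.2.2 != 0) ->
  (forall i, (count (fun z => z.1 == i) l <= N)%N) ->
  \sum_(z <- l) val z = 0 -> forall i, \sum_(z <- l | z.1 == i) term z.2 = 0.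
Proof.
have pureT := hull_pure (@pure_torsion F) t0.
have [n] := ubnP (size l); elim: n l => // n IH [|z0 l'] sl nz cl sum0 i; first by rewrite big_nil.
set l := z0 :: l' in sl nz cl sum0 *; pose a := z0.2.2.
have a0 : a != 0 by apply: (nz z0); rewrite mem_head.
pose P (z : nat * (int * F)) := `[< hull torsion t (z.2.2 / a) >].
pose C := with_image chi (fun _ => False) (hull torsion t).
have rC := acl_ring C.
have Ct : acl C (1 + chi t).
  apply: (subringD rC); first exact: (subring1 rC).
  by apply: acl_sub; right; exists t => //; apply: (hull_gen (@pure_torsion F)).
have sumP : \sum_(z <- l | P z) val z = 0.
  have := @strong_graded _ _ chi chiM chi1 (hull torsion t) (fun _ => False)
    [seq (z.2.1%:~R * ((1 + chi t) ^+ N) ^+ z.1, z.2.2 / a) | z <- l] pureT strong_hull.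
  rewrite !big_map => h; transitivity ((\sum_(z <- l | P z)
     (z.2.1%:~R * ((1 + chi t) ^+ N) ^+ z.1) * chi (z.2.2 / a)) * chi a).
    rewrite mulr_suml; apply: eq_bigr => z _.
    by rewrite -!mulrA -chiM divfK // [chi _ * _]mulrC.
  rewrite h ?mul0r //.
    move=> _ /mapP[z zl ->] /=; split; last by rewrite mulf_neq0 ?invr_neq0 // nz.
    apply: (subringM rC); first exact: (subring_int rC).
    by apply: (subringX rC); apply: (subringX rC).
  rewrite -[RHS](mul0r (chi a)^-1) -[in RHS]sum0 mulr_suml; apply: eq_bigr => z _ /=.
  by rewrite (chi_div chiM chi1) // !mulrA; congr (_ / _); rewrite mulrAC.
have count_le (D : pred (nat * (int * F))) j : (count (fun z => z.1 == j) [seq z <- l | D z] <= N)%N.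
  by rewrite count_filter; apply: leq_trans (cl j); apply: sub_count => z /andP[].
rewrite (bigID P) /= -[RHS]addr0; congr (_ + _).
  have h := @sparse_hull [seq (z.1, (z.2.1, z.2.2 / a)) | z <- [seq z <- l | P z]].
  have -> : \sum_(z <- l | (z.1 == i) && P z) term z.2 =
      (\sum_(z <- [seq (z.1, (z.2.1, z.2.2 / a)) | z <- [seq z <- l | P z]] | z.1 == i) term z.2) * chi a.
    rewrite mulr_suml big_map big_filter_cond /=.
    rewrite (eq_bigl (fun z => P z && (z.1 == i))) => [|z]; last by rewrite andbC.
    by apply: eq_bigr => z _; rewrite -mulrA -chiM divfK.
  rewrite h ?mul0r // => [_ /mapP[z + ->]|j|].
  - by rewrite mem_filter => /andP[/asboolP].
  - by rewrite count_map; apply: count_le.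
  rewrite big_map big_filter /= -[RHS](mul0r (chi a)^-1) -[in RHS]sumP mulr_suml.
  apply: eq_bigr => z _; rewrite (chi_div chiM chi1) // mulrA.
  by rewrite -!mulrA; congr (_ * (_ * _)); rewrite mulrC.
have -> : \sum_(z <- l | (z.1 == i) && ~~ P z) term z.2 =
    \sum_(z <- [seq z <- l | ~~ P z] | z.1 == i) term z.2.
  by rewrite big_filter_cond; apply: eq_bigl => z; rewrite andbC.
apply: IH => [|z|j|].
- rewrite size_filter -ltnS; apply: leq_trans sl; rewrite ltnS /l /= {1}/P asboolT //=.
    by rewrite add0n ltnS count_size.
  by rewrite divff //; apply: pure1.
- by rewrite mem_filter => /andP[_ /nz].
- exact: count_le.
- by rewrite big_filter -[RHS]sum0 [RHS](bigID P) /= sumP add0r.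
Qed.

(** Within one coset of the hull of [t] a nonzero coefficient vanishes to order less
    than [N] where [1 + chi t] does, so the terms of the polynomial have distinct
    orders of vanishing and cannot cancel. *)
Lemma binomial_avoid (q : {poly K}) : (forall i, few_terms N q`_i) ->
  root q ((1 + chi t) ^+ N) -> q = 0.
Proof.
move=> hq qx.
have /choice[s sP] : forall i, exists s : seq (int * F), [/\ (size s <= N)%N,
    forall u, u \in s -> u.2 != 0 & \sum_(u <- s) term u = q`_i].
  move=> i; have [s sN sE] := hq i; exists [seq u <- s | u.2 != 0]; split.
  - by apply: leq_trans sN; rewrite size_filter count_size.
  - by move=> u; rewrite mem_filter => /andP[].
  - rewrite -sE big_filter [RHS](bigID (fun u => u.2 != 0)) /= [X in _ + X]big1 ?addr0 // => u.
    by rewrite negbK => /eqP ->; rewrite chi0 mulr0.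
pose l := [seq (i, u) | i <- iota 0 (size q), u <- s i].
have sumI (V : nmodType) (j : nat) (G : nat -> V) :
    \sum_(i <- iota 0 (size q) | i == j) G i = if (j < size q)%N then G j else 0.
  case: ifP => lt_j; first by rewrite -big_filter filter_pred1_uniq ?iota_uniq ?mem_iota // big_seq1.
  by rewrite big_seq_cond big_pred0 // => i; rewrite mem_iota /=; case: eqP => [->|]; rewrite ?lt_j ?andbF.
have sumL (V : nmodType) (G : nat -> int * F -> V) j :
    \sum_(z <- l | z.1 == j) G z.1 z.2 = if (j < size q)%N then \sum_(u <- s j) G j u else 0.
  rewrite -(sumI V j (fun i => \sum_(u <- s i) G i u)) big_mkcond big_allpairs_dep /= [RHS]big_mkcond; apply: eq_bigr => i _.
  by case: eqP => _ //=; rewrite big1.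
have term0 := @sparse_relation l.
apply/polyP => j; rewrite coef0; have [lt_j|le_j] := ltnP j (size q); last by rewrite nth_default.
have [_ _ <-] := sP j; have := sumL _ (fun _ => term) j; rewrite lt_j => <-.
apply: term0 => [z /allpairsPdep[i [u [_ us ->]]]|i|].
- by case: (sP i) => _ h _; apply: h.
- rewrite -sum1_count; have := sumL nat (fun _ _ => 1%N) i => /= ->.
  by case: ifP => // _; case: (sP i) => sN _ _; rewrite sum1_size.
- rewrite big_allpairs_dep /= -[RHS](rootP qx) horner_coef -(big_mkord xpredT (fun i => q`_i * ((1 + chi t) ^+ N) ^+ i)) /index_iota subn0.
  by apply: eq_bigr => i _; case: (sP i) => _ _ <-; rewrite mulr_suml.
Qed.
End Complexity.

Section WideK.
Variables (U : (nat -> Prop) -> Prop) (hU : nonprincipal_ultrafilter U).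
Variables (F K FN KN : closedFieldType) (chi : F -> K) (chiN : FN -> KN).
Hypotheses (charK : [pchar K] =i pred0) (chiP : character chi) (chi_gen : generic chi).
Variables (pF : (nat -> F) -> FN) (pK : (nat -> K) -> KN).
Hypotheses (hF : ultrapower_map U pF) (hK : ultrapower_map U pK).
Hypothesis chi_p : forall f, chiN (pF f) = pK (fun n => chi (f n)).
Variables (t : F) (t0 : t != 0) (nt : ~ torsion t).

(** A tower of growth rates, each beyond every fixed power of the previous. *)
Fixpoint tower m n := if m is m'.+1 then (tower m' n ^ n.+1).+1 else 2.

Lemma tower_gt1 m n : (1 < tower m n)%N.
Proof. by elim: m => //= m IH; rewrite ltnS expn_gt0 (ltnW IH). Qed.

Lemma tower_mono m m' n : (m <= m')%N -> (tower m n <= tower m' n)%N.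
Proof.
move=> /subnK <-; elim: (m' - m)%N => // d IH; rewrite addSn /=.
apply: leq_trans IH (leq_trans _ (leqnSn _)).
by rewrite -{1}[tower _ _]expn1 leq_exp2l ?tower_gt1.
Qed.

Let Cx m C n y := few_terms chi (tower m n ^ C) y.
Let x m n := (1 + chi t) ^+ (tower m n ^ n.+1).

Let Cx_mono m C C' n u : (C <= C')%N -> Cx m C n u -> Cx m C' n u.
Proof. by move=> CC'; apply: few_terms_mono; rewrite leq_exp2l ?tower_gt1. Qed.

Let x_avoid m : ~ acl (bounded pK (Cx m)) (pK (x m)).
Proof.
apply: (ultrapower_avoid hU hK (Cx_mono (m := m))).
- exists 0%N => n _; have [_ _ <-] := chiP.
  by apply: few_terms_mono (few_terms_chi chi 1); rewrite expn0.
- move=> C; exists (C + C).+1 => n u v _ hu hv; split.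
    apply: few_terms_mono (few_termsB hu hv); rewrite addnn -mul2n expnS.
    by apply: leq_mul; rewrite ?tower_gt1 // leq_exp2l ?tower_gt1 ?leq_addr.
  apply: few_terms_mono (few_termsM chiP hu hv).
  by rewrite -expnD leq_exp2l ?tower_gt1.
- move=> n q hq _; apply: binomial_avoid => // i.
  by apply: few_terms_mono (hq i); rewrite leq_exp2l ?tower_gt1.
Qed.

(** The element of level [m] is a power of [1 + chi t] with an exponent beyond the
    complexity of all lower levels; its own complexity fits into the next. *)
Theorem ultrapower_wideK : wideK chiN.
Proof.
move=> s; have [|m hm] := @indep_seq_avoid KN (chi_range chiN) (fun m => pK (x m)) s; last first.
  by exists (pK (x m)).
move=> m; apply: contra_not (@x_avoid m); apply: aclS => _ [[a <-]|[i lt_im <-]].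
  have [f <-] := upow_surj hF a; rewrite chi_p; exists (fun n => chi (f n)) => //.
  exists 1%N => n _; apply: few_terms_mono (few_terms_chi chi (f n)).
  by rewrite expn1 ltnW ?tower_gt1.
exists (x i) => //; exists 1%N => n _.
apply: few_terms_mono (few_terms_binomial chiP t _).
by rewrite expn1; apply: (@tower_mono i.+1 m n).
Qed.
End WideK.

(** * Models with large transcendence degrees *)

Section Models.
Variables (ACFC : theory) (hACFC : axiomatizes_ACFC ACFC).
Variables (U : (nat -> Prop) -> Prop) (hU : nonprincipal_ultrafilter U).

Definition elem_equiv (M N : Lstructure) := forall phi, satisfies M phi <-> satisfies N phi.

Lemma ultrapower_equiv M : elem_equiv (ultraproduct U (fun _ => M)) M.
Proof. by move=> phi; apply: satisfies_ultrapower. Qed.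

Lemma models_equiv M N T : elem_equiv M N -> models M T -> models N T.
Proof. by move=> MN MT phi /MT/MN. Qed.

(** The first ultrapower provides an element of infinite order in the first
    sort, the second one makes both transcendence degrees infinite. *)
Lemma wide_model M : is_model_of_ACFC M -> exists (F K : closedFieldType) (chi : F -> K),
  [/\ [pchar K] =i pred0, character chi, generic chi, wideF F /\ wideK chi
    & elem_equiv (Lstructure_of chi) M].
Proof.
have step (F K : closedFieldType) (chi : F -> K) : models (Lstructure_of chi) ACFC ->
    exists (F' K' : closedFieldType) (chi' : F' -> K'),
    [/\ ultraproduct U (fun _ => Lstructure_of chi) = Lstructure_of chi',
      [pchar K'] =i pred0, character chi' & generic chi'].
  move=> mod; have : models (ultraproduct U (fun _ => Lstructure_of chi)) ACFC.
    by apply: models_equiv mod => phi; rewrite ultrapower_equiv.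
  by move=> /hACFC[F' [K' [chi' [? ? ? ?]]]]; exists F', K', chi'.
move=> mM; have modM : models M ACFC by apply/hACFC.
have [F [K [chi [ME _ _ _]]]] := mM; rewrite ME in modM *.
have [F1 [K1 [chi1 [E1 char1 char_chi1 gen1]]]] := step _ _ _ modM.
have mod1 : models (Lstructure_of chi1) ACFC.
  by rewrite -E1; apply: models_equiv modM => phi; rewrite ultrapower_equiv.
have [F2 [K2 [chi2 [E2 char2 char_chi2 gen2]]]] := step _ _ _ mod1.
have [pF1 [pK1 [hF1 hK1 _]]] := ultrapower_maps hU E1.
have [pF2 [pK2 [hF2 hK2 hchi2]]] := ultrapower_maps hU E2.
have [t nt] : exists t, ~ acl (fun y => y \in [::]) t := ultrapower_wideF hU hF1 [::].
have t0 : t != 0.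
  by apply/eqP => t0; apply: nt; rewrite t0; apply: (subring0 (acl_ring _)).
have ntt : ~ torsion t by move=> /torsion_acl tt; apply: nt; apply: aclS tt.
exists F2, K2, chi2; split=> //.
  split; first exact: (ultrapower_wideF hU hF2).
  exact: (ultrapower_wideK hU char1 char_chi1 gen1 hF2 hK2 hchi2 t0 ntt).
by move=> phi; rewrite -E2 ultrapower_equiv -E1 ultrapower_equiv.
Qed.

(** Sentences have no variables, so any position decides them. *)
Lemma equiv_of_pchar (F K F' K' : closedFieldType) (chi : F -> K) (chi' : F' -> K') :
  [pchar K] =i pred0 -> [pchar K'] =i pred0 -> [pchar F] =i [pchar F'] ->
  character chi -> character chi' -> generic chi -> generic chi' ->
  wideF F -> wideK chi -> wideF F' -> wideK chi' ->
  elem_equiv (Lstructure_of chi) (Lstructure_of chi').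
Proof.
move=> cK cK' cF chiP chiP' gen gen' wF wK wF' wK' phi.
have [SF [SK st]] := initial_state cK cK' cF chiP chiP' gen gen'.
by apply: (game chiP chiP' wF wK wF' wK' phi st) => -[].
Qed.
End Models.

(** * Torsion fields *)

(** The powers of [x] reduce to finitely many residues modulo its equation. *)
Lemma torsion_closure (p : nat) (F : fieldType) (i : {rmorphism 'F_p -> F}) (x : F) :
  integralOver i x -> x != 0 -> torsion x.
Proof.
case=> q mon_q qx x0; pose d := (size q).-1.
have sq : size q = d.+1 by rewrite /d prednK // size_poly_gt0 monic_neq0.
pose m := #|{: 'rV['F_p]_d}|.
pose f (k : 'I_m.+1) : 'rV['F_p]_d := poly_rV ('X^k %% q).
have xE (k : nat) : x ^+ k = (map_poly i ('X^k %% q)).[x].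
  rewrite -[LHS]hornerXn -(map_polyXn i) {1}(divp_eq 'X^k q) rmorphD rmorphM /=.
  by rewrite hornerD hornerM (rootP qx) mulr0 add0r.
have : ~ injective f by move/leq_card; rewrite card_ord ltnn.
move=> /existsNP[k /existsNP[l /not_implyP[fkl /eqP nkl]]].
have ekl : x ^+ k = x ^+ l.
  rewrite !xE; have := congr1 rVpoly fkl; rewrite !poly_rV_K; first by move=> ->.
    by rewrite -ltnS -sq ltn_modp monic_neq0.
  by rewrite -ltnS -sq ltn_modp monic_neq0.
have main (a b : nat) : (a < b)%N -> x ^+ a = x ^+ b -> torsion x.
  move=> lt_ab eab; exists (b - a)%N; first by rewrite subn_gt0.
  by apply: (mulIf (expf_neq0 a x0)); rewrite -exprD subnK ?(ltnW lt_ab) // mul1r.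
move: nkl; rewrite -val_eqE /= neq_ltn => /orP[lt|lt]; first exact: main lt ekl.
exact: main lt (esym ekl).
Qed.

(** Otherwise a Bezout relation between [k] and [q] would put [x] into [D]. *)
Lemma prime_power_outside (E : fieldType) (D : E -> Prop) (x : E) q k : prime q -> x != 0 ->
  D 1 -> (forall a b, D a -> D b -> D (a / b)) -> D (x ^+ q) -> ~ D x -> D (x ^+ k) -> (q %| k)%N.
Proof.
move=> pq x0 D1 Ddiv Dq nD Dk; apply: contrapT => /negP nqk; apply: nD.
have DM a b : D a -> D b -> D (a * b).
  by move=> Da Db; rewrite -[b]invrK -[b^-1]mul1r; apply: (Ddiv) => //; apply: (Ddiv).
have DX a n : D a -> D (a ^+ n).
  by move=> Da; elim: n => [|n IH] //; rewrite exprS; apply: DM.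
have k0 : (0 < k)%N by case: k nqk {Dk} => //; rewrite dvdn0.
case: (egcdnP q k0) => km kn e _.
have co : gcdn k q = 1%N by apply/eqP; rewrite -/(coprime _ _) coprime_sym prime_coprime.
have -> : x = x ^+ k ^+ km / x ^+ q ^+ kn.
  apply: (mulIf (expf_neq0 kn (expf_neq0 q x0))); rewrite divfK ?expf_neq0 //.
  by rewrite -!exprM -exprS [(k * _)%N]mulnC e co [(q * _)%N]mulnC addn1.
by apply: Ddiv; apply: DX.
Qed.

Section Teichmuller.
Variables (F K : closedFieldType) (charK : [pchar K] =i pred0).
Implicit Types S : F * K -> Prop.

(** Graphs of isomorphisms between subgroups of the multiplicative groups.  The
    empty graph is included, so that the family is closed under unions of all
    chains. *)
Let pgroup S := [/\ forall z w, S z -> S w -> S (z.1 / w.1, z.2 / w.2),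
  forall z, S z -> (z.1 != 0) && (z.2 != 0)
  & forall z, S z -> (z.1 == 1) = (z.2 == 1)].

Let pgroup_inj S z w : pgroup S -> S z -> S w -> (z.1 == w.1) = (z.2 == w.2).
Proof.
case=> Sdiv S0 S1 Sz Sw; have /andP[w1 w2] := S0 w Sw.
have := S1 _ (Sdiv _ _ Sz Sw) => /=.
by rewrite -[1 in LHS](divff w1) -[1 in RHS](divff w2) !(inj_eq (divIf _)).
Qed.

Let pgroup_mul S a b : pgroup S -> S (1, 1) -> S a -> S b -> S (a.1 * b.1, a.2 * b.2).
Proof.
case=> Sdiv _ _ S11 Sa Sb; have := Sdiv _ _ Sa (Sdiv _ _ S11 Sb).
by rewrite /= !mul1r !invrK.
Qed.

Let pgroup_exp S a n : pgroup S -> S (1, 1) -> S a -> S (a.1 ^+ n, a.2 ^+ n).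
Proof.
move=> pS S11 Sa; elim: n => [|n IH] //; rewrite !exprS.
exact: (pgroup_mul pS S11 Sa IH).
Qed.

Let pgroup_powers S z q : pgroup S -> (0 < q)%N -> S (1, 1) -> S (z.1 ^+ q, z.2 ^+ q) ->
  z.1 != 0 -> z.2 != 0 -> (forall k b, (q %| k)%N \/ (S b -> (z.1 ^+ k * b.1 != 1) && (z.2 ^+ k * b.2 != 1))) ->
  pgroup (fun w => exists k b, S b /\ w = (z.1 ^+ k * b.1, z.2 ^+ k * b.2)).
Proof.
move=> pS q0 S11 Sq z1 z2 hk; have [Sdiv S0 S1] := pS.
split.
- move=> _ _ [k [b [Sb ->]]] [l [c [Sc ->]]] /=; have /andP[c1 c2] := S0 c Sc.
  exists (k + l * q.-1)%N, (b.1 / c.1 / z.1 ^+ q ^+ l, b.2 / c.2 / z.2 ^+ q ^+ l); split.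
    exact: (Sdiv _ _ (Sdiv _ _ Sb Sc) (pgroup_exp l pS S11 Sq)).
  have alg (E : fieldType) (y u v : E) : y != 0 -> v != 0 ->
      y ^+ k * u / (y ^+ l * v) = y ^+ (k + l * q.-1) * (u / v / y ^+ q ^+ l).
    move=> y0 v0; have -> : y ^+ q ^+ l = y ^+ l * y ^+ (l * q.-1).
      by rewrite -exprM -exprD -mulnS prednK // mulnC.
    rewrite exprD; field; rewrite v0 ?expf_neq0 //.
  by congr (_, _); apply: alg.
- move=> _ [k [b [Sb ->]]] /=; have /andP[b1 b2] := S0 b Sb.
  by rewrite !mulf_neq0 ?expf_neq0.
- move=> _ [k [b [Sb ->]]] /=; have [/dvdnP[m ->]|h] := hk k b.
    by rewrite mulnC !exprM; apply: (S1 _ (pgroup_mul pS S11 (pgroup_exp m pS S11 Sq) Sb)).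
  by have /andP[/negPf -> /negPf ->] := h Sb.
Qed.

(** Every injective homomorphism from a group of roots of unity extends: a root
    of order [q] modulo the domain is sent to a [q]-th root outside the range,
    and one exists because [K] has [q] of them whereas the domain misses one. *)
Lemma pgroup_root S x q : pgroup S -> S (1, 1) -> prime q -> x != 0 ->
  (forall y, ~ S (x, y)) -> (exists u, S (x ^+ q, u)) ->
  exists y, [/\ y != 0, S (x ^+ q, y ^+ q) & forall a, ~ S (a, y)].
Proof.
move=> pS S11 pq x0 nx [u Su]; have [Sdiv S0 S1] := pS; have q0 := prime_gt0 pq.
have /andP[_ u0] := S0 _ Su; rewrite /= in u0.
have [y0 y0q] := closed_nth_root u q0.
have y00 : y0 != 0 by apply: contra_neq u0 => e; rewrite -y0q e expr0n gtn_eqF.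
have [|Sw [isoW dW cW]] := @prime_piso algC K.
  by move=> r; rewrite charK Num.Theory.pchar_num.
have [w0 prw0] := C_prim_root_exists q0.
have [[w1 w] Sww /= w1E] : pdom Sw w0 by apply/dW; apply: algC_acl.
rewrite {w1}w1E in Sww.
have wk k : (w ^+ k == 1) = (q %| k)%N.
  by rewrite (prim_order_dvd prw0); apply/esym/(piso_expr_eq1 k isoW Sww).
have w_0 : w != 0.
  apply/eqP => e; have := wk q; rewrite e expr0n gtn_eqF // dvdnn.
  by rewrite eq_sym oner_eq0.
apply: contrapT => noy.
have allS (k : 'I_q) : exists a, S (a, y0 * w ^+ k).
  apply: contrapT => na; apply: noy; exists (y0 * w ^+ k); split.
  - by rewrite mulf_neq0 ?expf_neq0.
  - rewrite exprMn y0q -exprM mulnC exprM.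
    by have /eqP -> : w ^+ q == 1; rewrite ?wk // expr1n mulr1.
  - by move=> a Sa; apply: na; exists a.
have /choice[a aP] := allS.
have a_inj : injective a.
  move=> k l akl; have /esym := pgroup_inj pS (aP k) (aP l); rewrite /= akl eqxx => /eqP.
  move/(mulfI y00); wlog le_lk : k l {akl} / (l <= k)%N => [hw e|e].
    by have [/hw/(_ e)|/ltnW/hw/(_ (esym e))] := leqP l k.
  apply: val_inj => /=; apply/eqP; rewrite eqn_leq le_lk andbT -subn_eq0.
  have : (q %| k - l)%N.
    rewrite -wk; apply/eqP/(mulIf (expf_neq0 l w_0)).
    by rewrite -exprD subnK // mul1r.
  by apply: contraLR => nkl; rewrite gtnNdvd // ?lt0n // (leq_ltn_trans (leq_subr _ _)).
have rootP z : z ^+ q = x ^+ q -> root ('X^q - (x ^+ q)%:P) z.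
  by move=> e; rewrite rootE !hornerE ?hornerXn e subrr.
have := @max_poly_roots _ ('X^q - (x ^+ q)%:P) (x :: codom a).
rewrite -size_poly_eq0 size_XnsubC // => /(_ isT).
rewrite /= size_codom card_ord ltnn => h; suff: false by []; apply: h.
- rewrite rootP //=; apply/allP => _ /codomP[k ->]; apply: rootP.
  apply/eqP; have := pgroup_inj pS (pgroup_exp q pS S11 (aP k)) Su => /= ->.
  rewrite exprMn y0q -exprM mulnC exprM.
  by have /eqP -> : w ^+ q == 1; rewrite ?wk // expr1n mulr1.
- rewrite map_inj_uniq ?enum_uniq // andbT; apply/negP => /codomP[k xk].
  by apply: (nx (y0 * w ^+ k)); rewrite xk; apply: aP.
Qed.

(** A maximal partial isomorphism between the multiplicative groups has full
    domain: an element outside it has a power of prime order modulo the domain,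
    to which [pgroup_root] applies. *)
Theorem torsion_character : (forall x : F, x != 0 -> torsion x) ->
  exists chi : F -> K, (forall a b, chi (a * b) = chi a * chi b) /\
    [/\ chi 0 = 0, chi 1 = 1 & injective chi].
Proof.
move=> tF; have [|A [pA maxA]] := @Zorn_bigcup _ (pgroup : set (set (F * K)%type)).
  move=> C CP Ctot; split.
  - move=> z w [S CS Sz] [S' CS' Sw].
    case: (Ctot _ _ CS CS') => sub; [exists S'|exists S] => //.
      by case: (CP _ CS') => h _ _; apply: h => //; apply: sub.
    by case: (CP _ CS) => h _ _; apply: h => //; apply: sub.
  - by move=> z [S CS Sz]; case: (CP _ CS) => _ h _; apply: h.
  - by move=> z [S CS Sz]; case: (CP _ CS) => _ _; apply.
have [Adiv A0 A1] := pA.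
have A11 : A (1, 1).
  apply: contrapT => nA11; have noA z : ~ A z.
    move=> Az; apply: nA11; have := Adiv _ _ Az Az; have /andP[z1 z2] := A0 _ Az.
    by rewrite !divff.
  apply: (maxA (fun z => z = (1, 1))).
    by split=> [z /noA //|/(_ (1, 1) erefl)/noA].
  by split=> [_ _ -> ->|_ ->|_ ->] //=; rewrite ?divr1 ?oner_neq0 ?eqxx.
have domA x : x != 0 -> exists y, A (x, y).
  move=> x0; apply: contrapT => nx; pose D a := exists u, A (a, u).
  have exn : exists n, (0 < n)%N && `[< D (x ^+ n) >].
    have [n n0 xn] := tF x x0; exists n; rewrite n0 /=; apply/asboolP.
    by exists 1; rewrite xn.
  case: (ex_minnP exn) => n /andP[n0 /asboolP Dn] min_n.
  have n1 : (1 < n)%N.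
    rewrite ltn_neqAle n0 andbT; apply/eqP => n1; apply: nx.
    by rewrite -n1 expr1 in Dn.
  pose q := pdiv n; have pq : prime q := pdiv_prime n1.
  have nE : (n %/ q * q)%N = n by rewrite divnK // pdiv_dvd.
  pose x' := x ^+ (n %/ q); have x'0 : x' != 0 by rewrite expf_neq0.
  have x'q : x' ^+ q = x ^+ n by rewrite -exprM nE.
  have nDx' : ~ D x'.
    move=> Dx'; have := min_n (n %/ q)%N; rewrite divn_gt0 ?prime_gt0 // pdiv_leq //=.
    rewrite asboolT // => /(_ isT); rewrite leqNgt ltn_Pdiv // prime_gt1 //.
  have nx' y : ~ A (x', y) by move=> Axy; apply: nDx'; exists y.
  have Dq : D (x' ^+ q) by rewrite x'q.
  have [y [y0 Aq ny]] := pgroup_root pA A11 pq x'0 nx' Dq.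
  apply: (maxA (fun w => exists k b, A b /\ w = (x' ^+ k * b.1, y ^+ k * b.2))).
    split=> [[a b] Aab|sub].
      by exists 0%N, (a, b); split=> //; rewrite !expr0 !mul1r.
    apply: (nx' y); apply: sub; exists 1%N, (1, 1); split=> //.
    by rewrite !expr1 !mulr1.
  apply: (pgroup_powers (z := (x', y)) pA (prime_gt0 pq) A11 Aq x'0 y0) => k b /=.
  have [qk|nqk] := boolP (q %| k)%N; [by left|right=> Ab; have /andP[b1 b2] := A0 _ Ab].
  apply/andP; split; apply: contra nqk => /eqP e.
    apply: (prime_power_outside pq x'0 (D := D)) => //; first by exists 1.
      by move=> a c [u Aau] [v Acv]; exists (u / v); apply: (Adiv _ _ Aau Acv).
    have -> : x' ^+ k = 1 / b.1 by rewrite -e mulfK.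
    by exists (1 / b.2); apply: (Adiv _ _ A11 Ab).
  apply: (prime_power_outside pq y0 (D := fun v => exists a, A (a, v))) => //.
  - by exists 1.
  - by move=> a c [u Aau] [v Acv]; exists (u / v); apply: (Adiv _ _ Aau Acv).
  - by exists (x' ^+ q).
  - by case=> a; apply: ny.
  have -> : y ^+ k = 1 / b.2 by rewrite -e mulfK.
  by exists (1 / b.1); apply: (Adiv _ _ A11 Ab).
have /choice[chi chiP] : forall x, exists y, if x == 0 then y = 0 else A (x, y).
  by move=> x; case: eqVneq => [_|/domA//]; exists 0.
have chiA x : x != 0 -> A (x, chi x) by move=> /negPf x0; have := chiP x; rewrite x0.
have chi0 : chi 0 = 0 by have := chiP 0; rewrite eqxx.
have chi_n0 x : x != 0 -> chi x != 0 by move=> /chiA/A0/andP[].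
have inj z w : A z -> A w -> (z.1 == w.1) = (z.2 == w.2) by apply: pgroup_inj.
exists chi; split=> [a b|].
  have [->|a0] := eqVneq a 0; first by rewrite mul0r chi0 mul0r.
  have [->|b0] := eqVneq b 0; first by rewrite mulr0 chi0 mulr0.
  have := inj _ _ (chiA _ (mulf_neq0 a0 b0)) (pgroup_mul pA A11 (chiA _ a0) (chiA _ b0)).
  by rewrite /= eqxx => /esym/eqP.
split=> // [|a b e].
  by have := inj _ _ (chiA _ (oner_neq0 _)) A11; rewrite /= eqxx => /esym/eqP.
have [a0|a0] := eqVneq a 0.
  rewrite a0 chi0 in e *; apply/esym/eqP; apply: contraTT isT => /chi_n0.
  by rewrite -e eqxx.
have b0 : b != 0 by apply: contraTneq (chi_n0 _ a0) => b0; rewrite e b0 chi0 eqxx.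
by have := inj _ _ (chiA _ a0) (chiA _ b0); rewrite /= e eqxx => /eqP.
Qed.
End Teichmuller.

(** * Completeness *)

(** In a torsion field no tuple is multiplicatively independent. *)
Lemma torsion_generic (F K : closedFieldType) (chi : F -> K) :
  (forall x : F, x != 0 -> torsion x) -> injective chi -> generic chi.
Proof.
move=> tF chi_inj; split=> // n v n0 iv; case: iv; pose i0 := Ordinal n0.
have [a [b [ab vab]]] : exists a b, a <> b /\ v i0 ^+ a = v i0 ^+ b.
  have [->|v0] := eqVneq (v i0) 0; first by exists 1%N, 2; rewrite !expr0n.
  have [m m0 vm] := tF _ v0; exists m, 0%N; rewrite vm; split=> // m00.
  by rewrite m00 in m0.
pose k c : 'X_{1..n} := [multinom (if i == i0 then c else 0)%N | i < n].
exists (k a), (k b); split.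
  by move/mnmP/(_ i0); rewrite !mnmE eqxx.
rewrite (bigD1 i0) //= [RHS](bigD1 i0) //= !mnmE eqxx vab; congr (_ * _).
by apply: eq_bigr => i /negPf ii0; rewrite !mnmE ii0.
Qed.

Lemma ACFC_positive_char p : prime p -> exists (F K : closedFieldType) (chi : F -> K),
  [/\ [pchar K] =i pred0, character chi, generic chi & p%:R = 0 :> F].
Proof.
move=> pp; have [F [i int_i]] := countable_algebraic_closure 'F_p.
have tF (x : F) : x != 0 -> torsion x by apply: torsion_closure (int_i x).
have [chi [chiM [chi0 chi1 chi_inj]]] :=
  @torsion_character F algC (@Num.Theory.pchar_num algC) tF.
exists F, algC, chi; split=> //; first exact: Num.Theory.pchar_num.
  exact: torsion_generic.
rewrite -(rmorph_nat i); have -> : p%:R = 0 :> 'F_p; last exact: rmorph0.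
by apply/eqP; rewrite -(dvdn_pcharf (pchar_Fp pp)).
Qed.

Lemma eval_numeralF (F K : nzRingType) (chi : F -> K) (v : 'I_0 -> F) q :
  evalF (M := Lstructure_of chi) v (numeralF q) = q%:R.
Proof. by elim: q => //= q ->; rewrite mulrSr. Qed.

Section Completeness.
Variables (ACFC : theory) (hACFC : axiomatizes_ACFC ACFC).

Lemma positive_char_model p : prime p -> exists (F K : closedFieldType) (chi : F -> K),
  models (Lstructure_of chi) ACFC /\ forall q, prime q ->
    satisfies (Lstructure_of chi) (EqF (numeralF q) FZero) <-> q = p.
Proof.
move=> pp; have [F [K [chi [cK chiP gen pF]]]] := ACFC_positive_char pp.
exists F, K, chi; split; first by apply/hACFC; exists F, K, chi.
move=> q pq; rewrite /satisfies /= eval_numeralF; split=> [qF|-> //].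
have pcF : p \in [pchar F] by rewrite inE pp /= pF.
have := dvdn_pcharf pcF q; rewrite qF eqxx dvdn_prime2 // => /eqP //.
Qed.

(** In characteristic zero the model is an ultraproduct of models of growing
    positive characteristic. *)
Lemma ACFC_p_consistent p : prime p \/ p = 0%N -> consistent (ACFC_p ACFC p).
Proof.
case=> [pp|->].
  have [F [K [chi [mod hp]]]] := positive_char_model pp.
  exists (Lstructure_of chi) => phi [/mod//|]; case: p pp hp => // p' pp hp ->.
  by apply/(hp p'.+1).
have [U hU] := exists_nonprincipal_ultrafilter.
have exM k : exists M, models M ACFC /\ forall q, prime q -> (q <= k)%N ->
    ~ satisfies M (EqF (numeralF q) FZero).
  have [r lt_kr pr] := prime_above k.
  have [F [K [chi [mod hp]]]] := positive_char_model pr.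
  exists (Lstructure_of chi); split=> // q pq le_qk /(hp q pq) qp.
  by rewrite qp leqNgt lt_kr in le_qk.
have /choice[M MP] := exM; exists (ultraproduct U M) => phi [Aphi|[q [pq ->]]].
  by apply/satisfies_ultraproduct => //; apply: (ultraT hU) => k; case: (MP k) => h _; apply: h.
apply/satisfies_ultraproduct => //; apply: ultraS hU _ _ _ (ultra_ge hU q) => k le_qk.
by case: (MP k) => _ h; apply: (h q).
Qed.

Lemma pchar_of_model p (F K F' K' : closedFieldType) (chi : F -> K) (chi' : F' -> K') :
  prime p \/ p = 0%N -> models (Lstructure_of chi) (ACFC_p ACFC p) ->
  models (Lstructure_of chi') (ACFC_p ACFC p) -> [pchar F] =i [pchar F'].
Proof.
case=> [pp|->] mod mod' q.
  have ax : char_axioms p (EqF (numeralF p) FZero) by case: p pp {mod mod'}.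
  have := mod _ (or_intror ax); have := mod' _ (or_intror ax).
  rewrite /satisfies /= !eval_numeralF => pF' pF.
  have pc : p \in [pchar F] by rewrite inE pp /= pF.
  have pc' : p \in [pchar F'] by rewrite inE pp /= pF'.
  by rewrite (pcharf_eq pc) (pcharf_eq pc').
have char0 (E L : closedFieldType) (ch : E -> L) :
    models (Lstructure_of ch) (ACFC_p ACFC 0) -> q \in [pchar E] = false.
  move=> modE; apply/negP; rewrite inE => /andP[pq /eqP qE].
  have := modE (Not (EqF (numeralF q) FZero)); rewrite /satisfies /= eval_numeralF; apply=> //.
  by right; exists q.
by rewrite (char0 _ _ _ mod) (char0 _ _ _ mod').
Qed.

Lemma ACFC_p_models_equiv p M M' : prime p \/ p = 0%N ->
  models M (ACFC_p ACFC p) -> models M' (ACFC_p ACFC p) -> elem_equiv M M'.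
Proof.
move=> hp mod mod'; have [U hU] := exists_nonprincipal_ultrafilter.
have acfc N : models N (ACFC_p ACFC p) -> is_model_of_ACFC N.
  by move=> modN; apply/hACFC => phi Aphi; apply: modN; left.
have [F [K [chi [cK chiP gen [wF wK] equiv]]]] := wide_model hACFC hU (acfc M mod).
have [F' [K' [chi' [cK' chiP' gen' [wF' wK'] equiv']]]] := wide_model hACFC hU (acfc M' mod').
have modF : models (Lstructure_of chi) (ACFC_p ACFC p).
  by apply: models_equiv mod => phi; rewrite equiv.
have modF' : models (Lstructure_of chi') (ACFC_p ACFC p).
  by apply: models_equiv mod' => phi; rewrite equiv'.
have cF := pchar_of_model hp modF modF'.
move=> phi; rewrite -equiv -equiv'.
exact: equiv_of_pchar.
Qed.
End Completeness.

Local Close Scope ring_scope.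

Theorem theorem1p4 (ACFC : theory) (hACFC : axiomatizes_ACFC ACFC)
    (p : nat) (hp : prime p \/ p = 0) :
  complete (ACFC_p ACFC p).
Proof.
have cons := ACFC_p_consistent hACFC hp; split=> // phi; have [M modM] := cons.
have [Mphi|nMphi] := pselect (satisfies M phi); [left|right] => N modN.
  by apply/(ACFC_p_models_equiv hACFC hp modM modN phi).
by move=> Nphi; apply: nMphi; apply/(ACFC_p_models_equiv hACFC hp modM modN phi).
Qed.
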